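(* Let $\Omega$ be a bi-circularly symmetric, simply connected, proper subdomain of $\mathbb{C}$ containing $0$. Let $f$ be the unique conformal mapping of $\mathbb{D}$ onto $\Omega$ satisfying $f(0)=0$ and $f'(0)>0$. Then: (i) the function $x\mapsto f(x)$ is real-valued, increasing and convex on $[0,1)$, and positive on $(0,1)$; (ii) the function $y\mapsto -if(iy)$ is real-valued, increasing and concave on $[0,1)$, and positive on $(0,1)$.
   Context: $\mathbb{D}=\{z\in\mathbb{C}:|z|<1\}$. A domain is a nonempty connected open subset of $\mathbb{C}$; a conformal mapping of $\mathbb{D}$ onto $\Omega$ is a holomorphic bijection $\mathbb{D}\to\Omega$. A plane domain $\Omega$ is called bi-circularly symmetric if its intersection with each circle centred at $0$ is either empty, or the whole circle, or the union of two subarcs of equal length centred respectively on the positive and negative real axes (i.e. the midpoints of the two subarcs lie on the positive and on the negative real axis respectively). *)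

(* Defs.v *)
From Stdlib Require Import Reals.
From Coquelicot Require Import Coquelicot.
Open Scope R_scope.

Definition unit_disc (z : C) : Prop := Cmod z < 1.

Definition connected_set (A : C -> Prop) : Prop :=
  forall U V : C -> Prop,
    open U -> open V ->
    (forall z, A z -> U z \/ V z) ->
    (exists z, A z /\ U z) -> (exists z, A z /\ V z) ->
    exists z, A z /\ U z /\ V z.

Definition plane_domain (Omega : C -> Prop) : Prop :=
  (exists z, Omega z) /\ open Omega /\ connected_set Omega.

Definition I01 (t : R) : Prop := 0 <= t <= 1.

(* Only the restriction of [gamma] to [0,1] matters; continuity at the
   endpoints is one-sided. *)
Definition path_in (A : C -> Prop) (gamma : R -> C) : Prop :=
  continuous_on I01 gamma /\ forall t, I01 t -> A (gamma t).

Definition path_connected (A : C -> Prop) : Prop :=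
  forall z w : C, A z -> A w ->
    exists gamma, path_in A gamma /\ gamma 0 = z /\ gamma 1 = w.

(* In [H (s, t)], [s] is the deformation parameter and [t] the parameter along
   the loop; the base point stays fixed. *)
Definition null_homotopic (A : C -> Prop) (gamma : R -> C) : Prop :=
  exists H : R * R -> C,
    continuous_on (fun p => I01 (fst p) /\ I01 (snd p)) H /\
    (forall s t, I01 s -> I01 t -> A (H (s, t))) /\
    (forall t, I01 t -> H (0, t) = gamma t) /\
    (forall t, I01 t -> H (1, t) = gamma 0) /\
    (forall s, I01 s -> H (s, 0) = gamma 0 /\ H (s, 1) = gamma 0).

Definition simply_connected (A : C -> Prop) : Prop :=
  path_connected A /\
  forall gamma, path_in A gamma -> gamma 0 = gamma 1 -> null_homotopic A gamma.

(* Open arc of the circle [|z| = r] with midpoint [r e^{i c}] and angular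
   length [2 theta]. *)
Definition arc (r c theta : R) (z : C) : Prop :=
  exists t : R, Rabs (t - c) < theta /\ z = (r * cos t, r * sin t).

(* This is a property of plane domains, i.e. open sets, whose traces on circles
   are relatively open: a proper subarc occurring as a component of such a trace
   is an open arc. For [theta = PI / 2] the trace omits exactly the two points
   [r i] and [- r i]. *)
Definition bi_circularly_symmetric (Omega : C -> Prop) : Prop :=
  forall r : R, 0 < r ->
    (forall z, Cmod z = r -> ~ Omega z) \/
    (forall z, Cmod z = r -> Omega z) \/
    (exists theta : R, 0 < theta <= PI / 2 /\
       forall z, Cmod z = r ->
         (Omega z <-> arc r 0 theta z \/ arc r PI theta z)).

Definition holomorphic_on (A : C -> Prop) (f : C -> C) : Prop :=
  forall z : C, A z -> ex_derive (K := C_AbsRing) f z.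

(* Only the values of [f] on the disc matter. *)
Definition conformal_mapping (f : C -> C) (Omega : C -> Prop) : Prop :=
  holomorphic_on unit_disc f /\
  (forall z, unit_disc z -> Omega (f z)) /\
  (forall z w, unit_disc z -> unit_disc w -> f z = f w -> z = w) /\
  (forall w, Omega w -> exists z, unit_disc z /\ f z = w).

Definition strictly_increasing_on (D : R -> Prop) (g : R -> R) : Prop :=
  forall x y, D x -> D y -> x < y -> g x < g y.

Definition convex_on (D : R -> Prop) (g : R -> R) : Prop :=
  forall x y t, D x -> D y -> 0 <= t <= 1 ->
    g (t * x + (1 - t) * y) <= t * g x + (1 - t) * g y.

Definition concave_on (D : R -> Prop) (g : R -> R) : Prop :=
  forall x y t, D x -> D y -> 0 <= t <= 1 ->
    t * g x + (1 - t) * g y <= g (t * x + (1 - t) * y).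

Definition real_valued_on (D : R -> Prop) (h : R -> C) : Prop :=
  forall x, D x -> Im (h x) = 0.

(* Main.v *)
(* Write P(z) = z f'(z) / f(z).  Symmetry of Omega in both axes and uniqueness of
   the Riemann map make f odd and commute with conjugation, so f is real on the
   real axis, imaginary on the imaginary axis, and P is real on both.

   The key inequality is Im P >= 0 wherever f(z) lies in the open first quadrant.
   Since d/d(phi) of log |f^-1 (rho e^(i phi))| is Im P / |P|^2, it says that
   |f^-1| increases along circular arcs from the real to the imaginary axis.  By
   bi-circular symmetry, reflecting the part of Omega in the sector
   alpha < arg < alpha + pi/2 in the line arg = alpha stays inside Omega, and the
   maximum principle applied to f^-1(reflection of f(z)) / z compares |f^-1| at a
   point and at its mirror image.

   Differentiating Im P = 0 transversally to the axes, x f'(x) / f(x) is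
   increasing and >= 1 on [0,1), and the analogous quotient on the imaginary axis
   is decreasing and <= 1.  Writing f = z phi, so that f' = P phi, these
   inequalities make both P and phi, hence f', monotone along each axis. *)

(* Nothing is known about [f] near the unit circle, so the function fed to the maximum principle
   need not extend there. The principle is therefore proved for open subsets of the disc with a
   limsup condition at the boundary: at points of the unit circle the bound |k| < 1 on the numerator
   of k(z) / z is enough, and only boundary points inside the disc require the symmetry of [f].

   The reflection is used for lines close to the real axis. The reflection in arg = t/2 followed by
   conjugation is the rotation by -t, so letting t tend to 0 from the right turns the comparison of
   moduli at mirror points into the sign of one derivative.

   The function theory is local: Goursat on rectangles, primitives on squares, Cauchy's formula on a
   small circle. [P] contains f', so its derivative requires f to be twice differentiable. Openness
   of [f] and f' <> 0 come from injectivity through the mean value inequality for a reciprocal,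
   without counting zeros. *)
Require Import Defs.
From Stdlib Require Import Reals Ranalysis5 Lra List ClassicalEpsilon.
From Coquelicot Require Import Coquelicot.
Open Scope R_scope.
Set Bullet Behavior "Strict Subproofs".

(** * Calculus along a parametrization *)

Section Continuity.
Context {U : UniformSpace}.

Lemma continuous_locally {V : UniformSpace} (f : U -> V) (x : U) (P : V -> Prop) :
  continuous f x -> locally (f x) P -> locally x (fun y => P (f y)).
Proof. intros H HP; exact (H P HP). Qed.

Lemma continuous_C_pair (f : U -> C) (x : U) :
  continuous (fun y => fst (f y)) x -> continuous (fun y => snd (f y)) x ->
  continuous f x.
Proof.
intros H1 H2.
apply continuous_ext with (fun y => (fst (f y), snd (f y))).
- intros y; now destruct (f y).
- intros P [eps HP]; change (locally x (fun y => P (fst (f y), snd (f y)))).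
  generalize (filter_and _ _ (continuous_locally _ _ _ H1 (locally_ball _ eps))
                         (continuous_locally _ _ _ H2 (locally_ball _ eps))).
  apply filter_imp; intros y [A B]; apply HP; split; assumption.
Qed.

Lemma continuous_C_fst (f : U -> C) (x : U) :
  continuous f x -> continuous (fun y => fst (f y)) x.
Proof. intros H; apply (continuous_comp f fst); [exact H | apply continuous_fst]. Qed.

Lemma continuous_C_snd (f : U -> C) (x : U) :
  continuous f x -> continuous (fun y => snd (f y)) x.
Proof. intros H; apply (continuous_comp f snd); [exact H | apply continuous_snd]. Qed.

Lemma continuous_Cplus (f g : U -> C) (x : U) :
  continuous f x -> continuous g x -> continuous (fun y => Cplus (f y) (g y)) x.
Proof.
intros Hf Hg; apply continuous_C_pair; simpl;
  apply (continuous_plus (V := R_NormedModule));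
  auto using continuous_C_fst, continuous_C_snd.
Qed.

Lemma continuous_Copp (f : U -> C) (x : U) :
  continuous f x -> continuous (fun y => Copp (f y)) x.
Proof.
intros Hf; apply continuous_C_pair; simpl;
  apply (continuous_opp (V := R_NormedModule));
  auto using continuous_C_fst, continuous_C_snd.
Qed.

Lemma continuous_Cminus (f g : U -> C) (x : U) :
  continuous f x -> continuous g x -> continuous (fun y => Cminus (f y) (g y)) x.
Proof. intros Hf Hg; apply continuous_Cplus; auto using continuous_Copp. Qed.

Lemma continuous_Rmult (f g : U -> R) (x : U) :
  continuous f x -> continuous g x -> continuous (fun y => f y * g y) x.
Proof. intros Hf Hg; apply (continuous_mult (K := R_AbsRing)); auto. Qed.

Lemma continuous_Rplus (f g : U -> R) (x : U) :
  continuous f x -> continuous g x -> continuous (fun y => f y + g y) x.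
Proof. intros Hf Hg; apply (continuous_plus (V := R_NormedModule)); auto. Qed.

Lemma continuous_Cmult (f g : U -> C) (x : U) :
  continuous f x -> continuous g x -> continuous (fun y => Cmult (f y) (g y)) x.
Proof.
intros Hf Hg; apply continuous_C_pair; simpl.
- apply (continuous_minus (V := R_NormedModule)); apply continuous_Rmult;
  auto using continuous_C_fst, continuous_C_snd.
- apply continuous_Rplus; apply continuous_Rmult;
  auto using continuous_C_fst, continuous_C_snd.
Qed.

Lemma continuous_Cconj (f : U -> C) (x : U) :
  continuous f x -> continuous (fun y => Cconj (f y)) x.
Proof.
intros Hf; apply continuous_C_pair; simpl.
- now apply continuous_C_fst.
- apply (continuous_opp (V := R_NormedModule)); now apply continuous_C_snd.
Qed.

Lemma continuous_Cmod (f : U -> C) (x : U) :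
  continuous f x -> continuous (fun y => Cmod (f y)) x.
Proof.
intros Hf; unfold Cmod.
apply (continuous_comp (fun y => fst (f y) ^ 2 + snd (f y) ^ 2) sqrt).
- apply continuous_Rplus; simpl; apply continuous_Rmult;
    try (apply continuous_Rmult); try apply continuous_const;
    auto using continuous_C_fst, continuous_C_snd.
- apply continuous_sqrt.
Qed.

Lemma continuous_RtoC (f : U -> R) (x : U) :
  continuous f x -> continuous (fun y => RtoC (f y)) x.
Proof.
intros Hf; apply continuous_C_pair; simpl; [exact Hf | apply continuous_const].
Qed.

Lemma continuous_Cinv (f : U -> C) (x : U) :
  continuous f x -> f x <> RtoC 0 -> continuous (fun y => Cinv (f y)) x.
Proof.
intros Hf H0.
assert (N : fst (f x) ^ 2 + snd (f x) ^ 2 <> 0).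
{ intro E; apply H0, Cmod_eq_0; unfold Cmod; rewrite E; apply sqrt_0. }
assert (K : continuous (fun y => / (fst (f y) ^ 2 + snd (f y) ^ 2)) x).
{ apply (continuous_comp (fun y => fst (f y) ^ 2 + snd (f y) ^ 2) Rinv);
    [ | now apply continuous_Rinv].
  apply continuous_Rplus; simpl; apply continuous_Rmult;
    try (apply continuous_Rmult); try apply continuous_const;
    auto using continuous_C_fst, continuous_C_snd. }
unfold Cinv; apply continuous_C_pair; simpl fst; simpl snd; unfold Rdiv;
  apply continuous_Rmult; try exact K.
- now apply continuous_C_fst.
- apply (continuous_opp (V := R_NormedModule)); now apply continuous_C_snd.
Qed.

Lemma continuous_Cdiv (f g : U -> C) (x : U) :
  continuous f x -> continuous g x -> g x <> RtoC 0 ->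
  continuous (fun y => Cdiv (f y) (g y)) x.
Proof. intros; apply continuous_Cmult; auto using continuous_Cinv. Qed.

Lemma locally_Cneq0 (f : U -> C) (x : U) :
  continuous f x -> f x <> RtoC 0 -> locally x (fun y => f y <> RtoC 0).
Proof.
intros Hf H0.
assert (P : 0 < Cmod (f x)) by now apply Cmod_gt_0.
generalize (continuous_locally _ _ _ (continuous_Cmod f x Hf) (locally_ball (Cmod (f x)) (mkposreal _ P))).
apply filter_imp; intros y B E.
change (Rabs (Cmod (f y) - Cmod (f x)) < Cmod (f x)) in B.
rewrite E, Cmod_0 in B; apply Rabs_def2 in B; lra.
Qed.

End Continuity.

(* Caratheodory's form of differentiability.  With [iota] the identity of [C]
   this is complex differentiability, with [iota := RtoC] it is
   differentiability of a path; the calculus rules are common to both. *)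
Definition has_slope {U : UniformSpace} (iota : U -> C) (f : U -> C) (x : U) (l : C) :=
  exists phi : U -> C, continuous phi x /\ phi x = l /\
    locally x (fun y => f y = Cplus (f x) (Cmult (phi y) (Cminus (iota y) (iota x)))).

Notation Cdiff := (has_slope (fun z : C => z)).
Notation Pdiff := (has_slope (U := R_UniformSpace) RtoC).

Section Slopes.
Context {U : UniformSpace} (iota : U -> C) (x : U).
Hypothesis iota_cont : continuous iota x.
Notation D := (has_slope iota).

Lemma slope_continuous f l : D f x l -> continuous f x.
Proof.
intros (phi & Hc & _ & He).
apply continuous_ext_loc with (fun y => Cplus (f x) (Cmult (phi y) (Cminus (iota y) (iota x)))).
- revert He; apply filter_imp; congruence.
- apply continuous_Cplus; [apply continuous_const | apply continuous_Cmult; [exact Hc |]].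
  apply continuous_Cminus; [exact iota_cont | apply continuous_const].
Qed.

Lemma slope_ext_loc f g l : locally x (fun y => f y = g y) -> D f x l -> D g x l.
Proof.
intros E (phi & Hc & Hl & He); exists phi; split; [exact Hc | split; [exact Hl |]].
generalize (filter_and _ _ E He); apply filter_imp; intros y [A B].
rewrite <- A, B, (locally_singleton _ _ E); reflexivity.
Qed.

Lemma slope_eq f l l' : D f x l -> l = l' -> D f x l'.
Proof. intros; subst; assumption. Qed.

Lemma slope_const a : D (fun _ => a) x (RtoC 0).
Proof.
exists (fun _ => RtoC 0); split; [apply continuous_const | split; [reflexivity |]].
apply filter_forall; intros; ring.
Qed.

Lemma slope_iota : D iota x (RtoC 1).
Proof.
exists (fun _ => RtoC 1); split; [apply continuous_const | split; [reflexivity |]].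
apply filter_forall; intros; ring.
Qed.

Lemma slope_plus f g l m :
  D f x l -> D g x m -> D (fun y => Cplus (f y) (g y)) x (Cplus l m).
Proof.
intros (p & Pc & Pl & Pe) (q & Qc & Ql & Qe).
exists (fun y => Cplus (p y) (q y)); split; [now apply continuous_Cplus | split; [congruence |]].
generalize (filter_and _ _ Pe Qe); apply filter_imp; intros y [-> ->]; ring.
Qed.

Lemma slope_mult f g l m :
  D f x l -> D g x m ->
  D (fun y => Cmult (f y) (g y)) x (Cplus (Cmult l (g x)) (Cmult (f x) m)).
Proof.
intros Hf Hg; assert (Cg := slope_continuous g m Hg).
destruct Hf as (p & Pc & Pl & Pe), Hg as (q & Qc & Ql & Qe).
exists (fun y => Cplus (Cmult (p y) (g y)) (Cmult (f x) (q y))); split; [ | split; [congruence |]].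
- apply continuous_Cplus; apply continuous_Cmult; auto; apply continuous_const.
- generalize (filter_and _ _ Pe Qe); apply filter_imp; intros y [A B]; rewrite A, B; ring.
Qed.

Lemma slope_scal f a l : D f x l -> D (fun y => Cmult a (f y)) x (Cmult a l).
Proof.
intros H; eapply slope_eq; [apply slope_mult; [apply slope_const | exact H] | simpl; ring].
Qed.

Lemma slope_opp f l : D f x l -> D (fun y => Copp (f y)) x (Copp l).
Proof.
intros H; apply slope_ext_loc with (fun y => Cmult (Copp (RtoC 1)) (f y)).
- apply filter_forall; intros; ring.
- eapply slope_eq; [now apply slope_scal, H | ring].
Qed.

Lemma slope_minus f g l m :
  D f x l -> D g x m -> D (fun y => Cminus (f y) (g y)) x (Cminus l m).
Proof. intros; apply slope_plus; [ | apply slope_opp]; assumption. Qed.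

Lemma slope_inv f l :
  D f x l -> f x <> RtoC 0 ->
  D (fun y => Cinv (f y)) x (Copp (Cdiv l (Cmult (f x) (f x)))).
Proof.
intros Hf H0; assert (Cf := slope_continuous f l Hf).
destruct Hf as (p & Pc & Pl & Pe).
exists (fun y => Copp (Cdiv (p y) (Cmult (f y) (f x)))); split; [ | split; [congruence |]].
- apply continuous_Copp, continuous_Cdiv; [exact Pc | | now apply Cmult_neq_0].
  apply continuous_Cmult; [exact Cf | apply continuous_const].
- generalize (filter_and _ _ Pe (locally_Cneq0 f x Cf H0)); apply filter_imp; intros y [A B].
  assert (E : Cmult (p y) (Cminus (iota y) (iota x)) = Cminus (f y) (f x)) by (rewrite A; ring).
  replace (Cmult (Copp (Cdiv (p y) (Cmult (f y) (f x)))) (Cminus (iota y) (iota x)))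
    with (Copp (Cdiv (Cmult (p y) (Cminus (iota y) (iota x))) (Cmult (f y) (f x))))
    by (field; now split).
  rewrite E; field; now split.
Qed.

Lemma slope_div f g l m :
  D f x l -> D g x m -> g x <> RtoC 0 ->
  D (fun y => Cdiv (f y) (g y)) x
    (Cdiv (Cminus (Cmult l (g x)) (Cmult (f x) m)) (Cmult (g x) (g x))).
Proof.
intros Hf Hg H0; eapply slope_eq; [apply slope_mult; [exact Hf | apply slope_inv; eassumption] |].
simpl; field; assumption.
Qed.

(** The outer function is always complex: the two choices of [iota] give the chain rule for
    holomorphic maps and the one for a holomorphic map along a path. *)
Lemma slope_comp (F : C -> C) f L l :
  Cdiff F (f x) L -> D f x l -> D (fun y => F (f y)) x (Cmult L l).
Proof.
intros HF Hf; assert (Cf := slope_continuous f l Hf).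
destruct HF as (P & PC & PL & PE), Hf as (p & Pc & Pl & Pe).
exists (fun y => Cmult (P (f y)) (p y)); split; [ | split; [congruence |]].
- apply continuous_Cmult; [ | exact Pc].
  apply continuous_comp; assumption.
- generalize (filter_and _ _ Pe (continuous_locally _ _ _ Cf PE)); apply filter_imp; intros y [A B].
  rewrite B; rewrite A at 2; ring.
Qed.

End Slopes.

Lemma im_le_Cmod (z : C) : Rabs (Im z) <= Cmod z.
Proof. apply Rle_trans with (2 := Rmax_Cmod z), Rmax_r. Qed.

Lemma Cball_le (z w : C) (e : R) : Cmod (Cminus w z) < e -> ball z e w.
Proof.
intros H; split; apply Rle_lt_trans with (2 := H).
- exact (re_le_Cmod (Cminus w z)).
- exact (im_le_Cmod (Cminus w z)).
Qed.

Lemma Cmod_le_abs (z : C) : Cmod z <= Rabs (fst z) + Rabs (snd z).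
Proof.
apply Rle_trans with (2 := Rle_refl _).
unfold Cmod; rewrite <- (sqrt_Rsqr (Rabs (fst z) + Rabs (snd z))).
- apply sqrt_le_1_alt; unfold Rsqr.
  rewrite <- (pow2_abs (fst z)), <- (pow2_abs (snd z)).
  assert (0 <= Rabs (fst z) * Rabs (snd z)) by (apply Rmult_le_pos; apply Rabs_pos); nra.
- assert (A := Rabs_pos (fst z)); assert (B := Rabs_pos (snd z)); lra.
Qed.

(** Neighbourhoods in [C] are made of coordinatewise balls, while all estimates below are in [Cmod];
    each kind of ball contains one of the other kind, at the cost of a factor 2. *)
Lemma locally_C_eps (P : C -> Prop) (z : C) :
  locally z P <-> exists d, 0 < d /\ forall w, Cmod (Cminus w z) < d -> P w.
Proof.
split.
- intros [d H]; exists d; split; [apply cond_pos |]; intros w Hw; apply H, Cball_le, Hw.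
- intros (d & d0 & H).
  assert (d2 : 0 < d / 2) by lra.
  exists (mkposreal _ d2); intros w [A B]; apply H.
  change (Rabs (fst w - fst z) < d / 2) in A; change (Rabs (snd w - snd z) < d / 2) in B.
  apply Rle_lt_trans with (1 := Cmod_le_abs _); simpl.
  change (Rabs (fst w - fst z) + Rabs (snd w - snd z) < d); lra.
Qed.

Lemma continuous_C_eps {U : UniformSpace} (f : U -> C) (x : U) :
  continuous f x <->
  forall e, 0 < e -> locally x (fun y => Cmod (Cminus (f y) (f x)) < e).
Proof.
split.
- intros H e e0; apply (H (fun w => Cmod (Cminus w (f x)) < e)).
  apply locally_C_eps; exists e; auto.
- intros H P HP; apply locally_C_eps in HP; destruct HP as (d & d0 & HP).
  change (locally x (fun y => P (f y))); generalize (H d d0); apply filter_imp; auto.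
Qed.

Lemma is_derive_Cdiff (f : C -> C) (z l : C) :
  is_derive (K := C_AbsRing) (V := C_NormedModule) f z l -> Cdiff f z l.
Proof.
intros [_ H]; specialize (H z (fun P HP => HP)).
exists (fun w => if Ceq_dec w z then l else Cdiv (Cminus (f w) (f z)) (Cminus w z)).
split; [ | split].
- apply continuous_C_eps; intros e e0.
  destruct (Ceq_dec z z) as [_ | []]; [ | reflexivity].
  assert (e2 : 0 < e / 2) by lra.
  destruct (H (mkposreal _ e2)) as [d Hd]; apply locally_C_eps; exists d; split; [apply cond_pos |].
  (* The filter inside [is_derive] is that of [C_AbsRing], whose balls are already [Cmod] balls. *)
  intros w Hw; specialize (Hd w Hw); rename Hw into Hb, Hd into Hw.
  destruct (Ceq_dec w z) as [-> | N].
  { replace (Cminus l l) with (RtoC 0) by ring; now rewrite Cmod_0. }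
  assert (N' : Cminus w z <> RtoC 0) by (intro E; apply N; apply Ceq_minus, E).
  assert (P : 0 < Cmod (Cminus w z)) by now apply Cmod_gt_0.
  replace (Cminus (Cdiv (Cminus (f w) (f z)) (Cminus w z)) l)
    with (Cdiv (Cminus (Cminus (f w) (f z)) (Cmult (Cminus w z) l)) (Cminus w z)) by (field; exact N').
  rewrite Cmod_div by exact N'.
  apply Rmult_lt_reg_r with (1 := P).
  unfold Rdiv; rewrite Rmult_assoc, Rinv_l, Rmult_1_r by lra.
  apply Rle_lt_trans with (1 := Hw).
  change (e / 2 * Cmod (Cminus w z) < e * Cmod (Cminus w z)); nra.
- destruct (Ceq_dec z z) as [_ | []]; reflexivity.
- apply filter_forall; intros w; destruct (Ceq_dec w z) as [-> | N]; [ring |].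
  field; intro E; apply N; apply Ceq_minus, E.
Qed.

Lemma Cdiff_is_derive (f : C -> C) (z l : C) :
  Cdiff f z l -> is_derive (K := C_AbsRing) (V := C_NormedModule) f z l.
Proof.
intros (phi & Hc & Hl & He); split; [apply is_linear_scal_l |].
intros x Hx e.
assert (E : z = x) by (apply (is_filter_lim_locally_unique (V := AbsRing_NormedModule C_AbsRing)), Hx); subst x.
destruct (proj1 (locally_C_eps _ _) (filter_and _ _ He (proj1 (continuous_C_eps _ _) Hc e (cond_pos e))))
  as (d & d0 & Hd).
exists (mkposreal d d0); intros w Hw; destruct (Hd w Hw) as [A B].
change (Cmod (Cminus (Cminus (f w) (f z)) (Cmult (Cminus w z) l)) <= e * Cmod (Cminus w z)).
rewrite A, <- Hl.
replace (Cminus (Cminus (Cplus (f z) (Cmult (phi w) (Cminus w z))) (f z)) (Cmult (Cminus w z) (phi z)))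
  with (Cmult (Cminus (phi w) (phi z)) (Cminus w z)) by ring.
rewrite Cmod_mult; apply Rmult_le_compat_r; [apply Cmod_ge_0 | lra].
Qed.

Lemma R_slope (F : R -> R) (psi : R -> R) (t : R) :
  continuous psi t -> locally t (fun s => F s = F t + psi s * (s - t)) ->
  is_derive F t (psi t).
Proof.
intros Hc He; apply is_derive_Reals; intros e e0.
destruct He as [d1 H1]; destruct (Hc _ (locally_ball (psi t) (mkposreal e e0))) as [d2 H2].
assert (d0 : 0 < Rmin d1 d2) by (apply Rmin_case; apply cond_pos).
exists (mkposreal _ d0); intros h hn hd; simpl in hd.
assert (B1 : ball t d1 (t + h)).
{ change (Rabs (t + h - t) < d1); replace (t + h - t) with h by ring.
  apply Rlt_le_trans with (1 := hd), Rmin_l. }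
assert (B2 : ball t d2 (t + h)).
{ change (Rabs (t + h - t) < d2); replace (t + h - t) with h by ring.
  apply Rlt_le_trans with (1 := hd), Rmin_r. }
rewrite (H1 _ B1); specialize (H2 _ B2).
change (Rabs (psi (t + h) - psi t) < e) in H2.
replace ((F t + psi (t + h) * (t + h - t) - F t) / h - psi t) with (psi (t + h) - psi t); [exact H2 |].
field; exact hn.
Qed.

Lemma R_slope_inv (F : R -> R) (t l : R) :
  is_derive F t l ->
  exists psi, continuous psi t /\ psi t = l /\ forall s, F s = F t + psi s * (s - t).
Proof.
intros H; apply is_derive_Reals in H.
assert (E' : forall a b : R, a + (b - a) = b) by (intros; ring).
exists (fun s => if Req_EM_T s t then l else (F s - F t) / (s - t)).
split; [ | split].
- intros P [e HP].
  destruct (H e (cond_pos e)) as [d Hd]; exists d; intros s Hs.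
  change (Rabs (s - t) < d) in Hs; apply HP.
  destruct (Req_EM_T t t) as [_ | []]; [ | reflexivity].
  destruct (Req_EM_T s t) as [E | N]; [apply ball_center |].
  specialize (Hd (s - t)); rewrite E' in Hd.
  apply Hd; [now apply Rminus_eq_contra | exact Hs].
- destruct (Req_EM_T t t) as [_ | []]; reflexivity.
- intros s; destruct (Req_EM_T s t) as [-> | N]; [ring | field; lra].
Qed.

Lemma Pdiff_is_derive (g : R -> C) (t : R) (l : C) :
  Pdiff g t l ->
  is_derive (fun s => fst (g s)) t (fst l) /\ is_derive (fun s => snd (g s)) t (snd l).
Proof.
intros (phi & Hc & <- & He); split.
- apply (R_slope _ (fun s => fst (phi s))); [now apply continuous_C_fst |].
  revert He; apply filter_imp; intros s ->; simpl; ring.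
- apply (R_slope _ (fun s => snd (phi s))); [now apply continuous_C_snd |].
  revert He; apply filter_imp; intros s ->; simpl; ring.
Qed.

Lemma is_derive_Pdiff (g : R -> C) (t : R) (l : C) :
  is_derive (fun s => fst (g s)) t (fst l) -> is_derive (fun s => snd (g s)) t (snd l) ->
  Pdiff g t l.
Proof.
intros H1 H2; apply R_slope_inv in H1; apply R_slope_inv in H2.
destruct H1 as (p & Pc & Pl & Pe), H2 as (q & Qc & Ql & Qe).
exists (fun s => (p s, q s)); split; [ | split].
- now apply continuous_C_pair.
- rewrite Pl, Ql; now destruct l.
- apply filter_forall; intros s; apply injective_projections; simpl.
  + refine (eq_trans (Pe s) _); ring.
  + refine (eq_trans (Qe s) _); ring.
Qed.

Lemma RtoC_cont (t : R) : continuous RtoC t.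
Proof. apply continuous_RtoC, continuous_id. Qed.

Definition Cdiff_continuous f z l : Cdiff f z l -> continuous f z :=
  slope_continuous (fun w : C => w) z (continuous_id z) f l.
Definition Cdiff_id z : Cdiff (fun w => w) z (RtoC 1) := slope_iota (fun w : C => w) z.
Definition Cdiff_const z a : Cdiff (fun _ => a) z (RtoC 0) := slope_const (fun w : C => w) z a.
Definition Cdiff_plus z := slope_plus (fun w : C => w) z.
Definition Cdiff_opp z := slope_opp (fun w : C => w) z (continuous_id z).
Definition Cdiff_minus z := slope_minus (fun w : C => w) z (continuous_id z).
Definition Cdiff_scal z := slope_scal (fun w : C => w) z (continuous_id z).
Definition Cdiff_mult z := slope_mult (fun w : C => w) z (continuous_id z).
Definition Cdiff_inv z := slope_inv (fun w : C => w) z (continuous_id z).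
Definition Cdiff_div z := slope_div (fun w : C => w) z (continuous_id z).
Definition Cdiff_comp z := slope_comp (fun w : C => w) z (continuous_id z).
Definition Pdiff_continuous (f : R -> C) t l : Pdiff f t l -> continuous f t :=
  slope_continuous RtoC t (RtoC_cont t) f l.
Definition Pdiff_const t a : Pdiff (fun _ => a) t (RtoC 0) := slope_const RtoC t a.
Definition Pdiff_RtoC t : Pdiff RtoC t (RtoC 1) := slope_iota RtoC t.
Definition Pdiff_plus t := slope_plus (U := R_UniformSpace) RtoC t.
Definition Pdiff_scal t := slope_scal (U := R_UniformSpace) RtoC t (RtoC_cont t).
Definition Pdiff_comp t := slope_comp (U := R_UniformSpace) RtoC t (RtoC_cont t).

(** * Integrals of paths and over rectangles *)

(** Coordinatewise, so that existence and the fundamental theorem are the real ones; [CI_correct]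
    and [CI_unique] pass to the integral in the product module, whose norm is [Cmod]. *)
Definition CI (g : R -> C) (a b : R) : C :=
  (RInt (fun t => fst (g t)) a b, RInt (fun t => snd (g t)) a b).

Definition cont_seg (g : R -> C) (a b : R) : Prop :=
  forall t, Rmin a b <= t <= Rmax a b -> continuous g t.

Lemma CI_unique (g : R -> C) (a b : R) (l : C) :
  is_RInt g a b l -> CI g a b = l.
Proof.
intros H; apply injective_projections; simpl; apply is_RInt_unique.
- now apply (is_RInt_fct_extend_fst (U := R_NormedModule) (V := R_NormedModule)).
- now apply (is_RInt_fct_extend_snd (U := R_NormedModule) (V := R_NormedModule)).
Qed.

Lemma CI_correct (g : R -> C) (a b : R) :
  cont_seg g a b -> is_RInt g a b (CI g a b).
Proof.
intros H; apply (is_RInt_fct_extend_pair (U := R_NormedModule) (V := R_NormedModule));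
  apply (RInt_correct (V := R_CompleteNormedModule)), ex_RInt_continuous;
  intros t Ht; [apply continuous_C_fst | apply continuous_C_snd]; auto.
Qed.

Lemma CI_ext (f g : R -> C) (a b : R) :
  (forall t, Rmin a b <= t <= Rmax a b -> f t = g t) -> CI f a b = CI g a b.
Proof.
intros H; unfold CI; f_equal; apply RInt_ext; intros t Ht; rewrite H; lra.
Qed.

Lemma CI_plus (f g : R -> C) (a b : R) :
  cont_seg f a b -> cont_seg g a b ->
  CI (fun t => Cplus (f t) (g t)) a b = Cplus (CI f a b) (CI g a b).
Proof.
intros Hf Hg; apply CI_unique.
apply (is_RInt_plus (V := prod_NormedModule R_AbsRing R_NormedModule R_NormedModule));
  now apply CI_correct.
Qed.

Lemma CI_scal (a0 : C) (g : R -> C) (a b : R) :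
  cont_seg g a b -> CI (fun t => Cmult a0 (g t)) a b = Cmult a0 (CI g a b).
Proof.
intros H; apply CI_unique.
assert (H1 : is_RInt (fun t => fst (g t)) a b (fst (CI g a b)))
  by (apply (is_RInt_fct_extend_fst (U := R_NormedModule) (V := R_NormedModule)), CI_correct, H).
assert (H2 : is_RInt (fun t => snd (g t)) a b (snd (CI g a b)))
  by (apply (is_RInt_fct_extend_snd (U := R_NormedModule) (V := R_NormedModule)), CI_correct, H).
apply (is_RInt_fct_extend_pair (U := R_NormedModule) (V := R_NormedModule)); simpl.
- apply (is_RInt_minus (V := R_NormedModule)); apply (is_RInt_scal (V := R_NormedModule)); assumption.
- apply (is_RInt_plus (V := R_NormedModule)); apply (is_RInt_scal (V := R_NormedModule)); assumption.
Qed.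

Lemma CI_minus (f g : R -> C) (a b : R) :
  cont_seg f a b -> cont_seg g a b ->
  CI (fun t => Cminus (f t) (g t)) a b = Cminus (CI f a b) (CI g a b).
Proof.
intros Hf Hg; apply CI_unique.
apply (is_RInt_minus (V := prod_NormedModule R_AbsRing R_NormedModule R_NormedModule));
  now apply CI_correct.
Qed.

Lemma CI_swap (g : R -> C) (a b : R) : cont_seg g a b -> CI g b a = Copp (CI g a b).
Proof.
intros H; apply CI_unique.
apply (is_RInt_swap (V := prod_NormedModule R_AbsRing R_NormedModule R_NormedModule)).
now apply CI_correct.
Qed.

Lemma CI_Chasles (g : R -> C) (a b c : R) :
  cont_seg g a b -> cont_seg g b c -> CI g a c = Cplus (CI g a b) (CI g b c).
Proof.
intros H1 H2; apply CI_unique.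
apply (is_RInt_Chasles (V := prod_NormedModule R_AbsRing R_NormedModule R_NormedModule)) with b;
  now apply CI_correct.
Qed.

Lemma CI_point (g : R -> C) (a : R) : CI g a a = RtoC 0.
Proof. unfold CI; now rewrite !RInt_point. Qed.

Lemma CI_const (a0 : C) (a b : R) : CI (fun _ => a0) a b = Cmult a0 (RtoC (b - a)).
Proof.
unfold CI; rewrite !RInt_const; apply injective_projections; simpl; unfold scal; simpl;
  unfold mult; simpl; ring.
Qed.

Lemma CI_le (g : R -> C) (h : R -> R) (a b l : R) :
  a <= b -> cont_seg g a b -> (forall t, a <= t <= b -> Cmod (g t) <= h t) ->
  is_RInt h a b l -> Cmod (CI g a b) <= l.
Proof.
intros Hab Hg Hh Hl; rewrite Cmod_norm.
apply (norm_RInt_le (V := prod_NormedModule R_AbsRing R_NormedModule R_NormedModule) g h a b);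
  [exact Hab | | now apply CI_correct | exact Hl].
intros t Ht; rewrite <- Cmod_norm; auto.
Qed.

Lemma CI_le_const (g : R -> C) (M a b : R) :
  cont_seg g a b -> (forall t, Rmin a b <= t <= Rmax a b -> Cmod (g t) <= M) ->
  Cmod (CI g a b) <= M * Rabs (b - a).
Proof.
assert (K : forall x y, x <= y -> cont_seg g x y ->
   (forall t, x <= t <= y -> Cmod (g t) <= M) -> Cmod (CI g x y) <= M * (y - x)).
{ intros x y Hxy Hg Hh; apply (CI_le g (fun _ => M)); auto.
  replace (M * (y - x)) with (scal (y - x) M) by (unfold scal; simpl; unfold mult; simpl; ring).
  apply (is_RInt_const (V := R_NormedModule)). }
intros Hg Hh; destruct (Rle_dec a b) as [H | H].
- rewrite Rmin_left, Rmax_right in Hh by exact H.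
  rewrite Rabs_pos_eq by lra; now apply K.
- rewrite CI_swap, Cmod_opp by (unfold cont_seg in *; now rewrite Rmin_comm, Rmax_comm).
  rewrite Rmin_right, Rmax_left in Hh by lra.
  rewrite Rabs_left1 by lra; replace (- (b - a)) with (a - b) by ring.
  apply K; [lra | unfold cont_seg in *; now rewrite Rmin_comm, Rmax_comm | exact Hh].
Qed.

Lemma CI_derive (F g : R -> C) (a b : R) :
  (forall t, Rmin a b <= t <= Rmax a b -> Pdiff F t (g t)) -> cont_seg g a b ->
  CI g a b = Cminus (F b) (F a).
Proof.
intros HF Hg; apply injective_projections; simpl; apply is_RInt_unique.
- apply (is_RInt_derive (V := R_CompleteNormedModule) (fun t => fst (F t))); intros t Ht.
  + now apply Pdiff_is_derive, HF.
  + now apply continuous_C_fst, Hg.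
- apply (is_RInt_derive (V := R_CompleteNormedModule) (fun t => snd (F t))); intros t Ht.
  + now apply Pdiff_is_derive, HF.
  + now apply continuous_C_snd, Hg.
Qed.

Lemma nested_intervals (x W : nat -> R) :
  (forall n, 0 <= W n) -> (forall n, x n <= x (S n)) ->
  (forall n, x (S n) + W (S n) <= x n + W n) ->
  exists p, forall n, x n <= p <= x n + W n.
Proof.
intros HW Hx Hd.
assert (A : forall n m, x n <= x (n + m)%nat).
{ intros n; induction m as [|m IH]; [rewrite Nat.add_0_r; lra |].
  rewrite Nat.add_succ_r; specialize (Hx (n + m)%nat); lra. }
assert (B : forall n m, x (n + m)%nat + W (n + m)%nat <= x n + W n).
{ intros n; induction m as [|m IH]; [rewrite Nat.add_0_r; lra |].
  rewrite Nat.add_succ_r; specialize (Hd (n + m)%nat); lra. }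
assert (E : forall n m, x m <= x n + W n).
{ intros n m; apply Rle_trans with (1 := A m n); rewrite Nat.add_comm.
  specialize (B n m); specialize (HW (n + m)%nat); lra. }
destruct (completeness (fun r => exists n, r = x n)) as [p [Hp1 Hp2]].
- exists (x 0%nat + W 0%nat); intros r [n ->]; apply E.
- exists (x 0%nat), 0%nat; reflexivity.
- exists p; intros n; split.
  + apply Hp1; now exists n.
  + apply Hp2; intros r [m ->]; apply E.
Qed.

(** Compactness in the form that Goursat's argument needs: a property inherited by one of the four
    quarters persists at every scale around one point. Sides may be zero. *)
Lemma bisection (P : R -> R -> R -> R -> Prop) (a c w h : R) :
  (forall x y w h, P x y w h ->
     P x y (w / 2) (h / 2) \/ P (x + w / 2) y (w / 2) (h / 2) \/
     P x (y + h / 2) (w / 2) (h / 2) \/ P (x + w / 2) (y + h / 2) (w / 2) (h / 2)) ->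
  0 <= w -> 0 <= h -> P a c w h ->
  exists p q, forall d, 0 < d -> exists x y w' h',
    0 <= w' < d /\ 0 <= h' < d /\ x <= p <= x + w' /\ y <= q <= y + h' /\ P x y w' h'.
Proof.
intros Hs Hw Hh H0.
set (W := fun n => w / 2 ^ n); set (H := fun n => h / 2 ^ n).
(* The first quarter with the property is taken; the fourth is the default, and [HP] shows that it
   has the property when the other three fail. *)
set (nxt := fun (n : nat) (u : R * R) =>
  let (x, y) := u in
  if excluded_middle_informative (P x y (W (S n)) (H (S n))) then (x, y) else
  if excluded_middle_informative (P (x + W (S n)) y (W (S n)) (H (S n))) then (x + W (S n), y) else
  if excluded_middle_informative (P x (y + H (S n)) (W (S n)) (H (S n))) then (x, y + H (S n)) else
  (x + W (S n), y + H (S n))).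
set (u := fix u n := match n with O => (a, c) | S k => nxt k (u k) end).
assert (p2 : forall n, 0 < 2 ^ n) by (intros; apply pow_lt; lra).
assert (EW : forall n, W n / 2 = W (S n)).
{ intros n; unfold W; simpl; field; apply Rgt_not_eq, p2. }
assert (EH : forall n, H n / 2 = H (S n)).
{ intros n; unfold H; simpl; field; apply Rgt_not_eq, p2. }
assert (W0 : forall n, 0 <= W n).
{ intros n; apply Rmult_le_pos; [exact Hw | left; apply Rinv_0_lt_compat, p2]. }
assert (H0' : forall n, 0 <= H n).
{ intros n; apply Rmult_le_pos; [exact Hh | left; apply Rinv_0_lt_compat, p2]. }
assert (HP : forall n, P (fst (u n)) (snd (u n)) (W n) (H n)).
{ induction n as [|n IH].
  - unfold W, H; simpl; unfold Rdiv; now rewrite Rinv_1, !Rmult_1_r.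
  - change (u (S n)) with (nxt n (u n)); apply Hs in IH; rewrite EW, EH in IH.
    destruct (u n) as [x y]; unfold nxt; simpl in IH.
    repeat destruct excluded_middle_informative; simpl; tauto. }
assert (step : forall n,
  (fst (u (S n)) = fst (u n) \/ fst (u (S n)) = fst (u n) + W (S n)) /\
  (snd (u (S n)) = snd (u n) \/ snd (u (S n)) = snd (u n) + H (S n))).
{ intros n; change (u (S n)) with (nxt n (u n)); destruct (u n) as [x y]; unfold nxt; simpl.
  repeat destruct excluded_middle_informative; simpl; auto. }
destruct (nested_intervals (fun n => fst (u n)) W) as [p Hp]; auto.
{ intros n; specialize (W0 (S n)); destruct (step n) as [[-> | ->] _]; lra. }
{ intros n; specialize (W0 (S n)); specialize (EW n); destruct (step n) as [[-> | ->] _]; lra. }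
destruct (nested_intervals (fun n => snd (u n)) H) as [q Hq]; auto.
{ intros n; specialize (H0' (S n)); destruct (step n) as [_ [-> | ->]]; lra. }
{ intros n; specialize (H0' (S n)); specialize (EH n); destruct (step n) as [_ [-> | ->]]; lra. }
exists p, q; intros d d0.
destruct (cv_pow_half w d d0) as [n1 Hn1]; destruct (cv_pow_half h d d0) as [n2 Hn2].
set (n := (n1 + n2)%nat).
exists (fst (u n)), (snd (u n)), (W n), (H n).
assert (A1 : R_dist (w / 2 ^ n) 0 < d) by (apply Hn1; unfold n, ge; apply Nat.le_add_r).
assert (A2 : R_dist (h / 2 ^ n) 0 < d).
{ apply Hn2; unfold n, ge; rewrite Nat.add_comm; apply Nat.le_add_r. }
unfold R_dist in A1, A2; rewrite Rminus_0_r in A1, A2.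
repeat split; auto; try apply Hp; try apply Hq.
- apply Rle_lt_trans with (2 := A1), Rle_abs.
- apply Rle_lt_trans with (2 := A2), Rle_abs.
Qed.

(** The contour integral of f(z) dz, counterclockwise when a <= b and c <= d; exchanging the ends of
    either interval changes its sign. *)
Definition rect_int (f : C -> C) (a b c d : R) : C :=
  Cplus (Cminus (CI (fun x => f (x, c)) a b) (CI (fun x => f (x, d)) a b))
        (Cmult Ci (Cminus (CI (fun y => f (b, y)) c d) (CI (fun y => f (a, y)) c d))).

Definition box (c : C) (r : R) (z : C) : Prop :=
  Rabs (fst z - fst c) < r /\ Rabs (snd z - snd c) < r.

Definition in_rect (a b c d : R) (z : C) : Prop :=
  Rmin a b <= fst z <= Rmax a b /\ Rmin c d <= snd z <= Rmax c d.

Lemma cont_horizontal (f : C -> C) (x y : R) :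
  continuous f (x, y) -> continuous (fun s => f (s, y)) x.
Proof.
intros H; apply (continuous_comp (fun s => (s, y) : C) f); [ | exact H].
apply continuous_C_pair; [apply continuous_id | apply continuous_const].
Qed.

Lemma cont_vertical (f : C -> C) (x y : R) :
  continuous f (x, y) -> continuous (fun t => f (x, t)) y.
Proof.
intros H; apply (continuous_comp (fun t => (x, t) : C) f); [ | exact H].
apply continuous_C_pair; [apply continuous_const | apply continuous_id].
Qed.

Lemma Pdiff_horizontal (f : C -> C) (x y : R) (l : C) :
  Cdiff f (x, y) l -> Pdiff (fun s => f (s, y)) x l.
Proof.
intros H; eapply slope_eq; [apply (slope_comp RtoC x (RtoC_cont x) f (fun s => (s, y)) l (RtoC 1) H) | simpl; ring].
apply slope_ext_loc with (fun s => Cplus (RtoC s) (0, y)).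
- apply filter_forall; intros s; apply injective_projections; simpl; ring.
- eapply slope_eq; [apply slope_plus; [apply slope_iota | apply slope_const] | simpl; ring].
Qed.

Lemma Pdiff_vertical (f : C -> C) (x y : R) (l : C) :
  Cdiff f (x, y) l -> Pdiff (fun t => f (x, t)) y (Cmult l Ci).
Proof.
intros H; apply (slope_comp RtoC y (RtoC_cont y) f (fun t => (x, t)) l Ci H).
apply slope_ext_loc with (fun t => Cplus (Cmult Ci (RtoC t)) (RtoC x)).
- apply filter_forall; intros s; apply injective_projections; simpl; ring.
- eapply slope_eq; [apply slope_plus; [apply slope_scal; [apply RtoC_cont | apply slope_iota] | apply slope_const] | simpl; ring].
Qed.

Lemma Cmod_Ci : Cmod Ci = 1.
Proof.
unfold Cmod, Ci; simpl; replace (0 * (0 * 1) + 1 * (1 * 1)) with 1 by ring; apply sqrt_1.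
Qed.

Lemma Cmod_minus_le (u v : C) : Cmod (Cminus u v) <= Cmod u + Cmod v.
Proof. rewrite <- (Cmod_opp v); apply Cmod_triangle. Qed.

Section Rect.
Variables (f : C -> C) (a b c d : R).
Hypothesis fc : forall z, in_rect a b c d z -> continuous f z.

Lemma rect_seg_bot : cont_seg (fun x => f (x, c)) a b.
Proof.
intros t Ht; apply cont_horizontal, fc; split; [exact Ht |]; simpl.
split; [apply Rmin_l | apply Rmax_l].
Qed.

Lemma rect_seg_top : cont_seg (fun x => f (x, d)) a b.
Proof.
intros t Ht; apply cont_horizontal, fc; split; [exact Ht |]; simpl.
split; [apply Rmin_r | apply Rmax_r].
Qed.

Lemma rect_seg_left : cont_seg (fun y => f (a, y)) c d.
Proof.
intros t Ht; apply cont_vertical, fc; split; [ | exact Ht]; simpl.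
split; [apply Rmin_l | apply Rmax_l].
Qed.

Lemma rect_seg_right : cont_seg (fun y => f (b, y)) c d.
Proof.
intros t Ht; apply cont_vertical, fc; split; [ | exact Ht]; simpl.
split; [apply Rmin_r | apply Rmax_r].
Qed.

Lemma rect_int_le (M : R) :
  (forall z, in_rect a b c d z -> Cmod (f z) <= M) ->
  Cmod (rect_int f a b c d) <= 2 * M * (Rabs (b - a) + Rabs (d - c)).
Proof.
intros HM; unfold rect_int.
assert (B1 := CI_le_const _ M a b rect_seg_bot).
assert (B2 := CI_le_const _ M a b rect_seg_top).
assert (B3 := CI_le_const _ M c d rect_seg_left).
assert (B4 := CI_le_const _ M c d rect_seg_right).
eapply Rle_trans; [apply Cmod_triangle |].
rewrite Cmod_mult.
rewrite Cmod_Ci.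
assert (X1 := Cmod_minus_le (CI (fun x => f (x, c)) a b) (CI (fun x => f (x, d)) a b)).
assert (X2 := Cmod_minus_le (CI (fun y => f (b, y)) c d) (CI (fun y => f (a, y)) c d)).
assert (I1 : Rmin c d <= c <= Rmax c d) by (split; [apply Rmin_l | apply Rmax_l]).
assert (I2 : Rmin c d <= d <= Rmax c d) by (split; [apply Rmin_r | apply Rmax_r]).
assert (I3 : Rmin a b <= a <= Rmax a b) by (split; [apply Rmin_l | apply Rmax_l]).
assert (I4 : Rmin a b <= b <= Rmax a b) by (split; [apply Rmin_r | apply Rmax_r]).
assert (Y1 := B1 (fun t Ht => HM (t, c) (conj Ht I1))).
assert (Y2 := B2 (fun t Ht => HM (t, d) (conj Ht I2))).
assert (Y3 := B3 (fun t Ht => HM (a, t) (conj I3 Ht))).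
assert (Y4 := B4 (fun t Ht => HM (b, t) (conj I4 Ht))).
lra.
Qed.

Lemma rect_int_minus (g : C -> C) :
  (forall z, in_rect a b c d z -> continuous g z) ->
  rect_int (fun z => Cminus (f z) (g z)) a b c d =
  Cminus (rect_int f a b c d) (rect_int g a b c d).
Proof.
intros gc; unfold rect_int; rewrite !CI_minus; try ring;
  auto using rect_seg_bot, rect_seg_top, rect_seg_left, rect_seg_right.
all: intros t Ht; first [apply cont_horizontal | apply cont_vertical]; apply gc;
  split; try exact Ht; simpl; split; auto using Rmin_l, Rmin_r, Rmax_l, Rmax_r.
Qed.

Lemma rect_int_primitive (F : C -> C) :
  (forall z, in_rect a b c d z -> Cdiff F z (f z)) -> rect_int f a b c d = RtoC 0.
Proof.
intros HF; unfold rect_int.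
rewrite (CI_derive (fun x => F (x, c)) _ a b), (CI_derive (fun x => F (x, d)) _ a b).
2-5: auto using rect_seg_bot, rect_seg_top; intros t Ht; apply Pdiff_horizontal, HF;
  split; try exact Ht; simpl; split; auto using Rmin_l, Rmin_r, Rmax_l, Rmax_r.
rewrite Cmult_comm.
assert (E : forall x, (x = a \/ x = b) ->
  Cmult Ci (CI (fun y => f (x, y)) c d) = Cminus (F (x, d)) (F (x, c))).
{ intros x Hx.
  assert (S : cont_seg (fun y => f (x, y)) c d)
    by (destruct Hx; subst; auto using rect_seg_left, rect_seg_right).
  rewrite <- CI_scal by exact S.
  apply (CI_derive (fun y => F (x, y))).
  - intros t Ht; rewrite Cmult_comm; apply Pdiff_vertical, HF; split; [ | exact Ht]; simpl.
    destruct Hx; subst; split; auto using Rmin_l, Rmin_r, Rmax_l, Rmax_r.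
  - intros t Ht; apply continuous_Cmult; [apply continuous_const | now apply S]. }
match goal with |- Cplus ?u (Cmult (Cminus ?v ?w) Ci) = _ =>
  replace (Cmult (Cminus v w) Ci) with (Cminus (Cmult Ci v) (Cmult Ci w)) by ring end.
rewrite !E by auto; ring.
Qed.

End Rect.

(** * Goursat and local primitives *)

Lemma rect_int_split_x (f : C -> C) (a m b c d : R) :
  (forall z, in_rect a m c d z -> continuous f z) ->
  (forall z, in_rect m b c d z -> continuous f z) ->
  rect_int f a b c d = Cplus (rect_int f a m c d) (rect_int f m b c d).
Proof.
intros H1 H2; unfold rect_int.
rewrite (CI_Chasles (fun x => f (x, c)) a m b), (CI_Chasles (fun x => f (x, d)) a m b);
  [ring | ..]; eauto using rect_seg_bot, rect_seg_top.
Qed.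

Lemma rect_int_split_y (f : C -> C) (a b c m d : R) :
  (forall z, in_rect a b c m z -> continuous f z) ->
  (forall z, in_rect a b m d z -> continuous f z) ->
  rect_int f a b c d = Cplus (rect_int f a b c m) (rect_int f a b m d).
Proof.
intros H1 H2; unfold rect_int.
rewrite (CI_Chasles (fun y => f (a, y)) c m d), (CI_Chasles (fun y => f (b, y)) c m d);
  [ring | ..]; eauto using rect_seg_left, rect_seg_right.
Qed.

Lemma rect_int_swap_x (f : C -> C) (a b c d : R) :
  (forall z, in_rect a b c d z -> continuous f z) ->
  rect_int f b a c d = Copp (rect_int f a b c d).
Proof.
intros H1; unfold rect_int.
rewrite (CI_swap (fun x => f (x, c)) a b), (CI_swap (fun x => f (x, d)) a b);
  [ring | ..]; eauto using rect_seg_bot, rect_seg_top.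
Qed.

Lemma rect_int_swap_y (f : C -> C) (a b c d : R) :
  (forall z, in_rect a b c d z -> continuous f z) ->
  rect_int f a b d c = Copp (rect_int f a b c d).
Proof.
intros H1; unfold rect_int.
rewrite (CI_swap (fun y => f (a, y)) c d), (CI_swap (fun y => f (b, y)) c d);
  [ring | ..]; eauto using rect_seg_left, rect_seg_right.
Qed.

Lemma Cdiff_affine_error (f : C -> C) (z l : C) (e : R) :
  Cdiff f z l -> 0 < e ->
  exists d, 0 < d /\ forall w, Cmod (Cminus w z) < d ->
    Cmod (Cminus (f w) (Cplus (f z) (Cmult l (Cminus w z)))) <= e * Cmod (Cminus w z).
Proof.
intros (phi & Hc & <- & He) e0.
destruct (proj1 (locally_C_eps _ _) (filter_and _ _ He (proj1 (continuous_C_eps _ _) Hc e e0)))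
  as (d & d0 & Hd).
exists d; split; [exact d0 |]; intros w Hw; destruct (Hd w Hw) as [A B].
rewrite A.
replace (Cminus (Cplus (f z) (Cmult (phi w) (Cminus w z))) (Cplus (f z) (Cmult (phi z) (Cminus w z))))
  with (Cmult (Cminus (phi w) (phi z)) (Cminus w z)) by ring.
rewrite Cmod_mult; apply Rmult_le_compat_r; [apply Cmod_ge_0 | lra].
Qed.

Lemma Cdiff_affine_primitive (a l z w : C) :
  Cdiff (fun w => Cplus (Cmult a w) (Cmult (Cdiv l (RtoC 2)) (Cmult (Cminus w z) (Cminus w z)))) w
    (Cplus a (Cmult l (Cminus w z))).
Proof.
eapply slope_eq.
- apply Cdiff_plus; apply Cdiff_scal; [apply Cdiff_id |].
  apply Cdiff_mult; apply Cdiff_minus; apply Cdiff_id || apply Cdiff_const.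
- simpl; field.
Qed.

(** A rectangle whose integral exceeds [eta] times the squared half-perimeter has a quarter of the
    same kind, as that square shrinks by 4. Near the limit point [f] differs from an affine map by
    at most eta/4 times the distance; the affine map has a primitive, so the integral is at most
    half of what [P] demands. *)
Lemma Goursat_ordered (f : C -> C) (a b c d : R) :
  a <= b -> c <= d -> (forall z, in_rect a b c d z -> exists l, Cdiff f z l) ->
  rect_int f a b c d = RtoC 0.
Proof.
intros Hab Hcd HD.
destruct (Ceq_dec (rect_int f a b c d) (RtoC 0)) as [E | E]; [exact E | exfalso].
assert (P0 : 0 < Cmod (rect_int f a b c d)) by now apply Cmod_gt_0.
(* Dividing by (L + 1)^2 instead of L^2 covers degenerate rectangles and makes the initial
   inequality strict. *)
set (L := (b - a) + (d - c)); assert (L0 : 0 <= L) by (unfold L; lra).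
assert (Lp : 0 < (L + 1) ^ 2) by (apply pow_lt; lra).
set (eta := Cmod (rect_int f a b c d) / (L + 1) ^ 2).
assert (eta0 : 0 < eta) by now apply Rdiv_lt_0_compat.
set (P := fun x y w h => 0 <= w /\ 0 <= h /\ a <= x /\ x + w <= b /\ c <= y /\ y + h <= d /\
   eta * (w + h) ^ 2 < Cmod (rect_int f x (x + w) y (y + h))).
assert (HC : forall z, in_rect a b c d z -> continuous f z).
{ intros z Hz; destruct (HD z Hz) as [l Hl]; exact (Cdiff_continuous f z l Hl). }
unfold in_rect in HD, HC; rewrite Rmin_left, Rmax_right, Rmin_left, Rmax_right in HD, HC by lra.
destruct (bisection P a c (b - a) (d - c)) as (p & q & Hpq).
- intros x y w h (w0 & h0 & Hx & Hx' & Hy & Hy' & Hbad).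
  set (w' := w / 2) in *; set (h' := h / 2) in *.
  assert (Ew : w = w' + w') by (unfold w'; field); assert (Eh : h = h' + h') by (unfold h'; field).
  assert (Cc : forall u v s t, x <= u <= v -> v <= x + w -> y <= s <= t -> t <= y + h ->
    forall z, in_rect u v s t z -> continuous f z).
  { intros u v s t ? ? ? ? z [Z1 Z2]; apply HC.
    rewrite Rmin_left, Rmax_right in Z1, Z2 by lra; lra. }
  rewrite (rect_int_split_x f x (x + w') (x + w)) in Hbad by (apply Cc; lra).
  rewrite (rect_int_split_y f x (x + w') y (y + h') (y + h)) in Hbad by (apply Cc; lra).
  rewrite (rect_int_split_y f (x + w') (x + w) y (y + h') (y + h)) in Hbad by (apply Cc; lra).
  unfold P; replace (x + w' + w') with (x + w) by lra; replace (y + h' + h') with (y + h) by lra.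
  destruct (Rlt_dec (eta * (w' + h') ^ 2) (Cmod (rect_int f x (x + w') y (y + h')))) as [|N1];
    [left; repeat split; lra |].
  destruct (Rlt_dec (eta * (w' + h') ^ 2) (Cmod (rect_int f (x + w') (x + w) y (y + h')))) as [|N2];
    [right; left; repeat split; lra |].
  destruct (Rlt_dec (eta * (w' + h') ^ 2) (Cmod (rect_int f x (x + w') (y + h') (y + h)))) as [|N3];
    [right; right; left; repeat split; lra |].
  right; right; right; repeat split; try lra.
  apply Rnot_le_lt; intros N4.
  apply (Rlt_irrefl (eta * (w + h) ^ 2)), Rlt_le_trans with (1 := Hbad).
  assert (E4 : eta * (w + h) ^ 2 = 4 * (eta * (w' + h') ^ 2)) by (rewrite Ew, Eh; ring).
  eapply Rle_trans; [apply Cmod_triangle |].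
  eapply Rle_trans; [apply Rplus_le_compat; apply Cmod_triangle |].
  rewrite E4; lra.
- lra.
- lra.
- unfold P; replace (a + (b - a)) with b by ring; replace (c + (d - c)) with d by ring.
  repeat split; try lra.
  fold L; unfold eta; apply Rmult_lt_reg_r with (1 := Lp).
  replace (Cmod (rect_int f a b c d) / (L + 1) ^ 2 * L ^ 2 * (L + 1) ^ 2)
    with (Cmod (rect_int f a b c d) * L ^ 2) by (field; lra).
  apply Rmult_lt_compat_l; [exact P0 | nra].
- assert (Hz : a <= p <= b /\ c <= q <= d).
  { destruct (Hpq 1 Rlt_0_1) as (x & y & w & h & ? & ? & ? & ? & ? & ? & ? & ? & ? & ? & _); lra. }
  destruct (HD (p, q) Hz) as [l Hl].
  destruct (Cdiff_affine_error f (p, q) l (eta / 4) Hl) as (dl & dl0 & Hdl); [lra |].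
  destruct (Hpq (dl / 2)) as (x & y & w & h & ? & ? & ? & ? & ? & ? & ? & ? & ? & ? & Hbad); [lra |].
  set (A := fun v => Cplus (f (p, q)) (Cmult l (Cminus v (p, q)))) in *.
  assert (Hsub : forall z, in_rect x (x + w) y (y + h) z ->
    x <= fst z <= x + w /\ y <= snd z <= y + h).
  { intros z [Z1 Z2]; rewrite Rmin_left, Rmax_right in Z1, Z2 by lra; lra. }
  assert (cA : forall z, continuous A z).
  { intros z; unfold A; apply continuous_Cplus; [apply continuous_const |].
    apply continuous_Cmult; [apply continuous_const |].
    apply continuous_Cminus; [apply continuous_id | apply continuous_const]. }
  assert (cf : forall z, in_rect x (x + w) y (y + h) z -> continuous f z).
  { intros z Hz'; apply Hsub in Hz'; apply HC; lra. }
  assert (EA : rect_int A x (x + w) y (y + h) = RtoC 0).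
  { eapply rect_int_primitive; [auto | intros; apply Cdiff_affine_primitive]. }
  assert (EI : rect_int f x (x + w) y (y + h) =
               rect_int (fun z => Cminus (f z) (A z)) x (x + w) y (y + h)).
  { rewrite rect_int_minus by auto; rewrite EA; ring. }
  rewrite EI in Hbad; apply (Rlt_irrefl (eta * (w + h) ^ 2)), Rlt_le_trans with (1 := Hbad).
  eapply Rle_trans.
  + apply rect_int_le with (M := eta / 4 * (w + h)).
    * intros z Hz'; apply continuous_Cminus; auto.
    * intros z Hz'; apply Hsub in Hz'.
      assert (Hd : Cmod (Cminus z (p, q)) <= w + h).
      { eapply Rle_trans; [apply Cmod_le_abs |]; simpl.
        apply Rplus_le_compat; apply Rabs_le; lra. }
      eapply Rle_trans; [apply Hdl; lra |].
      apply Rmult_le_compat_l; lra.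
  + replace (x + w - x) with w by ring; replace (y + h - y) with h by ring.
    rewrite !Rabs_pos_eq by lra.
    assert (0 <= (w + h) ^ 2) by apply pow2_ge_0; nra.
Qed.

Lemma Goursat (f : C -> C) (a b c d : R) :
  (forall z, in_rect a b c d z -> exists l, Cdiff f z l) ->
  rect_int f a b c d = RtoC 0.
Proof.
intros HD.
assert (HC : forall z, in_rect a b c d z -> continuous f z).
{ intros z Hz; destruct (HD z Hz) as [l Hl]; exact (Cdiff_continuous f z l Hl). }
unfold in_rect in *.
destruct (Rle_dec a b); destruct (Rle_dec c d).
- now apply Goursat_ordered.
- rewrite (rect_int_swap_y f a b d c) by (unfold in_rect; now rewrite (Rmin_comm d), (Rmax_comm d)).
  rewrite Goursat_ordered; [ring | lra | lra |].
  unfold in_rect; now rewrite (Rmin_comm d), (Rmax_comm d).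
- rewrite (rect_int_swap_x f b a c d) by (unfold in_rect; now rewrite (Rmin_comm b), (Rmax_comm b)).
  rewrite Goursat_ordered; [ring | lra | lra |].
  unfold in_rect; now rewrite (Rmin_comm b), (Rmax_comm b).
- rewrite (rect_int_swap_y f a b d c) by (unfold in_rect; now rewrite (Rmin_comm d), (Rmax_comm d)).
  rewrite (rect_int_swap_x f b a d c)
    by (unfold in_rect; now rewrite (Rmin_comm d), (Rmax_comm d), (Rmin_comm b), (Rmax_comm b)).
  rewrite Goursat_ordered; [ring | lra | lra |].
  unfold in_rect; now rewrite (Rmin_comm d), (Rmax_comm d), (Rmin_comm b), (Rmax_comm b).
Qed.

Lemma Rminmax_between (x y t c r : R) :
  Rabs (x - c) < r -> Rabs (y - c) < r -> Rmin x y <= t <= Rmax x y -> Rabs (t - c) < r.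
Proof.
intros Hx Hy Ht; apply Rabs_def2 in Hx; apply Rabs_def2 in Hy; apply Rabs_def1.
- apply Rle_lt_trans with (Rmax x y - c); [lra | apply Rmax_case; lra].
- apply Rlt_le_trans with (Rmin x y - c); [apply Rmin_case; lra | lra].
Qed.

Lemma box_center (c : C) (r : R) : 0 < r -> box c r c.
Proof. intros; split; rewrite Rminus_diag, Rabs_R0; exact H. Qed.

Lemma Cdiff_of_error (f : C -> C) (z l : C) :
  (forall e, 0 < e -> locally z (fun w =>
     Cmod (Cminus (f w) (Cplus (f z) (Cmult l (Cminus w z)))) <= e * Cmod (Cminus w z))) ->
  Cdiff f z l.
Proof.
intros H; apply is_derive_Cdiff; split; [apply is_linear_scal_l |].
intros z' Hz' e.
assert (E : z = z') by (apply (is_filter_lim_locally_unique (V := AbsRing_NormedModule C_AbsRing)), Hz').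
subst z'.
destruct (proj1 (locally_C_eps _ _) (H e (cond_pos e))) as (d & d0 & Hd).
exists (mkposreal d d0); intros w Hw.
change (Cmod (Cminus (Cminus (f w) (f z)) (Cmult (Cminus w z) l)) <= e * Cmod (Cminus w z)).
replace (Cminus (Cminus (f w) (f z)) (Cmult (Cminus w z) l))
  with (Cminus (f w) (Cplus (f z) (Cmult l (Cminus w z)))) by ring.
now apply Hd.
Qed.

Lemma CI_near_const (g : R -> C) (v : C) (e a b : R) :
  cont_seg g a b -> (forall t, Rmin a b <= t <= Rmax a b -> Cmod (Cminus (g t) v) <= e) ->
  Cmod (Cminus (CI g a b) (Cmult v (RtoC (b - a)))) <= e * Rabs (b - a).
Proof.
intros Hg He; rewrite <- CI_const, <- CI_minus; [ | exact Hg | intros t _; apply continuous_const].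
apply CI_le_const; [ | exact He].
intros t Ht; apply continuous_Cminus; [now apply Hg | apply continuous_const].
Qed.

Section Primitive.
Variables (f : C -> C) (c : C) (r : R).
Hypothesis r0 : 0 < r.
Hypothesis fcont : forall z, box c r z -> continuous f z.
Hypothesis fdiff : forall z, box c r z -> z <> c -> exists l, Cdiff f z l.

Lemma box_rect (a b p q : R) :
  Rabs (a - fst c) < r -> Rabs (b - fst c) < r ->
  Rabs (p - snd c) < r -> Rabs (q - snd c) < r ->
  forall z, in_rect a b p q z -> box c r z.
Proof. intros ? ? ? ? z [H1 H2]; split; [apply (Rminmax_between a b) | apply (Rminmax_between p q)]; assumption. Qed.

(* The corner [c] may be a point of non-differentiability: the rectangle is cut
   down to arbitrarily small ones at that corner, and [f] is bounded there. *)
Lemma Goursat_corner (x y : R) :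
  Rabs (x - fst c) < r -> Rabs (y - snd c) < r ->
  rect_int f (fst c) x (snd c) y = RtoC 0.
Proof.
intros Hx Hy.
assert (Hcx : Rabs (fst c - fst c) < r) by (rewrite Rminus_diag, Rabs_R0; exact r0).
assert (Hcy : Rabs (snd c - snd c) < r) by (rewrite Rminus_diag, Rabs_R0; exact r0).
destruct (Req_dec x (fst c)) as [-> | Nx].
{ unfold rect_int; rewrite !CI_point; ring. }
destruct (Req_dec y (snd c)) as [-> | Ny].
{ unfold rect_int; rewrite !CI_point; ring. }
set (X := fun t => fst c + t * (x - fst c)); set (Y := fun t => snd c + t * (y - snd c)).
assert (HX : forall t, 0 <= t <= 1 -> Rabs (X t - fst c) <= t * r).
{ intros t Ht; unfold X; replace (fst c + t * (x - fst c) - fst c) with (t * (x - fst c)) by ring.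
  rewrite Rabs_mult, Rabs_pos_eq by lra; apply Rmult_le_compat_l; lra. }
assert (HY : forall t, 0 <= t <= 1 -> Rabs (Y t - snd c) <= t * r).
{ intros t Ht; unfold Y; replace (snd c + t * (y - snd c) - snd c) with (t * (y - snd c)) by ring.
  rewrite Rabs_mult, Rabs_pos_eq by lra; apply Rmult_le_compat_l; lra. }
assert (HXb : forall t, 0 <= t < 1 -> Rabs (X t - fst c) < r).
{ intros t Ht; specialize (HX t); nra. }
assert (HYb : forall t, 0 <= t < 1 -> Rabs (Y t - snd c) < r).
{ intros t Ht; specialize (HY t); nra. }
assert (EQ : forall t, 0 < t < 1 ->
  rect_int f (fst c) x (snd c) y = rect_int f (fst c) (X t) (snd c) (Y t)).
{ intros t Ht.
  assert (BX : Rabs (X t - fst c) < r) by (apply HXb; lra).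
  assert (BY : Rabs (Y t - snd c) < r) by (apply HYb; lra).
  rewrite (rect_int_split_x f (fst c) (X t) x)
    by (intros z Hz; apply fcont; revert z Hz; apply box_rect; assumption).
  rewrite (rect_int_split_y f (fst c) (X t) (snd c) (Y t) y)
    by (intros z Hz; apply fcont; revert z Hz; apply box_rect; assumption).
  rewrite (Goursat f (X t) x), (Goursat f (fst c) (X t) (Y t) y); [ring | |].
  - intros z Hz; apply fdiff; [revert z Hz; apply box_rect; assumption |].
    intros ->; destruct Hz as [_ Hz]; unfold Y in Hz; revert Hz.
    unfold Rmin, Rmax; repeat destruct Rle_dec; nra.
  - intros z Hz; apply fdiff; [revert z Hz; apply box_rect; assumption |].
    intros ->; destruct Hz as [Hz _]; unfold X in Hz; revert Hz.
    unfold Rmin, Rmax; repeat destruct Rle_dec; nra. }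
destruct (proj1 (locally_C_eps _ _)
  (proj1 (continuous_C_eps f c) (fcont c (box_center c r r0)) 1 Rlt_0_1)) as (d & d0 & Hd).
set (M := Cmod (f c) + 1).
assert (M0 : 0 < M) by (unfold M; generalize (Cmod_ge_0 (f c)); lra).
apply Cmod_eq_0, Rle_antisym; [ | apply Cmod_ge_0].
apply Rnot_lt_le; intros Pos.
set (I := Cmod (rect_int f (fst c) x (snd c) y)) in *.
(* The three bounds in turn give t < 1, keep the shrunken rectangle where |f| <= M, and make the
   final estimate 4 M t r <= I / 2. *)
set (t := Rmin (1 / 2) (Rmin (d / (4 * r)) (I / (8 * M * r)))).
assert (Mr : 0 < M * r) by now apply Rmult_lt_0_compat.
assert (t0 : 0 < t) by (unfold t; repeat apply Rmin_pos; try apply Rdiv_lt_0_compat; lra).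
assert (t1 : t <= 1 / 2) by apply Rmin_l.
assert (t2 : t * r <= d / 4).
{ apply Rle_trans with (d / (4 * r) * r); [ | right; field; lra].
  apply Rmult_le_compat_r; [lra |]; unfold t; eapply Rle_trans; [apply Rmin_r | apply Rmin_l]. }
assert (t3 : t * (M * r) <= I / 8).
{ apply Rle_trans with (I / (8 * M * r) * (M * r)); [ | right; field; lra].
  apply Rmult_le_compat_r; [lra |]; unfold t; eapply Rle_trans; [apply Rmin_r | apply Rmin_r]. }
assert (Hlt : I <= 2 * M * (Rabs (X t - fst c) + Rabs (Y t - snd c))).
{ unfold I; rewrite (EQ t) by lra; apply rect_int_le.
  - intros z Hz; apply fcont; revert z Hz; apply box_rect; auto; [apply HXb | apply HYb]; lra.
  - intros z Hz.
    assert (Hz' : Cmod (Cminus z c) < d).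
    { eapply Rle_lt_trans; [apply Cmod_le_abs |]; simpl.
      assert (A1 : Rabs (fst z - fst c) < d / 2).
      { apply (Rminmax_between (fst c) (X t)); [ | | apply Hz].
        - rewrite Rminus_diag, Rabs_R0; lra.
        - apply Rle_lt_trans with (1 := HX t ltac:(lra)); lra. }
      assert (A2 : Rabs (snd z - snd c) < d / 2).
      { apply (Rminmax_between (snd c) (Y t)); [ | | apply Hz].
        - rewrite Rminus_diag, Rabs_R0; lra.
        - apply Rle_lt_trans with (1 := HY t ltac:(lra)); lra. }
      unfold Rminus in A1, A2; lra. }
    specialize (Hd z Hz').
    replace (f z) with (Cplus (Cminus (f z) (f c)) (f c)) by ring.
    eapply Rle_trans; [apply Cmod_triangle | unfold M; lra]. }
assert (H1 := HX t ltac:(lra)); assert (H2 := HY t ltac:(lra)).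
assert (2 * M * (Rabs (X t - fst c) + Rabs (Y t - snd c)) <= 2 * M * (t * r + t * r)).
{ apply Rmult_le_compat_l; lra. }
lra.
Qed.

(** The path starts at the possibly singular point [c], so that comparing two paths only involves
    rectangles with [c] as a corner. *)
Definition box_primitive (z : C) : C :=
  Cplus (CI (fun s => f (s, snd c)) (fst c) (fst z))
        (Cmult Ci (CI (fun t => f (fst z, t)) (snd c) (snd z))).

Lemma box_segh (y a b : R) :
  Rabs (y - snd c) < r -> Rabs (a - fst c) < r -> Rabs (b - fst c) < r ->
  cont_seg (fun s => f (s, y)) a b.
Proof.
intros ? ? ? t Ht; apply cont_horizontal, fcont; split; simpl; [ | assumption].
apply (Rminmax_between a b); assumption.
Qed.

Lemma box_segv (x a b : R) :
  Rabs (x - fst c) < r -> Rabs (a - snd c) < r -> Rabs (b - snd c) < r ->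
  cont_seg (fun t => f (x, t)) a b.
Proof.
intros ? ? ? t Ht; apply cont_vertical, fcont; split; simpl; [assumption |].
apply (Rminmax_between a b); assumption.
Qed.

(** [Goursat_corner], applied up to (x, y) and up to (x', y), moves the horizontal paths from the
    height of [c] to the height [y]; the vertical side [T0] through [c] cancels in the
    difference. *)
Lemma box_primitive_increment (x y x' y' : R) :
  box c r (x, y) -> box c r (x', y') ->
  Cminus (box_primitive (x', y')) (box_primitive (x, y)) =
  Cplus (CI (fun s => f (s, y)) x x') (Cmult Ci (CI (fun t => f (x', t)) y y')).
Proof.
intros [H1 H2] [H3 H4]; simpl in H1, H2, H3, H4.
destruct (box_center c r r0) as [H5 H6].
assert (E1 := Goursat_corner x y H1 H2); assert (E2 := Goursat_corner x' y H3 H2).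
assert (E3 : CI (fun s => f (s, y)) (fst c) x' =
   Cplus (CI (fun s => f (s, y)) (fst c) x) (CI (fun s => f (s, y)) x x'))
  by (apply CI_Chasles; apply box_segh; assumption).
assert (E4 : CI (fun t => f (x', t)) (snd c) y' =
   Cplus (CI (fun t => f (x', t)) (snd c) y) (CI (fun t => f (x', t)) y y'))
  by (apply CI_Chasles; apply box_segv; assumption).
unfold rect_int in E1, E2; unfold box_primitive; simpl.
rewrite E3 in E2; rewrite E4.
set (A := CI (fun x => f (x, snd c)) (fst c) x) in *.
set (A' := CI (fun x => f (x, snd c)) (fst c) x') in *.
set (B := CI (fun x => f (x, y)) (fst c) x) in *.
set (T := CI (fun t => f (x, t)) (snd c) y) in *.
set (T' := CI (fun t => f (x', t)) (snd c) y) in *.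
set (T0 := CI (fun y => f (fst c, y)) (snd c) y) in *.
set (Q := CI (fun s => f (s, y)) x x') in *.
set (Z := CI (fun t => f (x', t)) y y').
assert (F1 : A = Cminus B (Cmult Ci (Cminus T T0))).
{ transitivity (Cminus A (RtoC 0)); [ring | rewrite <- E1; ring]. }
assert (F2 : A' = Cminus (Cplus B Q) (Cmult Ci (Cminus T' T0))).
{ transitivity (Cminus A' (RtoC 0)); [ring | rewrite <- E2; ring]. }
rewrite F1, F2; ring.
Qed.

Lemma box_primitive_diff (z : C) : box c r z -> Cdiff box_primitive z (f z).
Proof.
intros Hz; apply Cdiff_of_error; intros e e0.
assert (e4 : 0 < e / 4) by lra.
destruct (proj1 (locally_C_eps _ _) (proj1 (continuous_C_eps f z) (fcont z Hz) (e / 4) e4))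
  as (d & d0 & Hd).
assert (Hb : locally z (box c r)).
{ destruct Hz as [B1 B2].
  set (m := Rmin (r - Rabs (fst z - fst c)) (r - Rabs (snd z - snd c))).
  assert (m0 : 0 < m) by (apply Rmin_pos; lra).
  exists (mkposreal _ m0); intros w [W1 W2].
  change (Rabs (fst w - fst z) < m) in W1; change (Rabs (snd w - snd z) < m) in W2.
  assert (M1 : m <= r - Rabs (fst z - fst c)) by apply Rmin_l.
  assert (M2 : m <= r - Rabs (snd z - snd c)) by apply Rmin_r.
  split.
  - replace (fst w - fst c) with ((fst w - fst z) + (fst z - fst c)) by ring.
    eapply Rle_lt_trans; [apply Rabs_triang | lra].
  - replace (snd w - snd c) with ((snd w - snd z) + (snd z - snd c)) by ring.
    eapply Rle_lt_trans; [apply Rabs_triang | lra]. }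
apply locally_C_eps in Hb; destruct Hb as (d1 & d10 & Hb).
(* On the vertical leg both coordinates may differ from those of z, each by less than d / 2, so the
   distance stays below d. *)
apply locally_C_eps; exists (Rmin (d / 2) d1); split; [apply Rmin_pos; lra |]; intros w Hw.
assert (W1 : Cmod (Cminus w z) < d / 2) by (apply Rlt_le_trans with (1 := Hw), Rmin_l).
assert (W2 : box c r w) by (apply Hb, Rlt_le_trans with (1 := Hw), Rmin_r).
destruct w as [x' y'], z as [x y].
match goal with |- Cmod ?u <= _ => replace u with
  (Cminus (Cminus (box_primitive (x', y')) (box_primitive (x, y))) (Cmult (f (x, y)) (Cminus (x', y') (x, y)))) by ring end.
rewrite box_primitive_increment by assumption.
assert (X1 : Rabs (x' - x) <= Cmod (Cminus (x', y') (x, y)))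
  by exact (re_le_Cmod (Cminus (x', y') (x, y))).
assert (X2 : Rabs (y' - y) <= Cmod (Cminus (x', y') (x, y)))
  by exact (im_le_Cmod (Cminus (x', y') (x, y))).
set (m := Cmod (Cminus (x', y') (x, y))) in *.
destruct Hz as [B1 B2], W2 as [B3 B4]; simpl in B1, B2, B3, B4.
assert (Y1 : Cmod (Cminus (CI (fun s => f (s, y)) x x') (Cmult (f (x, y)) (RtoC (x' - x))))
  <= e / 4 * Rabs (x' - x)).
{ apply CI_near_const; [now apply box_segh |].
  intros t Ht; left; apply Hd; eapply Rle_lt_trans; [apply Cmod_le_abs |]; simpl.
  assert (Rabs (t - x) < d).
  { apply (Rminmax_between x x'); [rewrite Rminus_diag, Rabs_R0; lra | lra | exact Ht]. }
  replace (y + - y) with 0 by ring; rewrite Rabs_R0; unfold Rminus in *; lra. }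
assert (Y2 : Cmod (Cminus (CI (fun t => f (x', t)) y y') (Cmult (f (x, y)) (RtoC (y' - y))))
  <= e / 4 * Rabs (y' - y)).
{ apply CI_near_const; [now apply box_segv |].
  intros t Ht; left; apply Hd; eapply Rle_lt_trans; [apply Cmod_le_abs |]; simpl.
  assert (Rabs (t - y) < d / 2).
  { apply (Rminmax_between y y'); [rewrite Rminus_diag, Rabs_R0; lra | lra | exact Ht]. }
  unfold Rminus in *; lra. }
match type of Y1 with Cmod ?u <= _ => match type of Y2 with Cmod ?v <= _ =>
  apply Rle_trans with (Cmod (Cplus u (Cmult Ci v))) end end.
{ right; f_equal.
  replace (Cminus (x', y') (x, y)) with (Cplus (RtoC (x' - x)) (Cmult Ci (RtoC (y' - y))))
    by (apply injective_projections; simpl; ring).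
  ring. }
eapply Rle_trans; [apply Cmod_triangle |]; rewrite Cmod_mult, Cmod_Ci.
assert (e / 4 * Rabs (x' - x) <= e / 4 * m) by (apply Rmult_le_compat_l; lra).
assert (e / 4 * Rabs (y' - y) <= e / 4 * m) by (apply Rmult_le_compat_l; lra).
assert (0 <= m) by apply Cmod_ge_0.
assert (0 <= e * m) by (apply Rmult_le_pos; lra).
lra.
Qed.

End Primitive.

(** * Cauchy formula and removable singularities *)

Lemma Cdiff_unique (f : C -> C) (z l m : C) : Cdiff f z l -> Cdiff f z m -> l = m.
Proof.
intros H1 H2; rewrite <- (is_C_derive_unique f z l), <- (is_C_derive_unique f z m);
  auto using Cdiff_is_derive.
Qed.

(** The divided difference of [f] at [w]; when [l] is the derivative there, the filled value makes
    it continuous, and [removable] then makes it holomorphic. *)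
Definition quot (f : C -> C) (w l z : C) : C :=
  if Ceq_dec z w then l else Cdiv (Cminus (f z) (f w)) (Cminus z w).

Lemma quot_at (f : C -> C) (w l : C) : quot f w l w = l.
Proof. unfold quot; destruct (Ceq_dec w w) as [_ | []]; reflexivity. Qed.

Lemma quot_off (f : C -> C) (w l z : C) :
  z <> w -> quot f w l z = Cdiv (Cminus (f z) (f w)) (Cminus z w).
Proof. intros N; unfold quot; destruct (Ceq_dec z w); [contradiction | reflexivity]. Qed.

Lemma quot_continuous (f : C -> C) (w l : C) : Cdiff f w l -> continuous (quot f w l) w.
Proof.
intros (phi & Hc & <- & He); apply continuous_ext_loc with phi; [ | exact Hc].
revert He; apply filter_imp; intros z Hz.
unfold quot; destruct (Ceq_dec z w) as [-> | N]; [reflexivity |].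
rewrite Hz; change (phi z = Cdiv (Cminus (Cplus (f w) (Cmult (phi z) (Cminus z w))) (f w)) (Cminus z w) :> C).
field; intro E; apply N, Ceq_minus, E.
Qed.

Lemma locally_Cneq (z w : C) : z <> w -> locally z (fun v => v <> w).
Proof.
intros N.
assert (H := locally_Cneq0 (fun v => Cminus v w) z).
generalize (H (continuous_Cminus _ _ _ (continuous_id z) (continuous_const w z))
  (Cminus_eq_contra _ _ N)).
apply filter_imp; intros v Hv E; apply Hv; rewrite E; ring.
Qed.

Lemma quot_diff (f : C -> C) (w l z m : C) :
  Cdiff f z m -> z <> w -> exists k, Cdiff (quot f w l) z k.
Proof.
intros H N; eexists.
apply slope_ext_loc with (fun v => Cdiv (Cminus (f v) (f w)) (Cminus v w)).
- generalize (locally_Cneq z w N); apply filter_imp; intros v Hv; now rewrite quot_off.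
- apply Cdiff_div; [apply Cdiff_minus; [exact H | apply Cdiff_const] |
    apply Cdiff_minus; [apply Cdiff_id | apply Cdiff_const] | now apply Cminus_eq_contra].
Qed.

Definition cis (t : R) : C := (cos t, sin t).
Definition circ (c : C) (r : R) (t : R) : C := Cplus c (Cmult (RtoC r) (cis t)).

Lemma Cmod_cis (t : R) : Cmod (cis t) = 1.
Proof.
unfold Cmod, cis; simpl.
replace (cos t * (cos t * 1) + sin t * (sin t * 1)) with 1; [apply sqrt_1 |].
generalize (sin2_cos2 t); unfold Rsqr; lra.
Qed.

Lemma Pdiff_cis (t : R) : Pdiff cis t (Cmult Ci (cis t)).
Proof.
apply is_derive_Pdiff; simpl.
- replace (0 * cos t - 1 * sin t) with (- sin t) by ring; apply is_derive_cos.
- replace (0 * sin t + 1 * cos t) with (cos t) by ring; apply is_derive_sin.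
Qed.

Lemma Pdiff_circ (c : C) (r t : R) : Pdiff (circ c r) t (Cmult Ci (Cminus (circ c r t) c)).
Proof.
eapply slope_eq; [apply Pdiff_plus; [apply Pdiff_const | apply Pdiff_scal, Pdiff_cis] |].
unfold circ; ring.
Qed.

Lemma circ_continuous (c : C) (r t : R) : continuous (circ c r) t.
Proof. eapply Pdiff_continuous, Pdiff_circ. Qed.

Lemma circ_periodic (c : C) (r : R) : circ c r (2 * PI) = circ c r 0.
Proof. unfold circ, cis; now rewrite cos_2PI, sin_2PI, cos_0, sin_0. Qed.

Lemma circ_dist (c : C) (r t : R) : 0 <= r -> Cmod (Cminus (circ c r t) c) = r.
Proof.
intros Hr; unfold circ; replace (Cminus (Cplus c (Cmult r (cis t))) c) with (Cmult r (cis t)) by ring.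
rewrite Cmod_mult, Cmod_cis, Cmod_R, Rabs_pos_eq by exact Hr; ring.
Qed.

Lemma Cmod_minus_sym (u v : C) : Cmod (Cminus u v) = Cmod (Cminus v u).
Proof. rewrite <- Cmod_opp; f_equal; ring. Qed.

Lemma Cmod_triangle_inv (u v : C) : Cmod u - Cmod v <= Cmod (Cminus u v).
Proof.
assert (H := Cmod_triangle (Cminus u v) v).
replace (Cplus (Cminus u v) v) with u in H by ring; lra.
Qed.

Lemma box_Cmod (c : C) (r : R) (z : C) : Cmod (Cminus z c) < r -> box c r z.
Proof.
intros H; split; apply Rle_lt_trans with (2 := H).
- exact (re_le_Cmod (Cminus z c)).
- exact (im_le_Cmod (Cminus z c)).
Qed.

Lemma box_incl (c w : C) (r s d : R) :
  Cmod (Cminus w c) <= d -> s + d <= r -> forall z, box w s z -> box c r z.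
Proof.
intros Hd Hs z [H1 H2].
assert (A := re_le_Cmod (Cminus w c)); assert (B := im_le_Cmod (Cminus w c)).
change (Re (Cminus w c)) with (fst w - fst c) in A; change (Im (Cminus w c)) with (snd w - snd c) in B.
split.
- replace (fst z - fst c) with ((fst z - fst w) + (fst w - fst c)) by ring.
  eapply Rle_lt_trans; [apply Rabs_triang | lra].
- replace (snd z - snd c) with ((snd z - snd w) + (snd w - snd c)) by ring.
  eapply Rle_lt_trans; [apply Rabs_triang | lra].
Qed.

Lemma circ_neq (c w : C) (r t : R) :
  0 < r -> Cmod (Cminus w c) < r -> Cminus (circ c r t) w <> RtoC 0.
Proof.
intros r0 Hw E.
assert (H := circ_dist c r t (Rlt_le _ _ r0)).
replace (circ c r t) with w in H by (apply eq_sym, Ceq_minus, E); lra.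
Qed.

(** Cauchy's formula with the kernel integral left unevaluated off the centre. The divided
    difference at [w] has a primitive on the square of half-side 2r about [w], which contains the
    circle and lies in the given square, so its integral along the circle vanishes. *)
Lemma Cauchy_box (f : C -> C) (c w : C) (r : R) :
  0 < r -> (forall z, box c (4 * r) z -> exists l, Cdiff f z l) -> Cmod (Cminus w c) < r / 2 ->
  CI (fun t => Cmult (Cmult (f (circ c r t)) (Cminus (circ c r t) c)) (Cinv (Cminus (circ c r t) w))) 0 (2 * PI)
  = Cmult (f w)
      (CI (fun t => Cmult (Cminus (circ c r t) c) (Cinv (Cminus (circ c r t) w))) 0 (2 * PI)).
Proof.
intros r0 HD Hw.
assert (incl : forall z, box w (2 * r) z -> box c (4 * r) z).
{ apply box_incl with (r / 2); lra. }
destruct (HD w (incl w (box_center w (2 * r) ltac:(lra)))) as [l Hl].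
set (g := quot f w l).
assert (Hg : forall z, box w (2 * r) z -> z <> w -> exists k, Cdiff g z k).
{ intros z Hz N; destruct (HD z (incl z Hz)) as [m Hm]; now apply (quot_diff f w l z m). }
assert (Hgc : forall z, box w (2 * r) z -> continuous g z).
{ intros z Hz; destruct (Ceq_dec z w) as [-> | N]; [now apply quot_continuous |].
  destruct (Hg z Hz N) as [k Hk]; exact (Cdiff_continuous _ _ _ Hk). }
assert (Hcirc : forall t, box w (2 * r) (circ c r t)).
{ intros t; apply box_Cmod.
  replace (Cminus (circ c r t) w) with (Cminus (Cminus (circ c r t) c) (Cminus w c)) by ring.
  eapply Rle_lt_trans; [apply Cmod_minus_le |]; rewrite circ_dist by lra; lra. }
assert (N : forall t, Cminus (circ c r t) w <> RtoC 0) by (intros; apply circ_neq; lra).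
assert (cf : forall t, continuous (fun s => f (circ c r s)) t).
{ intros t; destruct (HD _ (incl _ (Hcirc t))) as [m Hm].
  apply (continuous_comp (circ c r) f); [apply circ_continuous | exact (Cdiff_continuous _ _ _ Hm)]. }
assert (ck : forall t, continuous (fun s => Cinv (Cminus (circ c r s) w)) t).
{ intros t; apply continuous_Cinv; [ | apply N].
  apply continuous_Cminus; [apply circ_continuous | apply continuous_const]. }
assert (cc : forall t, continuous (fun s => Cminus (circ c r s) c) t).
{ intros t; apply continuous_Cminus; [apply circ_continuous | apply continuous_const]. }
assert (E : CI (fun t => Cmult (g (circ c r t)) (Cmult Ci (Cminus (circ c r t) c))) 0 (2 * PI) = RtoC 0).
{ rewrite (CI_derive (fun t => box_primitive g w (circ c r t))).
  - rewrite circ_periodic; ring.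
  - intros t _; apply (Pdiff_comp t (box_primitive g w) (circ c r)); [ | apply Pdiff_circ].
    apply box_primitive_diff with (r := 2 * r); auto; lra.
  - intros t _; apply continuous_Cmult.
    + apply (continuous_comp (circ c r) g); [apply circ_continuous | apply Hgc, Hcirc].
    + apply continuous_Cmult; [apply continuous_const | apply cc]. }
rewrite <- CI_scal by (intros t _; apply continuous_Cmult; auto).
assert (cF : forall t, continuous (fun s => Cmult (Cmult (f (circ c r s)) (Cminus (circ c r s) c))
    (Cinv (Cminus (circ c r s) w))) t).
{ intros t; apply continuous_Cmult; [ | apply ck]; apply continuous_Cmult; [apply cf | apply cc]. }
assert (cK : forall t, continuous (fun s => Cmult (f w) (Cmult (Cminus (circ c r s) c)
    (Cinv (Cminus (circ c r s) w)))) t).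
{ intros t; apply continuous_Cmult; [apply continuous_const |].
  apply continuous_Cmult; [apply cc | apply ck]. }
apply Ceq_minus; rewrite <- CI_minus by (intros t _; auto).
rewrite (CI_ext _ (fun t => Cmult (Copp Ci) (Cmult (g (circ c r t)) (Cmult Ci (Cminus (circ c r t) c))))).
- rewrite CI_scal, E; [ring |].
  intros t _; apply continuous_Cmult.
  + apply (continuous_comp (circ c r) g); [apply circ_continuous | apply Hgc, Hcirc].
  + apply continuous_Cmult; [apply continuous_const | apply cc].
- intros t _; unfold g; rewrite quot_off by (intro X; apply (N t); rewrite X; ring).
  assert (I2 : Cmult Ci Ci = Copp (RtoC 1)) by (apply injective_projections; simpl; ring).
  transitivity (Cmult (Copp (Cmult Ci Ci)) (Cmult (Cdiv (Cminus (f (circ c r t)) (f w)) (Cminus (circ c r t) w)) (Cminus (circ c r t) c)));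
    [rewrite I2 | ]; field; apply N.
Qed.

Lemma two_PI_pos : 0 < 2 * PI.
Proof. generalize PI_RGT_0; lra. Qed.

Lemma Cauchy_kernel_center (c : C) (r : R) : 0 < r ->
  CI (fun t => Cmult (Cminus (circ c r t) c) (Cinv (Cminus (circ c r t) c))) 0 (2 * PI) = RtoC (2 * PI).
Proof.
intros r0; rewrite (CI_ext _ (fun _ => RtoC 1)).
- rewrite CI_const, Rminus_0_r; ring.
- intros t _; apply Cinv_r, circ_neq; [exact r0 |].
  replace (Cminus c c) with (RtoC 0) by ring; now rewrite Cmod_0.
Qed.

Lemma mean_value (f : C -> C) (c : C) (r : R) :
  0 < r -> (forall z, box c (4 * r) z -> exists l, Cdiff f z l) ->
  CI (fun t => f (circ c r t)) 0 (2 * PI) = Cmult (RtoC (2 * PI)) (f c).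
Proof.
intros r0 HD.
assert (Z : Cmod (Cminus c c) < r / 2).
{ replace (Cminus c c) with (RtoC 0) by ring; rewrite Cmod_0; lra. }
assert (H := Cauchy_box f c c r r0 HD Z).
rewrite Cauchy_kernel_center in H by exact r0.
rewrite Cmult_comm, <- H; apply CI_ext; intros t _.
field; apply circ_neq; [exact r0 | lra].
Qed.

(** Differentiation under the integral sign, with a quadratic remainder uniform in t. [K] is
    replaced by [Rabs K + 1] to have a positive divisor. *)
Lemma CI_param_diff (F : C -> R -> C) (F' : R -> C) (w : C) (K d : R) :
  0 < d -> (forall v t, Cmod (Cminus v w) < d -> continuous (F v) t) ->
  (forall t, continuous F' t) ->
  (forall v t, Cmod (Cminus v w) < d -> 0 <= t <= 2 * PI ->
     Cmod (Cminus (F v t) (Cplus (F w t) (Cmult (Cminus v w) (F' t)))) <= K * Cmod (Cminus v w) ^ 2) ->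
  Cdiff (fun v => CI (F v) 0 (2 * PI)) w (CI F' 0 (2 * PI)).
Proof.
intros d0 HF HF' HK; apply Cdiff_of_error; intros e e0; apply locally_C_eps.
assert (P0 := two_PI_pos).
assert (K1 : 0 < Rabs K + 1) by (generalize (Rabs_pos K); lra).
assert (K2 : 0 < 2 * PI * (Rabs K + 1)) by now apply Rmult_lt_0_compat.
exists (Rmin d (e / (2 * PI * (Rabs K + 1)))); split.
{ apply Rmin_pos; [exact d0 | now apply Rdiv_lt_0_compat]. }
intros v Hv.
assert (V1 : Cmod (Cminus v w) < d) by (apply Rlt_le_trans with (1 := Hv), Rmin_l).
assert (V2 : Cmod (Cminus v w) < e / (2 * PI * (Rabs K + 1))) by (apply Rlt_le_trans with (1 := Hv), Rmin_r).
assert (W1 : Cmod (Cminus w w) < d) by (replace (Cminus w w) with (RtoC 0) by ring; now rewrite Cmod_0).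
assert (S1 : cont_seg (F v) 0 (2 * PI)) by (intros t _; auto).
assert (S2 : cont_seg (F w) 0 (2 * PI)) by (intros t _; auto).
assert (S3 : cont_seg F' 0 (2 * PI)) by (intros t _; auto).
assert (S4 : cont_seg (fun t => Cmult (Cminus v w) (F' t)) 0 (2 * PI))
  by (intros t _; apply continuous_Cmult; [apply continuous_const | auto]).
assert (S5 : cont_seg (fun t => Cplus (F w t) (Cmult (Cminus v w) (F' t))) 0 (2 * PI))
  by (intros t Ht; apply continuous_Cplus; [now apply S2 | now apply S4]).
rewrite (Cmult_comm _ (Cminus v w)), <- CI_scal, <- CI_plus, <- CI_minus by assumption.
eapply Rle_trans; [apply CI_le_const with (M := K * Cmod (Cminus v w) ^ 2) |].
- intros t Ht; apply continuous_Cminus; [now apply S1 | now apply S5].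
- rewrite Rmin_left, Rmax_right by lra; intros t Ht; now apply HK.
- rewrite Rminus_0_r, Rabs_pos_eq by lra.
  assert (M0 := Cmod_ge_0 (Cminus v w)).
  apply Rle_trans with ((2 * PI * (Rabs K + 1)) * Cmod (Cminus v w) * Cmod (Cminus v w)).
  + assert (K <= Rabs K + 1) by (generalize (Rle_abs K); lra).
    assert (0 <= Cmod (Cminus v w) ^ 2) by apply pow2_ge_0.
    replace (2 * PI * (Rabs K + 1) * Cmod (Cminus v w) * Cmod (Cminus v w))
      with ((Rabs K + 1) * Cmod (Cminus v w) ^ 2 * (2 * PI)) by ring.
    apply Rmult_le_compat_r; [lra |]; now apply Rmult_le_compat_r.
  + apply Rmult_le_compat_r; [exact M0 |].
    apply Rle_trans with (2 * PI * (Rabs K + 1) * (e / (2 * PI * (Rabs K + 1)))).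
    * apply Rmult_le_compat_l; lra.
    * right; field; split; lra.
Qed.

Lemma Cmult_le_compat (u v : C) (a b : R) : Cmod u <= a -> Cmod v <= b -> Cmod (Cmult u v) <= a * b.
Proof. intros; rewrite Cmod_mult; apply Rmult_le_compat; auto using Cmod_ge_0. Qed.

Section Kernel.
Variables (Phi : R -> C) (c : C) (r : R).
Hypothesis r0 : 0 < r.
Hypothesis Phic : forall t, continuous Phi t.

Definition ker (w : C) (t : R) : C := Cinv (Cminus (circ c r t) w).
(** Cauchy-type integrals of density [Phi]: the derivative of [ker1] is [ker2], that of [ker2] is
    twice [ker3]. *)
Definition ker1 (w : C) : C := CI (fun t => Cmult (Phi t) (ker w t)) 0 (2 * PI).
Definition ker2 (w : C) : C := CI (fun t => Cmult (Phi t) (Cmult (ker w t) (ker w t))) 0 (2 * PI).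
Definition ker3 (w : C) : C :=
  CI (fun t => Cmult (Phi t) (Cmult (ker w t) (Cmult (ker w t) (ker w t)))) 0 (2 * PI).

Lemma ker_continuous (w : C) (t : R) : Cmod (Cminus w c) < r -> continuous (ker w) t.
Proof.
intros Hw; apply continuous_Cinv; [ | now apply circ_neq].
apply continuous_Cminus; [apply circ_continuous | apply continuous_const].
Qed.

Lemma ker_le (w : C) (t : R) : Cmod (Cminus w c) < 3 * r / 4 -> Cmod (ker w t) <= 4 / r.
Proof.
intros Hw; unfold ker; rewrite Cmod_inv by (apply circ_neq; lra).
replace (4 / r) with (/ (r / 4)) by (field; lra).
apply Rinv_le_contravar; [lra |].
replace (Cminus (circ c r t) w) with (Cminus (Cminus (circ c r t) c) (Cminus w c)) by ring.
eapply Rle_trans; [ | apply Cmod_triangle_inv]; rewrite circ_dist; lra.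
Qed.

(** The resolvent identity. Used once it exhibits the linear term in v - w, used again it bounds the
    remainder by |v - w|^2. *)
Lemma ker_diff (w v : C) (t : R) :
  Cmod (Cminus w c) < r -> Cmod (Cminus v c) < r ->
  ker v t = Cplus (ker w t) (Cmult (Cminus v w) (Cmult (ker w t) (ker v t))).
Proof. intros; unfold ker; field; split; now apply circ_neq. Qed.

Lemma Phi_bounded : exists M, 0 < M /\ forall t, 0 <= t <= 2 * PI -> Cmod (Phi t) <= M.
Proof.
destruct (continuity_ab_maj (fun t => Cmod (Phi t)) 0 (2 * PI)) as (m & Hm & _).
- left; apply two_PI_pos.
- intros t _; apply continuity_pt_filterlim, (continuous_Cmod Phi), Phic.
- exists (Cmod (Phi m) + 1); split; [generalize (Cmod_ge_0 (Phi m)); lra |].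
  intros t Ht; specialize (Hm t Ht); lra.
Qed.

Lemma ker_near (w v : C) :
  Cmod (Cminus w c) < r / 2 -> Cmod (Cminus v w) < r / 4 -> Cmod (Cminus v c) < 3 * r / 4.
Proof.
intros H1 H2; replace (Cminus v c) with (Cplus (Cminus v w) (Cminus w c)) by ring.
eapply Rle_lt_trans; [apply Cmod_triangle | lra].
Qed.

Lemma ker1_diff (w : C) : Cmod (Cminus w c) < r / 2 -> Cdiff ker1 w (ker2 w).
Proof.
intros Hw; destruct Phi_bounded as (M & M0 & HM).
apply CI_param_diff with (d := r / 4) (K := M * (4 / r * (4 / r * (4 / r)))); [lra | | |].
- intros v t Hv; apply (ker_near w) in Hv; [ | exact Hw].
  apply continuous_Cmult; [apply Phic | apply ker_continuous; lra].
- intros t; apply continuous_Cmult; [apply Phic |].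
  apply continuous_Cmult; apply ker_continuous; lra.
- intros v t Hv Ht; apply (ker_near w) in Hv; [ | exact Hw].
  rewrite (ker_diff w v t) by lra.
  match goal with |- Cmod ?u <= _ => replace u with
    (Cmult (Cmult (Phi t) (Cmult (ker w t) (Cminus (ker v t) (ker w t)))) (Cminus v w)) by ring end.
  rewrite (ker_diff w v t) at 1 by lra.
  match goal with |- Cmod ?u <= _ => replace u with
    (Cmult (Cmult (Phi t) (Cmult (ker w t) (Cmult (ker w t) (ker v t)))) (Cmult (Cminus v w) (Cminus v w))) by ring end.
  apply Cmult_le_compat.
  + repeat apply Cmult_le_compat; try apply ker_le; try lra; now apply HM.
  + rewrite Cmod_mult; right; ring.
Qed.

Lemma ker2_diff (w : C) : Cmod (Cminus w c) < r / 2 -> Cdiff ker2 w (Cmult (RtoC 2) (ker3 w)).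
Proof.
intros Hw; destruct Phi_bounded as (M & M0 & HM).
unfold ker3; rewrite <- CI_scal
  by (intros t _; apply continuous_Cmult; [apply Phic |]; apply continuous_Cmult;
      [ | apply continuous_Cmult]; apply ker_continuous; lra).
set (q := 4 / r).
apply CI_param_diff with (d := r / 4) (K := M * (q * (q * (q * (q + 2 * q))))); [lra | | |].
- intros v t Hv; apply (ker_near w) in Hv; [ | exact Hw].
  apply continuous_Cmult; [apply Phic |]; apply continuous_Cmult; apply ker_continuous; lra.
- intros t; apply continuous_Cmult; [apply continuous_const |].
  apply continuous_Cmult; [apply Phic |]; apply continuous_Cmult;
    [ | apply continuous_Cmult]; apply ker_continuous; lra.
- intros v t Hv Ht; apply (ker_near w) in Hv; [ | exact Hw].
  assert (E := ker_diff w v t ltac:(lra) ltac:(lra)).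
  set (A := ker w t) in *; set (B := ker v t) in *; set (h := Cminus v w) in *.
  assert (E1 : Cminus B A = Cmult h (Cmult A B)) by (rewrite E at 1; ring).
  assert (E2 : Cminus (Cmult (Phi t) (Cmult B B)) (Cplus (Cmult (Phi t) (Cmult A A))
      (Cmult h (Cmult (RtoC 2) (Cmult (Phi t) (Cmult A (Cmult A A))))))
    = Cmult (Cmult (Phi t) (Cmult A (Cmult A (Cmult B (Cplus B (Cmult (RtoC 2) A)))))) (Cmult h h)).
  { transitivity (Cmult (Phi t) (Cminus (Cmult (Cminus B A) (Cplus B A))
        (Cmult (RtoC 2) (Cmult h (Cmult A (Cmult A A)))))); [ring |].
    rewrite E1.
    transitivity (Cmult (Phi t) (Cmult h (Cmult A (Cplus (Cmult (Cminus B A) (Cplus B A)) (Cmult A (Cminus B A))))));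
      [ring | rewrite E1; ring]. }
  rewrite E2; apply Cmult_le_compat.
  + repeat apply Cmult_le_compat; try (apply ker_le; lra); [now apply HM |].
    eapply Rle_trans; [apply Cmod_triangle |].
    apply Rplus_le_compat; [apply ker_le; lra |].
    apply Cmult_le_compat; [ | apply ker_le; lra].
    rewrite Cmod_R, Rabs_pos_eq; lra.
  + rewrite Cmod_mult; right; ring.
Qed.

End Kernel.

Lemma locally_disc (c : C) (r : R) : 0 < r -> locally c (fun w => Cmod (Cminus w c) < r).
Proof. intros r0; apply locally_C_eps; exists r; auto. Qed.

(** Near [c], [Cauchy_box] writes [f] as a quotient N1 / K1 of two Cauchy-type integrals, each twice
    differentiable. Only K1(c) = 2 pi has to be known: continuity keeps K1 away from 0 nearby. *)
Lemma derivative_diff (f : C -> C) (c : C) :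
  locally c (fun z => exists l, Cdiff f z l) ->
  exists f1 l, locally c (fun w => Cdiff f w (f1 w)) /\ Cdiff f1 c l.
Proof.
intros HL; destruct HL as [R HR].
set (r := R / 4); assert (r0 : 0 < r) by (unfold r; generalize (cond_pos R); lra).
assert (HD : forall z, box c (4 * r) z -> exists l, Cdiff f z l).
{ intros z [H1 H2]; apply HR; replace (4 * r) with (pos R) in H1, H2 by (unfold r; field).
  split; assumption. }
set (P := fun t => Cminus (circ c r t) c).
assert (cP : forall t, continuous P t).
{ intros t; apply continuous_Cminus; [apply circ_continuous | apply continuous_const]. }
set (Q := fun t => Cmult (f (circ c r t)) (Cminus (circ c r t) c)).
assert (cQ : forall t, continuous Q t).
{ intros t; apply continuous_Cmult; [ | apply cP].
  apply (continuous_comp (circ c r) f); [apply circ_continuous |].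
  destruct (HD (circ c r t)) as [l Hl]; [ | exact (Cdiff_continuous _ _ _ Hl)].
  apply box_Cmod; rewrite circ_dist; lra. }
set (N1 := ker1 Q c r); set (N2 := ker2 Q c r); set (N3 := ker3 Q c r).
set (K1 := ker1 P c r); set (K2 := ker2 P c r); set (K3 := ker3 P c r).
assert (Kc : K1 c = RtoC (2 * PI)) by exact (Cauchy_kernel_center c r r0).
assert (Zc : Cmod (Cminus c c) < r / 2).
{ replace (Cminus c c) with (RtoC 0) by ring; rewrite Cmod_0; lra. }
assert (DK1 : forall w, Cmod (Cminus w c) < r / 2 -> Cdiff K1 w (K2 w)) by exact (ker1_diff P c r r0 cP).
assert (DN1 : forall w, Cmod (Cminus w c) < r / 2 -> Cdiff N1 w (N2 w)) by exact (ker1_diff Q c r r0 cQ).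
assert (Kn : K1 c <> RtoC 0).
{ rewrite Kc; intros E; apply RtoC_inj in E; generalize two_PI_pos; lra. }
assert (L : locally c (fun w => Cmod (Cminus w c) < r / 2 /\ K1 w <> RtoC 0)).
{ apply filter_and; [apply locally_disc; lra |].
  apply locally_Cneq0; [exact (Cdiff_continuous _ _ _ (DK1 c Zc)) | exact Kn]. }
assert (LE : locally c (fun w => Cdiv (N1 w) (K1 w) = f w)).
{ revert L; apply filter_imp; intros w [Hw Hk].
  assert (E : N1 w = Cmult (f w) (K1 w)) by exact (Cauchy_box f c w r r0 HD Hw).
  rewrite E; field; exact Hk. }
exists (fun w => Cdiv (Cminus (Cmult (N2 w) (K1 w)) (Cmult (N1 w) (K2 w))) (Cmult (K1 w) (K1 w))).
eexists; split.
- generalize (filter_and _ _ L (locally_locally _ _ LE)); apply filter_imp; intros w [[Hw Hk] E].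
  apply slope_ext_loc with (1 := E), Cdiff_div; auto.
- apply Cdiff_div; [ | apply Cdiff_mult; now apply DK1 | now apply Cmult_neq_0].
  apply Cdiff_minus; apply Cdiff_mult; try (now apply DK1); try (now apply DN1); now apply ker2_diff.
Qed.

(** Morera's argument: continuity at [c] suffices for a primitive, and the derivative of a
    holomorphic function is differentiable. *)
Lemma removable (f : C -> C) (c : C) :
  locally c (fun z => continuous f z) -> locally c (fun z => z <> c -> exists l, Cdiff f z l) ->
  exists l, Cdiff f c l.
Proof.
intros H1 H2; destruct (filter_and _ _ H1 H2) as [R HR].
assert (Hc : forall z, box c R z -> continuous f z) by (intros z Hz; now apply HR).
assert (Hd : forall z, box c R z -> z <> c -> exists l, Cdiff f z l) by (intros z Hz; now apply HR).
assert (HG := box_primitive_diff f c R (cond_pos R) Hc Hd).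
assert (LG : locally c (fun z => Cdiff (box_primitive f c) z (f z))).
{ exists R; intros z Hz; apply HG; exact Hz. }
destruct (derivative_diff (box_primitive f c) c) as (G1 & l & E & D).
{ revert LG; apply filter_imp; eauto. }
exists l; apply slope_ext_loc with (2 := D).
generalize (filter_and _ _ E LG); apply filter_imp; intros z [A B].
exact (Cdiff_unique _ _ _ _ A B).
Qed.

Lemma quot_holomorphic (D : C -> Prop) (f : C -> C) (w l z : C) :
  (forall v, D v -> locally v D) -> (forall v, D v -> exists m, Cdiff f v m) ->
  Cdiff f w l -> D z -> exists k, Cdiff (quot f w l) z k.
Proof.
intros DO fd Hl Dz.
assert (H : forall v, D v -> v <> w -> exists k, Cdiff (quot f w l) v k).
{ intros v Dv N; destruct (fd v Dv) as [m Hm]; now apply quot_diff with (m := m). }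
destruct (Ceq_dec z w) as [-> | N]; [ | now apply H].
apply removable; generalize (DO w Dz); apply filter_imp; intros v Dv; [ | now apply H].
destruct (Ceq_dec v w) as [-> | N]; [now apply quot_continuous |].
destruct (H v Dv N) as [m Hm]; exact (Cdiff_continuous _ _ _ Hm).
Qed.

(** * Maximum principle *)

Lemma mean_value_le (f : C -> C) (c : C) (r M : R) :
  0 < r -> (forall z, box c (4 * r) z -> exists l, Cdiff f z l) ->
  (forall t, Cmod (f (circ c r t)) <= M) -> Cmod (f c) <= M.
Proof.
intros r0 HD HM; assert (H := mean_value f c r r0 HD).
assert (P0 := two_PI_pos).
assert (L : Cmod (CI (fun t => f (circ c r t)) 0 (2 * PI)) <= M * Rabs (2 * PI - 0)).
{ apply CI_le_const; [ | auto].
  intros t _; apply (continuous_comp (circ c r) f); [apply circ_continuous |].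
  destruct (HD (circ c r t)) as [l Hl]; [ | exact (Cdiff_continuous _ _ _ Hl)].
  apply box_Cmod; rewrite circ_dist; lra. }
rewrite H, Cmod_mult, Cmod_R, Rminus_0_r, !Rabs_pos_eq in L by lra.
apply Rmult_le_reg_r with (1 := P0); lra.
Qed.

Definition in_square (p : C) : Prop := -1 <= fst p <= 1 /\ -1 <= snd p <= 1.

(** Only upper semicontinuity is available, as the comparison function of the maximum principle may
    jump. Without a maximum, each point has a neighbourhood where [m] stays below some value of [m];
    the largest of finitely many such values is then below itself. *)
Lemma square_max (m : C -> R) :
  (forall p v, in_square p -> m p < v -> locally p (fun z => m z < v)) ->
  exists p, in_square p /\ forall z, in_square z -> m z <= m p.
Proof.
intros usc.
destruct (classic (exists p, in_square p /\ forall z, in_square z -> m z <= m p)) as [H | H]; [exact H | exfalso].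
assert (N : forall p : Compactness.Tn 2 R, exists u : C * posreal,
  in_square (fst p, fst (snd p)) -> in_square (fst u) /\
  forall z, ball (fst p, fst (snd p)) (snd u) z -> m z < m (fst u)).
{ intros (x & y & []); simpl.
  destruct (classic (in_square (x, y))) as [I | I]; [ | exists ((x, y), mkposreal 1 Rlt_0_1); tauto].
  destruct (classic (exists z, in_square z /\ m (x, y) < m z)) as [(z & Iz & Hz) | K].
  - destruct (usc (x, y) (m z) I Hz) as [d Hd]; exists (z, d); auto.
  - exfalso; apply H; exists (x, y); split; [exact I |].
    intros z Iz; apply Rnot_lt_le; intros L; apply K; eauto. }
set (u := fun p => proj1_sig (constructive_indefinite_description _ (N p))).
assert (Hu : forall p, in_square (fst p, fst (snd p)) -> in_square (fst (u p)) /\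
  forall z, ball (fst p, fst (snd p)) (snd (u p)) z -> m z < m (fst (u p))).
{ intros p; unfold u; destruct (constructive_indefinite_description _ (N p)); assumption. }
(* The finite cover exists only under a double negation, which is enough to prove [False]. *)
apply (compactness_list 2 (-1, (-1, tt)) (1, (1, tt)) (fun p => snd (u p))).
intros [l Hl].
assert (M : exists q, in_square q /\
  forall t, In t l -> in_square (fst t, fst (snd t)) -> m (fst (u t)) <= m q).
{ clear Hl; induction l as [|t l (q & Iq & Hq)].
  - exists (RtoC 0); split; [split; simpl; lra | intros t []].
  - destruct (classic (in_square (fst t, fst (snd t)) /\ m q < m (fst (u t)))) as [[I1 L] | K].
    + exists (fst (u t)); split; [now apply Hu |].
      intros t' [<- | Ht'] It'; [lra |]; specialize (Hq t' Ht' It'); lra.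
    + exists q; split; [exact Iq |]; intros t' [<- | Ht'] It'; [ | now apply Hq].
      apply Rnot_lt_le; intros L; now apply K. }
destruct M as ((x & y) & Iq & Hq).
destruct (Hl (x, (y, tt))) as ((a & b & []) & Hin & Hb & Hc).
{ simpl; destruct Iq; simpl in *; tauto. }
simpl in Hb, Hc.
assert (It : in_square (a, b)) by (split; simpl; tauto).
specialize (Hq _ Hin It).
destruct (Hu (a, (b, tt)) It) as [_ K].
apply (Rlt_irrefl (m (x, y))), Rlt_le_trans with (2 := Hq), K.
split; simpl; apply Hc.
Qed.

Lemma Cmod2_fst_snd (z : C) : Cmod z ^ 2 = fst z ^ 2 + snd z ^ 2.
Proof. apply Cmod2_alt. Qed.

Lemma continuous_lt_locally {U : UniformSpace} (f : U -> R) (x : U) (v : R) :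
  continuous f x -> f x < v -> locally x (fun y => f y < v).
Proof.
intros Hc Hv; apply (continuous_locally f x (fun a => a < v) Hc).
apply (open_lt v (f x) Hv).
Qed.

Lemma continuous_Cmod_pow2 {U : UniformSpace} (f : U -> C) (x : U) :
  continuous f x -> continuous (fun y => Cmod (f y) ^ 2) x.
Proof.
intros H; apply (continuous_ext (fun y => Cmod (f y) * Cmod (f y))); [intros; simpl; ring |].
apply continuous_Rmult; now apply continuous_Cmod.
Qed.

Section MaxPrinciple.
Variables (U : C -> Prop) (q : C -> C).
Hypothesis Udisc : forall z, U z -> Cmod z < 1.
Hypothesis Uopen : forall z, U z -> locally z U.
Hypothesis qdiff : forall z, U z -> exists l, Cdiff q z l.
Hypothesis qbdry : forall p, Cmod p <= 1 -> ~ U p -> forall e, 0 < e ->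
  locally p (fun z => U z -> Cmod (q z) <= 1 + e).

(* Adding [eta |z|^2] makes the mean value inequality strict, so that no
   interior maximum exists. *)
Lemma no_interior_max (p : C) (eta : R) :
  0 < eta -> U p ->
  (forall z, U z -> Cmod (q z) ^ 2 + eta * Cmod z ^ 2 <= Cmod (q p) ^ 2 + eta * Cmod p ^ 2) ->
  False.
Proof.
intros eta0 Up Hmax; destruct (Uopen p Up) as [R HR].
set (r := R / 4); assert (r0 : 0 < r) by (unfold r; generalize (cond_pos R); lra).
assert (HU : forall z, box p (4 * r) z -> U z).
{ intros z [H1 H2]; apply HR; replace (4 * r) with (pos R) in H1, H2 by (unfold r; field); split; assumption. }
assert (HD : forall z, box p (4 * r) z -> exists l, Cdiff (fun z => Cmult (q z) (q z)) z l).
{ intros z Hz; destruct (qdiff z (HU z Hz)) as [l Hl]; eexists; apply Cdiff_mult; exact Hl. }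
assert (Hcirc : forall t, U (circ p r t)).
{ intros t; apply HU, box_Cmod; rewrite circ_dist; lra. }
assert (MV := mean_value _ p r r0 HD).
assert (P0 := two_PI_pos).
set (A := Cmod (q p) ^ 2).
(* Expanding |p + r e^(it)|^2 in the maximality of p bounds |q|^2 on the circle by A - eta r^2 plus
   a trigonometric term of mean 0, so the mean of q^2 has modulus below A. *)
assert (L : Cmod (CI (fun t => Cmult (q (circ p r t)) (q (circ p r t))) 0 (2 * PI)) <= (A - eta * r ^ 2) * (2 * PI)).
{ apply CI_le with (h := fun t => A - eta * r ^ 2 - 2 * eta * r * (fst p * cos t + snd p * sin t)).
  - lra.
  - intros t _; apply (continuous_comp (circ p r) (fun z => Cmult (q z) (q z))); [apply circ_continuous |].
    destruct (HD (circ p r t)) as [l Hl]; [ | exact (Cdiff_continuous _ _ _ Hl)].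
    apply box_Cmod; rewrite circ_dist; lra.
  - intros t _; rewrite Cmod_mult; specialize (Hmax _ (Hcirc t)); fold A in Hmax.
    assert (E : Cmod (circ p r t) ^ 2 = Cmod p ^ 2 + r ^ 2 + 2 * r * (fst p * cos t + snd p * sin t)).
    { rewrite !Cmod2_fst_snd; simpl.
      generalize (sin2_cos2 t); unfold Rsqr; intros S.
      transitivity (fst p ^ 2 + snd p ^ 2 + r ^ 2 * (sin t * sin t + cos t * cos t)
                    + 2 * r * (fst p * cos t + snd p * sin t)); [ring | rewrite S; ring]. }
    rewrite E in Hmax; nra.
  - set (F := fun t => (A - eta * r ^ 2) * t - 2 * eta * r * (fst p * sin t - snd p * cos t)).
    replace ((A - eta * r ^ 2) * (2 * PI)) with (minus (F (2 * PI)) (F 0)).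
    + apply (is_RInt_derive (V := R_CompleteNormedModule)); intros t _.
      * unfold F; auto_derive; [trivial | ring].
      * apply (ex_derive_continuous (V := R_NormedModule)); auto_derive; trivial.
    + unfold F, minus, plus, opp; simpl; rewrite sin_2PI, cos_2PI, sin_0, cos_0; ring. }
rewrite MV, !Cmod_mult, Cmod_R, Rabs_pos_eq in L by lra.
fold A in L; assert (0 < r ^ 2) by (apply pow_lt; exact r0).
replace (Cmod (q p) * Cmod (q p)) with A in L by (unfold A; ring).
assert (0 < eta * r ^ 2) by now apply Rmult_lt_0_compat.
nra.
Qed.

(** Truncating |q|^2 below at 1 + eta and extending by that constant off [U] gives, by [qbdry], an
    upper semicontinuous function, to which eta |z|^2 is added. If |q z0|^2 = 1 + 4 eta, its maximum
    over the square is at least that, whereas at points with value 1 + eta before the addition it is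
    at most 1 + 3 eta. So the maximum is an interior one of the kind excluded by
    [no_interior_max]. *)
Lemma max_principle (z0 : C) : U z0 -> Cmod (q z0) <= 1.
Proof.
intros U0; apply Rnot_lt_le; intros H0.
set (eta := (Cmod (q z0) ^ 2 - 1) / 4).
assert (eta0 : 0 < eta) by (unfold eta; nra).
set (m := fun z => (if excluded_middle_informative (U z) then Rmax (Cmod (q z) ^ 2) (1 + eta) else 1 + eta)
                   + eta * Cmod z ^ 2).
assert (cm : forall p, continuous (fun z : C => eta * Cmod z ^ 2) p).
{ intros p; apply continuous_Rmult; [apply continuous_const |].
  apply (continuous_Cmod_pow2 (fun z : C => z)), continuous_id. }
destruct (square_max m) as (p & Ip & Hp).
- intros p v Ip Hv; unfold m in Hv |- *.
  assert (L1 : 1 + eta + eta * Cmod p ^ 2 < v -> locally p (fun z => 1 + eta + eta * Cmod z ^ 2 < v)).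
  { intros H; apply (continuous_lt_locally (fun z : C => 1 + eta + eta * Cmod z ^ 2)); [ | exact H].
    apply continuous_Rplus; [apply continuous_const | apply cm]. }
  destruct (excluded_middle_informative (U p)) as [Up | Up].
  + destruct (qdiff p Up) as [l Hl]; apply Cdiff_continuous in Hl.
    assert (L2 : locally p (fun z => Cmod (q z) ^ 2 + eta * Cmod z ^ 2 < v)).
    { apply (continuous_lt_locally (fun z : C => Cmod (q z) ^ 2 + eta * Cmod z ^ 2)).
      - apply continuous_Rplus; [now apply continuous_Cmod_pow2 | apply cm].
      - generalize (Rmax_l (Cmod (q p) ^ 2) (1 + eta)); lra. }
    assert (L3 : 1 + eta + eta * Cmod p ^ 2 < v) by (generalize (Rmax_r (Cmod (q p) ^ 2) (1 + eta)); lra).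
    generalize (filter_and _ _ (L1 L3) L2); apply filter_imp; intros z [A B].
    destruct (excluded_middle_informative (U z)); [apply Rmax_case; lra | lra].
  + assert (L2 : locally p (fun z => U z -> Cmod (q z) ^ 2 <= 1 + eta)).
    { destruct (Rle_dec (Cmod p) 1) as [Hle | Hgt].
      (* With e <= 1, (1 + e)^2 <= 1 + 3 e <= 1 + eta. *)
      - set (e := Rmin 1 (eta / 3)).
        assert (e0 : 0 < e) by (apply Rmin_pos; lra).
        assert (e1 : e <= 1) by apply Rmin_l; assert (e2 : e <= eta / 3) by apply Rmin_r.
        generalize (qbdry p Hle Up e e0); apply filter_imp; intros z Hz Uz; specialize (Hz Uz).
        assert (M0 := Cmod_ge_0 (q z)).
        apply Rle_trans with ((1 + e) ^ 2); [apply pow_incr; lra | nra].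
      - assert (L : locally p (fun z => - Cmod z < -1)).
        { apply (continuous_lt_locally (fun z : C => - Cmod z)); [ | lra].
          apply (continuous_opp (V := R_NormedModule)).
          apply (continuous_Cmod (fun z : C => z)), continuous_id. }
        revert L; apply filter_imp; intros z Hz Uz; apply Udisc in Uz; lra. }
    generalize (filter_and _ _ (L1 Hv) L2); apply filter_imp; intros z [A B].
    destruct (excluded_middle_informative (U z)) as [Uz |]; [specialize (B Uz); apply Rmax_case; lra | lra].
- assert (Usq : forall z, U z -> in_square z).
  { intros z Uz; apply Udisc in Uz.
    assert (A := re_le_Cmod z); assert (B := im_le_Cmod z); unfold Re, Im in A, B.
    split; apply Rabs_le_between; lra. }
  assert (Hge : forall z, U z -> Cmod (q z) ^ 2 + eta * Cmod z ^ 2 <= m p).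
  { intros z Uz; apply Rle_trans with (2 := Hp z (Usq z Uz)); unfold m.
    destruct (excluded_middle_informative (U z)) as [_ | []]; [ | exact Uz].
    apply Rplus_le_compat_r, Rmax_l. }
  assert (H1 := Hge z0 U0).
  assert (Hpp : Cmod p ^ 2 <= 2) by (rewrite Cmod2_fst_snd; destruct Ip; nra).
  assert (0 <= eta * Cmod z0 ^ 2) by (apply Rmult_le_pos; [lra | apply pow2_ge_0]).
  assert (E4 : Cmod (q z0) ^ 2 = 1 + 4 * eta) by (unfold eta; field).
  unfold m in Hge, H1; destruct (excluded_middle_informative (U p)) as [Up | Up].
  + assert (Hq : 1 + eta < Cmod (q p) ^ 2).
    { apply Rnot_le_lt; intros K; rewrite Rmax_right in H1 by exact K; nra. }
    rewrite Rmax_left in Hge by lra.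
    exact (no_interior_max p eta eta0 Up Hge).
  + nra.
Qed.

End MaxPrinciple.

(** * Univalent functions on the disc *)

Lemma continuous_gt_locally {U : UniformSpace} (f : U -> R) (x : U) (v : R) :
  continuous f x -> v < f x -> locally x (fun y => v < f y).
Proof.
intros Hc Hv; apply (continuous_locally f x (fun a => v < a) Hc).
apply (open_gt v (f x) Hv).
Qed.

Lemma locally_unit_disc (z : C) : unit_disc z -> locally z unit_disc.
Proof.
apply (continuous_lt_locally (fun w : C => Cmod w)).
apply (continuous_Cmod (fun w : C => w)), continuous_id.
Qed.

Lemma disc_box (c : C) (e : R) : unit_disc c -> 0 < e ->
  exists r, 0 < r /\ r < e /\ forall z, box c (4 * r) z -> unit_disc z.
Proof.
intros Hc e0; destruct (locally_unit_disc c Hc) as [R HR].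
set (r := Rmin (R / 4) (e / 2)).
assert (R0 := cond_pos R).
assert (r1 : r <= R / 4) by apply Rmin_l; assert (r2 : r <= e / 2) by apply Rmin_r.
exists r; split; [unfold r; apply Rmin_pos; lra | split; [lra |]].
intros z [H1 H2]; apply HR; split.
- change (Rabs (fst z - fst c) < R); lra.
- change (Rabs (snd z - snd c) < R); lra.
Qed.

Section Univalent.
Variable f : C -> C.
Hypothesis fdiff : forall z, unit_disc z -> exists l, Cdiff f z l.
Hypothesis finj : forall z w, unit_disc z -> unit_disc w -> f z = f w -> z = w.

(** Injectivity keeps [f] away from f(c) on the circle and compactness makes the distance uniform.
    This gap is the quantitative input of the open mapping theorem and of f' <> 0. *)
Lemma univalent_circle_gap (c : C) (r : R) :
  0 < r -> (forall z, box c (4 * r) z -> unit_disc z) ->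
  exists m, 0 < m /\ forall t, m <= Cmod (Cminus (f (circ c r t)) (f c)).
Proof.
intros r0 HD.
assert (HC : forall t, unit_disc (circ c r t)).
{ intros t; apply HD, box_Cmod; rewrite circ_dist; lra. }
assert (Hcc : unit_disc c) by (apply HD, box_center; lra).
destruct (continuity_ab_min (fun t => Cmod (Cminus (f (circ c r t)) (f c))) 0 (2 * PI)) as (t0 & Hm & _).
- left; apply two_PI_pos.
- intros t _; apply continuity_pt_filterlim.
  apply (continuous_Cmod (fun t => Cminus (f (circ c r t)) (f c))).
  apply continuous_Cminus; [ | apply continuous_const].
  destruct (fdiff _ (HC t)) as [l Hl].
  apply (continuous_comp (circ c r) f); [apply circ_continuous | exact (Cdiff_continuous _ _ _ Hl)].
- exists (Cmod (Cminus (f (circ c r t0)) (f c))); split.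
  + apply Cmod_gt_0; intros E; apply Ceq_minus in E; apply finj in E; [ | apply HC | exact Hcc].
    assert (D := circ_dist c r t0 (Rlt_le _ _ r0)); rewrite E in D.
    replace (Cminus c c) with (RtoC 0) in D by ring; rewrite Cmod_0 in D; lra.
  + intros t.
    (* reduction of [t] modulo [2 PI] *)
    set (k := Int_part (t / (2 * PI))); set (s := t - 2 * PI * IZR k).
    assert (P0 := two_PI_pos).
    assert (Hs : 0 <= s <= 2 * PI).
    { destruct (base_Int_part (t / (2 * PI))) as [B1 B2]; fold k in B1, B2.
      assert (E : t = 2 * PI * (t / (2 * PI))) by (field; lra).
      unfold s; split.
      - apply Rmult_le_compat_l with (r := 2 * PI) in B1; lra.
      - assert (2 * PI * (IZR k - t / (2 * PI)) >= 2 * PI * -1)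
          by (apply Rle_ge, Rmult_le_compat_l; lra); lra. }
    specialize (Hm s Hs).
    replace (circ c r t) with (circ c r s); [exact Hm |].
    unfold circ, cis, s; f_equal; f_equal.
    rewrite cos_minus, sin_minus.
    assert (Z : sin (IZR k * PI) = 0) by (apply sin_eq_0_1; exists k; reflexivity).
    replace (2 * PI * IZR k) with (2 * (IZR k * PI)) by ring.
    rewrite cos_2a_sin, sin_2a, Z; f_equal; ring.
Qed.

(** If a value w within m/2 of f(c) is omitted on the square, 1 / (f - w) is holomorphic there, at
    most 2/m on the circle but larger than 2/m at the centre, against the mean value inequality. *)
Lemma open_mapping (c : C) (e : R) : unit_disc c -> 0 < e ->
  locally (f c) (fun w => exists z, unit_disc z /\ Cmod (Cminus z c) < e /\ f z = w).
Proof.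
intros Hc e0; destruct (disc_box c (e / 8) Hc) as (r & r0 & re & HD); [lra |].
destruct (univalent_circle_gap c r r0 HD) as (m & m0 & Hm).
apply locally_C_eps; exists (m / 2); split; [lra |]; intros w Hw.
destruct (classic (exists z, box c (4 * r) z /\ f z = w)) as [(z & Bz & Ez) | N].
- exists z; split; [now apply HD | split; [ | exact Ez]].
  destruct Bz as [B1 B2]; eapply Rle_lt_trans; [apply Cmod_le_abs |].
  change (Rabs (fst z - fst c) + Rabs (snd z - snd c) < e); lra.
- exfalso.
  assert (N' : forall z, box c (4 * r) z -> Cminus (f z) w <> RtoC 0).
  { intros z Bz E; apply N; exists z; split; [exact Bz | apply Ceq_minus, E]. }
  assert (Bc : box c (4 * r) c) by (apply box_center; lra).
  assert (H : Cmod (Cinv (Cminus (f c) w)) <= 2 / m).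
  { apply (mean_value_le (fun z => Cinv (Cminus (f z) w)) c r); [exact r0 | |].
    - intros z Bz; destruct (fdiff z (HD z Bz)) as [l Hl]; eexists.
      apply Cdiff_inv; [ | now apply N'].
      apply Cdiff_minus; [exact Hl | apply Cdiff_const].
    - intros t; rewrite Cmod_inv by (apply N', box_Cmod; rewrite circ_dist; lra).
      replace (2 / m) with (/ (m / 2)) by (field; lra).
      apply Rinv_le_contravar; [lra |].
      replace (Cminus (f (circ c r t)) w)
        with (Cminus (Cminus (f (circ c r t)) (f c)) (Cminus w (f c))) by ring.
      eapply Rle_trans; [ | apply Cmod_triangle_inv]; specialize (Hm t); lra. }
  rewrite Cmod_inv in H by (now apply N').
  rewrite Cmod_minus_sym in Hw.
  assert (P : 0 < Cmod (Cminus (f c) w)) by (apply Cmod_gt_0; now apply N').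
  apply Rinv_lt_contravar in Hw; [ | apply Rmult_lt_0_compat; lra].
  replace (/ (m / 2)) with (2 / m) in Hw by (field; lra); lra.
Qed.

(* If [f'(c) = 0] but [f'(z1) <> 0], then [h z = (f z - f z1) / (z - z1)] has no
   zero, so the mean value inequality for [1 / h] bounds [|h c|] away from [0];
   but [h c] tends to [f'(c) = 0] as [z1] tends to [c]. *)
Lemma critical_points_open (c : C) : unit_disc c -> Cdiff f c (RtoC 0) ->
  locally c (fun z => Cdiff f z (RtoC 0)).
Proof.
intros Hc D0; destruct (disc_box c 1 Hc) as (r & r0 & _ & HD); [lra |].
destruct (univalent_circle_gap c r r0 HD) as (m & m0 & Hm).
(* On the circle |h| is at least (m/2) / (2r) = m / (4r), a bound which passes to c; half of it is
   the slope allowed here. *)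
destruct (Cdiff_affine_error f c (RtoC 0) (m / (8 * r)) D0) as (d & d0 & Hd).
{ apply Rdiv_lt_0_compat; lra. }
apply locally_C_eps; exists (Rmin d (r / 2)); split; [apply Rmin_pos; lra |].
intros z1 Hz1.
assert (Z1 : Cmod (Cminus z1 c) < d) by (apply Rlt_le_trans with (1 := Hz1), Rmin_l).
assert (Z2 : Cmod (Cminus z1 c) < r / 2) by (apply Rlt_le_trans with (1 := Hz1), Rmin_r).
destruct (Ceq_dec z1 c) as [-> | N1]; [exact D0 |].
assert (Dz1 : unit_disc z1) by (apply HD, box_Cmod; lra).
destruct (fdiff z1 Dz1) as [l1 Hl1].
destruct (Ceq_dec l1 (RtoC 0)) as [-> | L1]; [exact Hl1 | exfalso].
set (h := quot f z1 l1).
assert (hn : forall z, unit_disc z -> h z <> RtoC 0).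
{ intros z Dz; unfold h; destruct (Ceq_dec z z1) as [-> | N]; [now rewrite quot_at |].
  rewrite quot_off by exact N; intros E.
  assert (N' : Cminus z z1 <> RtoC 0) by now apply Cminus_eq_contra.
  apply N, finj; [exact Dz | exact Dz1 |]; apply Ceq_minus.
  replace (Cminus (f z) (f z1)) with (Cmult (Cdiv (Cminus (f z) (f z1)) (Cminus z z1)) (Cminus z z1))
    by (field; exact N').
  rewrite E; ring. }
assert (hd : forall z, unit_disc z -> exists k, Cdiff h z k).
{ intros z Dz; now apply (quot_holomorphic unit_disc); [exact locally_unit_disc | | |]. }
assert (Df : Cmod (Cminus (f z1) (f c)) <= m / (8 * r) * Cmod (Cminus z1 c)).
{ specialize (Hd z1 Z1); replace (Cplus (f c) (Cmult (RtoC 0) (Cminus z1 c))) with (f c) in Hd by ring; exact Hd. }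
assert (Df' : Cmod (Cminus (f z1) (f c)) <= m / 2).
{ apply Rle_trans with (1 := Df), Rle_trans with (m / (8 * r) * r).
  - apply Rmult_le_compat_l; [left; apply Rdiv_lt_0_compat; lra | lra].
  - replace (m / (8 * r) * r) with (m / 8) by (field; lra); lra. }
assert (H : Cmod (Cinv (h c)) <= 4 * r / m).
{ apply (mean_value_le (fun z => Cinv (h z)) c r); [exact r0 | |].
  - intros z Bz; destruct (hd z (HD z Bz)) as [k Hk]; eexists.
    apply Cdiff_inv; [exact Hk | apply hn, HD, Bz].
  - intros t.
    assert (Dt : unit_disc (circ c r t)) by (apply HD, box_Cmod; rewrite circ_dist; lra).
    rewrite Cmod_inv by now apply hn.
    replace (4 * r / m) with (/ (m / (4 * r))) by (field; lra).
    apply Rinv_le_contravar; [apply Rdiv_lt_0_compat; lra |].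
    assert (Nt : Cminus (circ c r t) z1 <> RtoC 0) by (apply circ_neq; lra).
    unfold h; rewrite quot_off by (intros E; apply Nt; rewrite E; ring).
    rewrite Cmod_div by exact Nt.
    assert (A1 : m / 2 <= Cmod (Cminus (f (circ c r t)) (f z1))).
    { replace (Cminus (f (circ c r t)) (f z1))
        with (Cminus (Cminus (f (circ c r t)) (f c)) (Cminus (f z1) (f c))) by ring.
      eapply Rle_trans; [ | apply Cmod_triangle_inv]; specialize (Hm t); lra. }
    assert (A2 : Cmod (Cminus (circ c r t) z1) <= 2 * r).
    { replace (Cminus (circ c r t) z1) with (Cminus (Cminus (circ c r t) c) (Cminus z1 c)) by ring.
      eapply Rle_trans; [apply Cmod_minus_le |]; rewrite circ_dist; lra. }
    replace (m / (4 * r)) with (m / 2 * / (2 * r)) by (field; lra).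
    assert (P : 0 < Cmod (Cminus (circ c r t) z1)) by now apply Cmod_gt_0.
    apply Rmult_le_compat; [lra | left; apply Rinv_0_lt_compat; lra | exact A1 |].
    now apply Rinv_le_contravar. }
assert (hc : h c <> RtoC 0) by (apply hn, HD, box_center; lra).
rewrite Cmod_inv in H by exact hc.
assert (Pc : 0 < Cmod (h c)) by now apply Cmod_gt_0.
assert (Hle : Cmod (h c) <= m / (8 * r)).
{ unfold h; assert (N2 : c <> z1) by congruence; rewrite quot_off by exact N2.
  assert (N3 : Cminus c z1 <> RtoC 0) by now apply Cminus_eq_contra.
  rewrite Cmod_div by exact N3.
  assert (P : 0 < Cmod (Cminus c z1)) by now apply Cmod_gt_0.
  apply Rmult_le_reg_r with (1 := P); unfold Rdiv at 1; rewrite Rmult_assoc, Rinv_l, Rmult_1_r by lra.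
  now rewrite (Cmod_minus_sym (f c)), (Cmod_minus_sym c). }
assert (Q : 8 * r / m <= / Cmod (h c)).
{ replace (8 * r / m) with (/ (m / (8 * r))) by (field; lra); now apply Rinv_le_contravar. }
assert (0 < r / m) by (apply Rdiv_lt_0_compat; lra).
unfold Rdiv in *; lra.
Qed.

(** One critical point would spread to a whole neighbourhood, making [f] constant on a short
    horizontal segment. *)
Lemma univalent_derivative_neq0 (c l : C) : unit_disc c -> Cdiff f c l -> l <> RtoC 0.
Proof.
intros Hc Hl E; subst l.
destruct (proj1 (locally_C_eps _ _) (filter_and _ _ (critical_points_open c Hc Hl) (locally_unit_disc c Hc)))
  as (d & d0 & Hd).
assert (Hs : forall t, 0 <= t <= d / 2 -> Cmod (Cminus (Cplus c (RtoC t)) c) < d).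
{ intros t Ht; replace (Cminus (Cplus c (RtoC t)) c) with (RtoC t) by ring.
  rewrite Cmod_R, Rabs_pos_eq by lra; lra. }
assert (H : CI (fun _ => RtoC 0) 0 (d / 2) = Cminus (f (Cplus c (RtoC (d / 2)))) (f (Cplus c (RtoC 0)))).
{ apply (CI_derive (fun t => f (Cplus c (RtoC t)))).
  - rewrite Rmin_left, Rmax_right by lra; intros t Ht.
    eapply slope_eq; [apply (Pdiff_comp t f (fun t => Cplus c (RtoC t))) | ].
    + apply Hd, Hs, Ht.
    + apply Pdiff_plus; [apply Pdiff_const | apply Pdiff_RtoC].
    + ring.
  - intros t _; apply continuous_const. }
rewrite CI_const in H.
assert (E : f (Cplus c (RtoC (d / 2))) = f (Cplus c (RtoC 0))).
{ apply Ceq_minus; rewrite <- H; ring. }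
apply finj in E; [ | apply Hd, Hs; lra | apply Hd, Hs; lra].
apply (f_equal (fun z => fst z - fst c)) in E; simpl in E; lra.
Qed.

(** Total by choice; its values are meaningful only on the image of the disc. *)
Definition finv (w : C) : C := epsilon (inhabits (RtoC 0)) (fun z => unit_disc z /\ f z = w).

Lemma finv_spec (w : C) : (exists z, unit_disc z /\ f z = w) -> unit_disc (finv w) /\ f (finv w) = w.
Proof. exact (epsilon_spec (inhabits (RtoC 0)) (fun z => unit_disc z /\ f z = w)). Qed.

Lemma finv_f (z : C) : unit_disc z -> finv (f z) = z.
Proof.
intros Dz; destruct (finv_spec (f z)) as [H1 H2]; [now exists z |].
now apply finj.
Qed.

Lemma finv_continuous (c : C) : unit_disc c -> continuous finv (f c).
Proof.
intros Dc; apply continuous_C_eps; intros e e0.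
generalize (open_mapping c e Dc e0); apply filter_imp; intros w (z & Dz & Hz & <-).
now rewrite !finv_f.
Qed.

(** The slope function of the inverse is the reciprocal of that of [f] taken at [finv w]; openness
    and f' <> 0 make it continuous. *)
Lemma finv_diff (c l : C) : unit_disc c -> Cdiff f c l -> Cdiff finv (f c) (Cinv l).
Proof.
intros Dc Hl; assert (L0 := univalent_derivative_neq0 c l Dc Hl).
assert (FC := finv_continuous c Dc).
destruct Hl as (phi & Pc & Pl & Pe).
rewrite <- (finv_f c Dc) in Pc, Pe.
exists (fun w => Cinv (phi (finv w))); split; [ | split].
- apply continuous_Cinv; [now apply continuous_comp | rewrite finv_f by exact Dc; congruence].
- rewrite finv_f by exact Dc; congruence.
- assert (N : locally (f c) (fun w => phi (finv w) <> RtoC 0)).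
  { apply (locally_Cneq0 (fun w => phi (finv w))); [now apply continuous_comp |].
    rewrite finv_f by exact Dc; congruence. }
  assert (S : locally (f c) (fun w => f (finv w) = w)).
  { generalize (open_mapping c 1 Dc Rlt_0_1); apply filter_imp; intros w (z & Dz & _ & Ez).
    apply finv_spec; now exists z. }
  generalize (filter_and _ _ (filter_and _ _ N S) (continuous_locally _ _ _ FC Pe)).
  apply filter_imp; intros w [[A B] D].
  rewrite finv_f in D |- * by exact Dc.
  rewrite B in D.
  assert (E : Cminus w (f c) = Cmult (phi (finv w)) (Cminus (finv w) c)).
  { transitivity (Cminus (Cplus (f c) (Cmult (phi (finv w)) (Cminus (finv w) c))) (f c));
      [f_equal; exact D | ring]. }
  rewrite E; change (finv w = Cplus c (Cmult (Cinv (phi (finv w))) (Cmult (phi (finv w)) (Cminus (finv w) c))) :> C).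
  field; exact A.
Qed.

End Univalent.

(** * Schwarz lemma and symmetries *)

(** The maximum principle for k(z) / z. On the unit circle the boundary condition follows from |k| <
    1, since 1 <= (1 + e) |z| nearby. With [U] the punctured disc it is the Schwarz lemma; the
    reflection argument takes for [U] the preimage of a sector. *)
Lemma schwarz_max (U : C -> Prop) (k : C -> C) :
  (forall z, U z -> unit_disc z) -> (forall z, U z -> locally z U) -> ~ U (RtoC 0) ->
  (forall z, U z -> exists l, Cdiff k z l) -> (forall z, U z -> Cmod (k z) < 1) ->
  (forall p, unit_disc p -> ~ U p -> forall e, 0 < e ->
     locally p (fun z => U z -> Cmod (k z) <= (1 + e) * Cmod z)) ->
  forall z, U z -> Cmod (k z) <= Cmod z.
Proof.
intros UD UO U0 kd k1 kb z Uz.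
assert (Un : forall v, U v -> v <> RtoC 0) by (intros v Uv ->; exact (U0 Uv)).
assert (Up : forall v, U v -> 0 < Cmod v) by (intros v Uv; apply Cmod_gt_0; auto).
assert (K : Cmod (Cdiv (k z) z) <= 1).
{ apply (max_principle U (fun v => Cdiv (k v) v)); auto.
  - intros v Uv; destruct (kd v Uv) as [l Hl]; eexists.
    apply Cdiff_div; [exact Hl | apply Cdiff_id | auto].
  - intros p Hp Np e e0.
    assert (L : locally p (fun v => U v -> Cmod (k v) <= (1 + e) * Cmod v)).
    { destruct (Rle_lt_or_eq_dec _ _ Hp) as [Hp1 | Hp1]; [now apply kb |].
      assert (L : locally p (fun v => 1 < (1 + e) * Cmod v)).
      { apply (continuous_gt_locally (fun v : C => (1 + e) * Cmod v)); [ | rewrite Hp1; lra].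
        apply continuous_Rmult; [apply continuous_const |].
        apply (continuous_Cmod (fun v : C => v)), continuous_id. }
      revert L; apply filter_imp; intros v Hv Uv; specialize (k1 v Uv); lra. }
    revert L; apply filter_imp; intros v Hv Uv; rewrite Cmod_div by exact (Un v Uv).
    apply Rmult_le_reg_r with (1 := Up v Uv); unfold Rdiv.
    rewrite Rmult_assoc, Rinv_l, Rmult_1_r by (apply Rgt_not_eq, Up, Uv); auto. }
rewrite Cmod_div in K by exact (Un z Uz).
apply Rmult_le_reg_r with (/ Cmod z); [apply Rinv_0_lt_compat; auto |].
rewrite Rinv_r by exact (Rgt_not_eq _ _ (Up z Uz)); exact K.
Qed.

Lemma Cdiff_Cmod_le (k : C -> C) (l : C) (e : R) :
  k (RtoC 0) = RtoC 0 -> Cdiff k (RtoC 0) l -> 0 < e ->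
  locally (RtoC 0) (fun z => Cmod (k z) <= (Cmod l + e) * Cmod z).
Proof.
intros k0 Hl e0; destruct (Cdiff_affine_error k _ l e Hl e0) as (d & d0 & Hd).
apply locally_C_eps; exists d; split; [exact d0 |]; intros z Hz; specialize (Hd z Hz).
rewrite k0 in Hd; replace (Cminus z (RtoC 0)) with z in Hd by ring.
replace (k z) with (Cplus (Cminus (k z) (Cplus (RtoC 0) (Cmult l z))) (Cmult l z)) by ring.
eapply Rle_trans; [apply Cmod_triangle |]; rewrite Cmod_mult; lra.
Qed.

Lemma Cmod_le_near (k : C -> C) (p : C) (e : R) :
  continuous k p -> Cmod (k p) <= Cmod p -> p <> RtoC 0 -> 0 < e ->
  locally p (fun z => Cmod (k z) <= (1 + e) * Cmod z).
Proof.
intros Hc Hle p0 e0; apply Cmod_gt_0 in p0.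
assert (L : locally p (fun z => Cmod (k z) + - ((1 + e) * Cmod z) < 0)).
{ apply (continuous_lt_locally (fun z : C => Cmod (k z) + - ((1 + e) * Cmod z))); [ | nra].
  apply continuous_Rplus; [now apply continuous_Cmod |].
  apply (continuous_opp (V := R_NormedModule)), continuous_Rmult; [apply continuous_const |].
  apply (continuous_Cmod (fun v : C => v)), continuous_id. }
revert L; apply filter_imp; intros z Hz; lra.
Qed.

Lemma Pdiff_Cmod2 (h : R -> C) (t : R) (m : C) :
  Pdiff h t m ->
  is_derive (fun s => Cmod (h s) ^ 2) t (2 * (fst (h t) * fst m + snd (h t) * snd m)).
Proof.
intros H; apply Pdiff_is_derive in H; destruct H as [H1 H2].
apply (is_derive_ext (fun s => fst (h s) ^ 2 + snd (h s) ^ 2)).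
{ intros s; now rewrite Cmod2_fst_snd. }
replace (2 * (fst (h t) * fst m + snd (h t) * snd m))
  with (INR 2 * fst m * fst (h t) ^ 1 + INR 2 * snd m * snd (h t) ^ 1) by (simpl; ring).
apply (is_derive_plus (V := R_NormedModule)).
- exact (is_derive_pow (fun s => fst (h s)) 2 t (fst m) H1).
- exact (is_derive_pow (fun s => snd (h s)) 2 t (snd m) H2).
Qed.

(** Differentiating |q|^2 = 1 in the directions 1 and i shows that [m] and i m are both orthogonal
    to q(z), which is not 0. *)
Lemma unimodular_derivative (q : C -> C) (z m : C) :
  locally z (fun w => Cmod (q w) = 1) -> Cdiff q z m -> m = RtoC 0.
Proof.
intros L Hm.
assert (A : forall a, Pdiff (fun t => q (Cplus z (Cmult a (RtoC t)))) 0 (Cmult m a)).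
{ intros a; apply (Pdiff_comp 0 q (fun t => Cplus z (Cmult a (RtoC t)))).
  - replace (Cplus z (Cmult a (RtoC 0))) with z by ring; exact Hm.
  - eapply slope_eq; [apply Pdiff_plus; [apply Pdiff_const | apply Pdiff_scal, Pdiff_RtoC] | ring]. }
assert (B : forall a, fst (q z) * fst (Cmult m a) + snd (q z) * snd (Cmult m a) = 0).
{ intros a; assert (D := Pdiff_Cmod2 _ _ _ (A a)).
  assert (E : is_derive (fun t => Cmod (q (Cplus z (Cmult a (RtoC t)))) ^ 2) 0 0).
  { apply (is_derive_ext_loc (fun _ => 1)); [ | apply (is_derive_const (V := R_NormedModule))].
    assert (L' : locally 0 (fun t => Cmod (q (Cplus z (Cmult a (RtoC t)))) = 1)).
    { apply (continuous_locally (fun t => Cplus z (Cmult a (RtoC t))) 0 (fun w => Cmod (q w) = 1)).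
      - apply continuous_Cplus; [apply continuous_const | apply continuous_Cmult].
        + apply continuous_const.
        + apply RtoC_cont.
      - replace (Cplus z (Cmult a (RtoC 0))) with z by ring; exact L. }
    revert L'; apply filter_imp; intros t E; rewrite E; symmetry; exact (pow1 2). }
  apply is_derive_unique in D; apply is_derive_unique in E; rewrite E in D.
  replace (Cplus z (Cmult a (RtoC 0))) with z in D by ring; lra. }
assert (B1 := B (RtoC 1)); assert (B2 := B Ci); simpl in B1, B2.
assert (N : fst (q z) ^ 2 + snd (q z) ^ 2 = 1).
{ rewrite <- Cmod2_fst_snd, (locally_singleton _ _ L); ring. }
destruct (q z) as [x y], m as [u v]; simpl in *.
assert (N' : x ^ 2 + y ^ 2 = 1) by (simpl; exact N).
assert (Hu : u * (x ^ 2 + y ^ 2) = 0).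
{ transitivity (x * (x * u + y * v) + y * (y * u - x * v)); [ring |].
  replace (x * u + y * v) with 0 by lra; replace (y * u - x * v) with 0 by lra; ring. }
assert (Hv : v * (x ^ 2 + y ^ 2) = 0).
{ transitivity (y * (x * u + y * v) - x * (y * u - x * v)); [ring |].
  replace (x * u + y * v) with 0 by lra; replace (y * u - x * v) with 0 by lra; ring. }
rewrite N' in Hu, Hv; apply injective_projections; simpl; lra.
Qed.

Lemma unit_disc_0 : unit_disc (RtoC 0).
Proof. unfold unit_disc; rewrite Cmod_0; lra. Qed.

Lemma unit_disc_scal (z : C) (t : R) : unit_disc z -> 0 <= t <= 1 -> unit_disc (Cmult z (RtoC t)).
Proof.
unfold unit_disc; intros Hz Ht; rewrite Cmod_mult, Cmod_R, Rabs_pos_eq by lra.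
generalize (Cmod_ge_0 z); nra.
Qed.

Definition conformal (f : C -> C) (Om : C -> Prop) : Prop :=
  (forall z, unit_disc z -> exists l, Cdiff f z l) /\
  (forall z, unit_disc z -> Om (f z)) /\
  (forall z w, unit_disc z -> unit_disc w -> f z = f w -> z = w) /\
  (forall w, Om w -> exists z, unit_disc z /\ f z = w).

Lemma conformal_finv (f : C -> C) (Om : C -> Prop) (w : C) :
  conformal f Om -> Om w ->
  unit_disc (finv f w) /\ f (finv f w) = w /\ exists l, Cdiff (finv f) w l.
Proof.
intros (fd & fO & fi & fs) Ow; destruct (finv_spec f w (fs w Ow)) as [H1 H2].
split; [exact H1 | split; [exact H2 |]].
destruct (fd _ H1) as [l Hl]; exists (Cinv l).
rewrite <- H2; now apply finv_diff.
Qed.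

(** The Schwarz lemma for the composite of [g] with the inverse of [f]; the common derivative [l]
    gives it derivative 1 at 0, which is the bound required at the puncture. *)
Lemma Schwarz_transition (Om : C -> Prop) (f g : C -> C) (l z : C) :
  conformal f Om -> conformal g Om -> f (RtoC 0) = RtoC 0 -> g (RtoC 0) = RtoC 0 ->
  Cdiff f (RtoC 0) l -> Cdiff g (RtoC 0) l -> unit_disc z ->
  Cmod (finv f (g z)) <= Cmod z.
Proof.
intros Cf Cg f0 g0 fl gl Dz.
assert (Cf' := Cf); destruct Cf' as (fd & fO & fi & fs).
assert (Cg' := Cg); destruct Cg' as (gd & gO & gi & gs).
assert (k0 : finv f (g (RtoC 0)) = RtoC 0).
{ rewrite g0; rewrite <- f0 at 1; exact (finv_f f fi _ unit_disc_0). }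
destruct (Ceq_dec z (RtoC 0)) as [-> | Nz]; [rewrite k0; lra |].
apply (schwarz_max (fun v => unit_disc v /\ v <> RtoC 0) (fun v => finv f (g v))); try tauto.
- intros v [Dv Nv]; apply filter_and; [now apply locally_unit_disc | now apply locally_Cneq].
- intros v [Dv Nv]; destruct (gd v Dv) as [m Hm].
  destruct (conformal_finv f Om (g v) Cf (gO v Dv)) as (_ & _ & n & Hn).
  exists (Cmult n m); exact (Cdiff_comp v (finv f) g n m Hn Hm).
- intros v [Dv Nv]; apply (conformal_finv f Om (g v) Cf (gO v Dv)).
- intros p Dp Np e e0.
  assert (p = RtoC 0) as -> by (destruct (Ceq_dec p (RtoC 0)); tauto).
  assert (L0 := univalent_derivative_neq0 f fd fi _ _ unit_disc_0 fl).
  assert (Dk : Cdiff (fun v => finv f (g v)) (RtoC 0) (Cmult (Cinv l) l)).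
  { assert (F := finv_diff f fd fi _ l unit_disc_0 fl); rewrite f0 in F.
    apply (Cdiff_comp _ (finv f) g); [now rewrite g0 | exact gl]. }
  rewrite Cinv_l in Dk by exact L0.
  generalize (Cdiff_Cmod_le _ _ e k0 Dk e0); rewrite Cmod_1.
  apply filter_imp; auto.
Qed.

(** Applied both ways, [Schwarz_transition] yields |k z| = |z| for the transition map. Its divided
    difference at 0 is thus unimodular, has derivative 0, and keeps along the segment from 0 to z
    its initial value 1. *)
Lemma conformal_unique (Om : C -> Prop) (f g : C -> C) (l z : C) :
  conformal f Om -> conformal g Om -> f (RtoC 0) = RtoC 0 -> g (RtoC 0) = RtoC 0 ->
  Cdiff f (RtoC 0) l -> Cdiff g (RtoC 0) l -> unit_disc z -> g z = f z.
Proof.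
intros Cf Cg f0 g0 fl gl.
assert (Cf' := Cf); destruct Cf' as (fd & fO & fi & fs).
assert (Cg' := Cg); destruct Cg' as (gd & gO & gi & gs).
set (k := fun v => finv f (g v)).
assert (k0 : k (RtoC 0) = RtoC 0).
{ unfold k; rewrite g0; rewrite <- f0 at 1; exact (finv_f f fi _ unit_disc_0). }
assert (Hk : forall v, unit_disc v -> unit_disc (k v) /\ f (k v) = g v /\ exists m, Cdiff k v m).
{ intros v Dv; destruct (conformal_finv f Om (g v) Cf (gO v Dv)) as (H1 & H2 & n & Hn).
  destruct (gd v Dv) as [m Hm].
  split; [exact H1 | split; [exact H2 |]]; exists (Cmult n m); exact (Cdiff_comp v (finv f) g n m Hn Hm). }
assert (L0 := univalent_derivative_neq0 f fd fi _ _ unit_disc_0 fl).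
assert (Dk : Cdiff k (RtoC 0) (RtoC 1)).
{ assert (F := finv_diff f fd fi _ l unit_disc_0 fl); rewrite f0 in F.
  eapply slope_eq; [apply (Cdiff_comp _ (finv f) g); [rewrite g0; exact F | exact gl] | apply Cinv_l, L0]. }
assert (Mk : forall v, unit_disc v -> Cmod (k v) = Cmod v).
{ intros v Dv; apply Rle_antisym; [now apply (Schwarz_transition Om f g l) |].
  destruct (Hk v Dv) as (D1 & E1 & _).
  assert (H := Schwarz_transition Om g f l (k v) Cg Cf g0 f0 gl fl D1).
  rewrite E1, finv_f in H; assumption. }
set (Q := quot k (RtoC 0) (RtoC 1)).
assert (MQ : forall v, unit_disc v -> Cmod (Q v) = 1).
{ intros v Dv; unfold Q; destruct (Ceq_dec v (RtoC 0)) as [-> | N]; [rewrite quot_at; apply Cmod_1 |].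
  rewrite quot_off by exact N; rewrite k0.
  replace (Cminus (k v) (RtoC 0)) with (k v) by ring; replace (Cminus v (RtoC 0)) with v by ring.
  rewrite Cmod_div, Mk by assumption; apply Rinv_r; apply Rgt_not_eq, Cmod_gt_0, N. }
assert (DQ : forall v, unit_disc v -> Cdiff Q v (RtoC 0)).
{ intros v Dv; destruct (quot_holomorphic unit_disc k (RtoC 0) (RtoC 1) v locally_unit_disc) as [m Hm]; auto.
  { intros w Dw; apply (Hk w Dw). }
  change (Cdiff Q v m) in Hm; rewrite <- (unimodular_derivative Q v m); [exact Hm | | exact Hm].
  generalize (locally_unit_disc _ Dv); apply filter_imp; auto. }
intros Dz.
assert (H : CI (fun _ => RtoC 0) 0 1 = Cminus (Q (Cmult z (RtoC 1))) (Q (Cmult z (RtoC 0)))).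
{ apply (CI_derive (fun t => Q (Cmult z (RtoC t)))).
  - rewrite Rmin_left, Rmax_right by lra; intros t Ht.
    eapply slope_eq; [apply (Pdiff_comp t Q (fun t => Cmult z (RtoC t))) | ].
    + now apply DQ, unit_disc_scal.
    + apply Pdiff_scal, Pdiff_RtoC.
    + ring.
  - intros t _; apply continuous_const. }
rewrite CI_const in H.
assert (E : Q z = RtoC 1).
{ replace (Cmult z (RtoC 1)) with z in H by ring; replace (Cmult z (RtoC 0)) with (RtoC 0) in H by ring.
  unfold Q in H at 2; rewrite quot_at in H.
  apply Ceq_minus; rewrite <- H; ring. }
destruct (Hk z Dz) as (_ & <- & _); f_equal.
destruct (Ceq_dec z (RtoC 0)) as [-> | N]; [exact k0 |].
unfold Q in E; rewrite quot_off, k0 in E by exact N.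
replace (k z) with (Cmult (Cdiv (Cminus (k z) (RtoC 0)) (Cminus z (RtoC 0))) z)
  by (field; intros X; apply N; rewrite <- X; ring).
rewrite E; ring.
Qed.

Lemma Cdiff_conj (f : C -> C) (z l : C) :
  Cdiff f (Cconj z) l -> Cdiff (fun w => Cconj (f (Cconj w))) z (Cconj l).
Proof.
intros (phi & Pc & Pl & Pe).
assert (Cc : continuous Cconj z) by apply (continuous_Cconj (fun w : C => w)), continuous_id.
exists (fun w => Cconj (phi (Cconj w))); split; [ | split; [congruence |]].
- apply continuous_Cconj; now apply continuous_comp.
- generalize (continuous_locally _ _ _ Cc Pe); apply filter_imp; intros w Hw.
  rewrite Hw, Cplus_conj, Cmult_conj, Cminus_conj, !Cconj_conj; reflexivity.
Qed.

Lemma unit_disc_conj (z : C) : unit_disc z -> unit_disc (Cconj z).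
Proof. unfold unit_disc; now rewrite Cmod_conj. Qed.

Lemma unit_disc_opp (z : C) : unit_disc z -> unit_disc (Copp z).
Proof. unfold unit_disc; now rewrite Cmod_opp. Qed.

Lemma conformal_conj (f : C -> C) (Om : C -> Prop) :
  (forall w, Om w -> Om (Cconj w)) -> conformal f Om ->
  conformal (fun z => Cconj (f (Cconj z))) Om.
Proof.
intros HO (fd & fO & fi & fs); repeat split.
- intros z Dz; destruct (fd _ (unit_disc_conj z Dz)) as [l Hl].
  exists (Cconj l); now apply Cdiff_conj.
- intros z Dz; apply HO, fO, unit_disc_conj, Dz.
- intros z w Dz Dw E; apply (f_equal Cconj) in E; rewrite !Cconj_conj in E.
  apply fi in E; auto using unit_disc_conj.
  now rewrite <- (Cconj_conj z), E, Cconj_conj.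
- intros w Ow; destruct (fs _ (HO _ Ow)) as (z & Dz & Ez); exists (Cconj z).
  split; [now apply unit_disc_conj |]; now rewrite Cconj_conj, Ez, Cconj_conj.
Qed.

Lemma Cdiff_odd (f : C -> C) (z l : C) :
  Cdiff f (Copp z) l -> Cdiff (fun w => Copp (f (Copp w))) z l.
Proof.
intros H; eapply slope_eq.
- apply Cdiff_opp; apply (Cdiff_comp z f Copp); [exact H | apply Cdiff_opp, Cdiff_id].
- ring.
Qed.

Lemma Copp_opp (z : C) : Copp (Copp z) = z.
Proof. ring. Qed.

Lemma conformal_odd (f : C -> C) (Om : C -> Prop) :
  (forall w, Om w -> Om (Copp w)) -> conformal f Om ->
  conformal (fun z => Copp (f (Copp z))) Om.
Proof.
intros HO (fd & fO & fi & fs); repeat split.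
- intros z Dz; destruct (fd _ (unit_disc_opp z Dz)) as [l Hl].
  exists l; now apply Cdiff_odd.
- intros z Dz; apply HO, fO, unit_disc_opp, Dz.
- intros z w Dz Dw E; apply (f_equal Copp) in E; rewrite !Copp_opp in E.
  apply fi in E; auto using unit_disc_opp.
  now rewrite <- (Copp_opp z), E, Copp_opp.
- intros w Ow; destruct (fs _ (HO _ Ow)) as (z & Dz & Ez); exists (Copp z).
  split; [now apply unit_disc_opp |]; now rewrite Copp_opp, Ez, Copp_opp.
Qed.

(** Cosine is even and decreasing on [0, pi], so an arc about the positive axis is cut out of its
    circle by a bound on the real part. *)
Lemma arc_0_iff (r theta : R) (z : C) : 0 < r -> 0 < theta <= PI / 2 -> Cmod z = r ->
  (arc r 0 theta z <-> r * cos theta < fst z).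
Proof.
intros r0 Ht Hz; assert (P := PI_RGT_0); split.
- intros (t & Hd & ->); simpl; rewrite Rminus_0_r in Hd.
  apply Rmult_lt_compat_l; [exact r0 |].
  assert (E : cos t = cos (Rabs t)) by (unfold Rabs; destruct Rcase_abs; [now rewrite cos_neg | reflexivity]).
  rewrite E; apply cos_decreasing_1; generalize (Rabs_pos t); lra.
- intros Hlt.
  assert (N : fst z ^ 2 + snd z ^ 2 = r ^ 2) by (rewrite <- Hz; symmetry; apply Cmod2_fst_snd).
  set (x := fst z / r).
  assert (Ex : fst z = r * x) by (unfold x; field; lra).
  assert (B : -1 <= x <= 1).
  { assert (x ^ 2 <= 1).
    { apply Rmult_le_reg_l with (r ^ 2); [apply pow_lt; exact r0 |].
      replace (r ^ 2 * x ^ 2) with (fst z ^ 2) by (rewrite Ex; ring).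
      generalize (pow2_ge_0 (snd z)); lra. }
    nra. }
  assert (A : Rabs (acos x) < theta).
  { assert (Hb := acos_bound x); rewrite Rabs_pos_eq by lra.
    apply Rnot_le_lt; intros Hle.
    apply cos_decr_1 in Hle; try lra.
    rewrite cos_acos in Hle by exact B.
    apply Rmult_le_compat_l with (r := r) in Hle; lra. }
  assert (S : (r * sin (acos x)) ^ 2 = snd z ^ 2).
  { assert (H := sin2_cos2 (acos x)); rewrite cos_acos in H by exact B; unfold Rsqr in H.
    assert (snd z ^ 2 = r ^ 2 - (r * x) ^ 2) by (rewrite <- Ex; lra).
    replace ((r * sin (acos x)) ^ 2) with (r ^ 2 * (sin (acos x) * sin (acos x))) by ring.
    replace (sin (acos x) * sin (acos x)) with (1 - x * x) by lra; lra. }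
  assert (S' : r * sin (acos x) = snd z \/ r * sin (- acos x) = snd z).
  { rewrite sin_neg.
    assert (F : (r * sin (acos x) - snd z) * (r * sin (acos x) + snd z) = 0).
    { transitivity ((r * sin (acos x)) ^ 2 - snd z ^ 2); [ring | lra]. }
    apply Rmult_integral in F; destruct F; [left | right]; lra. }
  (* The real part fixes the angle up to sign; the imaginary part selects the sign. *)
  destruct S' as [S' | S']; [exists (acos x) | exists (- acos x)];
    rewrite Rminus_0_r, ?Rabs_Ropp; (split; [exact A |]);
    apply injective_projections; simpl; rewrite ?cos_neg, ?cos_acos by exact B; auto.
Qed.

Lemma arc_PI_iff (r theta : R) (z : C) : arc r PI theta z <-> arc r 0 theta (Copp z).
Proof.
split; intros (t & Hd & E).
- exists (t - PI); split; [now rewrite Rminus_0_r |].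
  subst z; apply injective_projections; simpl; rewrite ?cos_minus, ?sin_minus, cos_PI, sin_PI; ring.
- exists (t + PI); split; [replace (t + PI - PI) with (t - 0) by ring; exact Hd |].
  replace z with (Copp (Copp z)) by ring; rewrite E.
  apply injective_projections; simpl; rewrite ?neg_cos, ?neg_sin; ring.
Qed.

(** The three alternatives of the definition merge into one monotonicity on each circle. Both axial
    symmetries and the reflection property are instances of it. *)
Lemma bi_circular_mono (Om : C -> Prop) (w w' : C) :
  bi_circularly_symmetric Om -> Om w -> Cmod w' = Cmod w -> Rabs (fst w) <= Rabs (fst w') -> Om w'.
Proof.
intros HB Ow HM HR.
destruct (Rle_lt_or_eq_dec 0 (Cmod w) (Cmod_ge_0 w)) as [r0 | r0].
- destruct (HB (Cmod w) r0) as [H | [H | (theta & Ht & H)]].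
  + exfalso; now apply (H w).
  + now apply H.
  + apply H in Ow; [ | reflexivity]; apply H; [exact HM |].
    rewrite arc_PI_iff, !arc_0_iff in Ow |- * by (rewrite ?Cmod_opp; auto); simpl in *.
    (* As theta <= pi/2 the threshold is nonnegative, so the two arcs together are the condition
       |Re| > r cos theta. *)
    assert (C0 : 0 <= Cmod w * cos theta).
    { apply Rmult_le_pos; [lra | apply cos_ge_0; generalize PI_RGT_0; lra]. }
    revert HR; unfold Rabs; repeat destruct Rcase_abs; lra.
- rewrite <- r0 in HM; apply Cmod_eq_0 in HM; symmetry in r0; apply Cmod_eq_0 in r0; congruence.
Qed.

(** * Reflections across a sector *)

Definition quadrant (s : C) : Prop := 0 < fst s /\ 0 < snd s.

Lemma locally_quadrant {U : UniformSpace} (g : U -> C) (x : U) :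
  continuous g x -> quadrant (g x) -> locally x (fun y => quadrant (g y)).
Proof.
intros Hc [H1 H2]; apply filter_and.
- apply (continuous_gt_locally (fun y => fst (g y))); [now apply continuous_C_fst | exact H1].
- apply (continuous_gt_locally (fun y => snd (g y))); [now apply continuous_C_snd | exact H2].
Qed.

Lemma Cmod_1_conj (a : C) : Cmod a = 1 -> Cmult a (Cconj a) = RtoC 1.
Proof. intros H; rewrite <- Cmod2_conj, H; apply injective_projections; simpl; ring. Qed.

Lemma derivative_le_0_right (F : R -> R) (t d : R) :
  is_derive F t d -> locally t (fun s => t < s -> F s <= F t) -> d <= 0.
Proof.
intros H [e He]; apply is_derive_Reals in H.
apply Rnot_lt_le; intros d0.
destruct (H (d / 2)) as [e2 H2]; [lra |].
set (h := Rmin e e2 / 2).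
assert (m0 : 0 < Rmin e e2) by (apply Rmin_pos; apply cond_pos).
assert (h1 : h < e) by (generalize (Rmin_l e e2); unfold h; lra).
assert (h2 : h < e2) by (generalize (Rmin_r e e2); unfold h; lra).
assert (h0 : 0 < h) by (unfold h; lra).
assert (K1 : F (t + h) <= F t).
{ apply He; [ | lra]; change (Rabs (t + h - t) < e).
  replace (t + h - t) with h by ring; rewrite Rabs_pos_eq; lra. }
assert (K2 := H2 h ltac:(lra) ltac:(rewrite Rabs_pos_eq; lra)).
apply Rabs_def2 in K2.
assert (K3 : (F (t + h) - F t) / h <= 0).
{ apply Rmult_le_reg_r with (1 := h0); unfold Rdiv; rewrite Rmult_assoc, Rinv_l, Rmult_1_r by lra; lra. }
lra.
Qed.

Section BiCircular.
Variables (Om : C -> Prop) (f : C -> C) (l : C).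
Hypothesis HB : bi_circularly_symmetric Om.
Hypothesis Hf : conformal f Om.
Hypothesis f0 : f (RtoC 0) = RtoC 0.
Hypothesis fl : Cdiff f (RtoC 0) l.
Hypothesis lreal : Cconj l = l.

Lemma Om_conj (w : C) : Om w -> Om (Cconj w).
Proof. intros H; apply (bi_circular_mono Om w); auto; [apply Cmod_conj | simpl; lra]. Qed.

Lemma Om_opp (w : C) : Om w -> Om (Copp w).
Proof. intros H; apply (bi_circular_mono Om w); auto; [apply Cmod_opp | simpl; rewrite Rabs_Ropp; lra]. Qed.

Lemma f_conj (z : C) : unit_disc z -> f (Cconj z) = Cconj (f z).
Proof.
intros Dz.
assert (Z : Cconj (RtoC 0) = RtoC 0) by (apply injective_projections; simpl; ring).
assert (H := conformal_unique Om f (fun v => Cconj (f (Cconj v))) l (Cconj z) Hf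
  (conformal_conj f Om Om_conj Hf) f0).
simpl in H; rewrite Z, f0, Z, Cconj_conj in H; symmetry; apply H; auto.
- rewrite <- lreal; apply Cdiff_conj; now rewrite Z.
- now apply unit_disc_conj.
Qed.

Lemma f_odd (z : C) : unit_disc z -> f (Copp z) = Copp (f z).
Proof.
intros Dz.
assert (Z : Copp (RtoC 0) = RtoC 0) by ring.
assert (H := conformal_unique Om f (fun v => Copp (f (Copp v))) l (Copp z) Hf
  (conformal_odd f Om Om_opp Hf) f0).
simpl in H; rewrite Z, f0, Z, Copp_opp in H; symmetry; apply H; auto.
- apply Cdiff_odd; now rewrite Z.
- now apply unit_disc_opp.
Qed.

Notation g := (finv f).

(* [|Re (a s)| <= |Re (conj a s)|]. *)
Lemma Om_reflect (a s : C) :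
  0 <= fst a * fst s -> 0 <= snd a * snd s -> Om (Cmult a s) -> Om (Cmult (Cconj a) s).
Proof.
intros H1 H2; intros H; apply (bi_circular_mono Om (Cmult a s)); auto.
- now rewrite !Cmod_mult, Cmod_conj.
- simpl; unfold Rabs; repeat destruct Rcase_abs; lra.
Qed.

(* For [a = e^(i alpha)], [conj a s] is the conjugate of the mirror image
   [a conj s] of [a s] in the line of direction [a].  The maximum principle is
   applied to [g (conj a ^ 2 * f z) / z] on the set where [f z] lies in the sector
   [alpha < arg < alpha + pi / 2]; on its two sides [conj a ^ 2 * w] equals
   [conj w], resp. [- conj w], and both maps preserve the modulus of [g]. *)
Lemma reflection_principle (a s : C) :
  Cmod a = 1 -> quadrant a -> quadrant s -> Om (Cmult a s) ->
  Cmod (g (Cmult (Cconj a) s)) <= Cmod (g (Cmult a s)).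
Proof.
intros a1 [qa1 qa2] [qs1 qs2] Os.
assert (Hf' := Hf); destruct Hf' as (fd & fO & fi & fs).
assert (AA := Cmod_1_conj a a1).
assert (A0 : forall v, v = Cmult a (Cmult (Cconj a) v)).
{ intros v; rewrite Cmult_assoc, AA; ring. }
(* Rotating by conj a carries the sector onto the open first quadrant, where membership is two sign
   conditions. *)
set (S := fun z => Cmult (Cconj a) (f z)).
assert (ES : forall z, f z = Cmult a (S z)) by (intros; apply A0).
assert (Sc : forall z, unit_disc z -> continuous S z).
{ intros z Dz; destruct (fd z Dz) as [m Hm]; apply continuous_Cmult; [apply continuous_const |].
  exact (Cdiff_continuous _ _ _ Hm). }
assert (OS : forall z, unit_disc z -> 0 <= fst (S z) -> 0 <= snd (S z) -> Om (Cmult (Cconj a) (S z))).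
{ intros z Dz H1 H2; apply Om_reflect; [apply Rmult_le_pos; lra | apply Rmult_le_pos; lra |].
  rewrite <- ES; now apply fO. }
set (U := fun z => unit_disc z /\ quadrant (S z)).
set (k := fun z => g (Cmult (Cconj a) (S z))).
destruct (conformal_finv f Om _ Hf Os) as (Dz & Ez & _).
assert (Uz : U (g (Cmult a s))).
{ split; [exact Dz |]; unfold S; rewrite Ez.
  replace (Cmult (Cconj a) (Cmult a s)) with (Cmult (Cmult a (Cconj a)) s) by ring.
  rewrite AA; replace (Cmult (RtoC 1) s) with s by ring; split; assumption. }
replace (Cmult (Cconj a) s) with (Cmult (Cconj a) (S (g (Cmult a s)))).
2:{ unfold S; rewrite Ez.
    replace (Cmult (Cconj a) (Cmult a s)) with (Cmult (Cmult a (Cconj a)) s) by ring.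
    rewrite AA; ring. }
assert (kd : forall z, unit_disc z -> Om (Cmult (Cconj a) (S z)) -> exists m, Cdiff k z m).
{ intros z Dv Ov; destruct (fd z Dv) as [m Hm].
  destruct (conformal_finv f Om _ Hf Ov) as (_ & _ & n & Hn).
  exists (Cmult n (Cmult (Cconj a) (Cmult (Cconj a) m))).
  apply (Cdiff_comp z g (fun v => Cmult (Cconj a) (S v))); [exact Hn |].
  apply Cdiff_scal, Cdiff_scal, Hm. }
apply (schwarz_max U k); [| | | | | | exact Uz].
- now intros z [H _].
- intros z [Dv Q]; apply filter_and; [now apply locally_unit_disc |].
  apply locally_quadrant; auto.
- intros [_ [H _]]; unfold S in H; rewrite f0 in H; simpl in H; lra.
- intros z [Dv [Q1 Q2]]; apply kd; [exact Dv | apply OS; auto; lra].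
- intros z [Dv [Q1 Q2]]; unfold k; apply (conformal_finv f Om _ Hf); apply OS; auto; lra.
- intros p Dp Np e e0.
  destruct (Rlt_dec (fst (S p)) 0) as [N1 | N1].
  { generalize (continuous_lt_locally (fun z => fst (S z)) p 0 (continuous_C_fst _ _ (Sc p Dp)) N1).
    apply filter_imp; intros z Hz [_ [Q _]]; lra. }
  destruct (Rlt_dec (snd (S p)) 0) as [N2 | N2].
  { generalize (continuous_lt_locally (fun z => snd (S z)) p 0 (continuous_C_snd _ _ (Sc p Dp)) N2).
    apply filter_imp; intros z Hz [_ [_ Q]]; lra. }
  apply Rnot_lt_le in N1; apply Rnot_lt_le in N2.
  assert (Op := OS p Dp N1 N2).
  destruct (Ceq_dec p (RtoC 0)) as [-> | P0].
  (* At 0 the derivatives of [f] and of its inverse cancel, and k'(0) = (conj a)^2 has modulus 1. *)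
  + assert (L0 := univalent_derivative_neq0 f fd fi _ _ unit_disc_0 fl).
    assert (F := finv_diff f fd fi _ l unit_disc_0 fl); rewrite f0 in F.
    assert (k0 : k (RtoC 0) = RtoC 0).
    { unfold k, S; rewrite f0; replace (Cmult (Cconj a) (Cmult (Cconj a) (RtoC 0))) with (RtoC 0) by ring.
      rewrite <- f0 at 1; exact (finv_f f fi _ unit_disc_0). }
    assert (Dk : Cdiff k (RtoC 0) (Cmult (Cconj a) (Cconj a))).
    { eapply slope_eq.
      - apply (Cdiff_comp _ g (fun v => Cmult (Cconj a) (S v))).
        + unfold S; rewrite f0.
          replace (Cmult (Cconj a) (Cmult (Cconj a) (RtoC 0))) with (RtoC 0) by ring; exact F.
        + apply Cdiff_scal, Cdiff_scal, fl.
      - field; exact L0. }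
    generalize (Cdiff_Cmod_le _ _ e k0 Dk e0).
    rewrite Cmod_mult, Cmod_conj, a1, Rmult_1_l; apply filter_imp; auto.
  (* Here S p lies on a side of the quadrant, and k p is conj p or - conj p. By [Op], k is still
     differentiable at p, so the bound extends to nearby points up to the factor 1 + e. *)
  + assert (Hk : Cmod (k p) <= Cmod p).
    { assert (B : S p = Cconj (S p) \/ S p = Copp (Cconj (S p))).
      { destruct (Rle_lt_or_eq_dec _ _ N1) as [L1 | E1]; [destruct (Rle_lt_or_eq_dec _ _ N2) as [L2 | E2] |].
        - exfalso; apply Np; split; [exact Dp | split; assumption].
        - left; apply injective_projections; unfold Cconj; cbn [fst snd]; [reflexivity | rewrite <- E2; ring].
        - right; apply injective_projections; unfold Cconj, Copp; cbn [fst snd]; [rewrite <- E1; ring | ring]. }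
      unfold k; right; destruct B as [B | B]; rewrite B.
      - replace (Cmult (Cconj a) (Cconj (S p))) with (f (Cconj p))
          by (rewrite f_conj, ES, Cmult_conj by exact Dp; reflexivity).
        rewrite (finv_f f fi) by now apply unit_disc_conj.
        apply Cmod_conj.
      - replace (Cmult (Cconj a) (Copp (Cconj (S p)))) with (f (Copp (Cconj p))).
        + rewrite (finv_f f fi) by now apply unit_disc_opp, unit_disc_conj.
          now rewrite Cmod_opp, Cmod_conj.
        + rewrite f_odd, f_conj, ES, Cmult_conj by (auto using unit_disc_conj); ring. }
    destruct (kd p Dp Op) as [m Hm].
    generalize (Cmod_le_near k p e (Cdiff_continuous _ _ _ Hm) Hk P0 e0); apply filter_imp; auto.
Qed.

(** Turning w = f(z) clockwise to w e^(-it) does not increase the modulus of the preimage: this is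
    [reflection_principle] with a = e^(it/2) and s = w e^(-it/2). The right derivative at t = 0 then
    gives the sign. *)
Lemma quadrant_logderivative (z m : C) :
  unit_disc z -> Cdiff f z m -> quadrant (f z) ->
  0 <= snd (Cdiv (Cmult z m) (f z)).
Proof.
intros Dz Hm Q.
assert (Hf' := Hf); destruct Hf' as (fd & fO & fi & fs).
assert (m0 := univalent_derivative_neq0 f fd fi z m Dz Hm).
set (w := f z) in *.
set (h := fun t => g (Cmult w (cis (- t)))).
assert (c0 : cis (- 0) = RtoC 1).
{ unfold cis; rewrite Ropp_0, cos_0, sin_0; reflexivity. }
assert (Pc : forall t, Pdiff (fun s => cis (- s)) t (Copp (Cmult Ci (cis (- t))))).
{ intros t; apply is_derive_Pdiff; unfold cis; simpl; auto_derive; trivial; ring. }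
assert (h0 : h 0 = z).
{ unfold h; rewrite c0; replace (Cmult w (RtoC 1)) with w by ring; now apply finv_f. }
assert (Ph : Pdiff h 0 (Cmult (Cinv m) (Cmult w (Copp Ci)))).
{ apply (Pdiff_comp 0 g (fun t => Cmult w (cis (- t)))).
  - rewrite c0; replace (Cmult w (RtoC 1)) with w by ring; now apply finv_diff.
  - eapply slope_eq; [apply Pdiff_scal, Pc |]; rewrite c0; ring. }
assert (D := derivative_le_0_right _ _ _ (Pdiff_Cmod2 _ _ _ Ph)).
assert (K : locally 0 (fun t => 0 < t -> Cmod (h t) ^ 2 <= Cmod (h 0) ^ 2)).
{ assert (L1 : locally 0 (fun t => quadrant (Cmult w (cis (- (t / 2)))))).
  { apply locally_quadrant.
    - apply continuous_Cmult; [apply continuous_const |].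
      apply (continuous_comp (fun t => t / 2) (fun s => cis (- s))).
      + apply continuous_Rmult; [apply continuous_id | apply continuous_const].
      + exact (Pdiff_continuous _ _ _ (Pc (0 / 2))).
    - replace (0 / 2) with 0 by field; rewrite c0.
      now replace (Cmult w (RtoC 1)) with w by ring. }
  (* As 1 < pi/2, t < 1 keeps e^(it/2) in the open quadrant for t > 0. *)
  assert (L2 : locally 0 (fun t => Rabs (t - 0) < 1)) by exact (locally_ball 0 (mkposreal 1 Rlt_0_1)).
  generalize (filter_and _ _ L1 L2); apply filter_imp; intros t [H1 H2] t0; rewrite h0.
  rewrite Rminus_0_r, Rabs_pos_eq in H2 by lra.
  assert (P1 := PI2_1).
  assert (Ew : w = Cmult (cis (t / 2)) (Cmult w (cis (- (t / 2))))).
  { replace (Cmult (cis (t / 2)) (Cmult w (cis (- (t / 2))))) with (Cmult w (Cmult (cis (t / 2)) (cis (- (t / 2))))) by ring.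
    replace (Cmult (cis (t / 2)) (cis (- (t / 2)))) with (RtoC 1); [ring |].
    unfold cis; rewrite cos_neg, sin_neg; apply injective_projections; simpl; [ | ring].
    generalize (sin2_cos2 (t / 2)); unfold Rsqr; lra. }
  assert (Ec : Cmult (Cconj (cis (t / 2))) (Cmult w (cis (- (t / 2)))) = Cmult w (cis (- t))).
  { replace (Cmult (Cconj (cis (t / 2))) (Cmult w (cis (- (t / 2)))))
      with (Cmult w (Cmult (Cconj (cis (t / 2))) (cis (- (t / 2))))) by ring.
    f_equal; replace (- t) with (- (t / 2) + - (t / 2)) by field.
    unfold cis; rewrite cos_plus, sin_plus, cos_neg, sin_neg.
    apply injective_projections; simpl; ring. }
  assert (R := reflection_principle (cis (t / 2)) (Cmult w (cis (- (t / 2)))) (Cmod_cis _)).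
  rewrite <- Ew, Ec in R.
  apply pow_incr; split; [apply Cmod_ge_0 |].
  unfold h; replace (Cmod z) with (Cmod (g w)) by (unfold w; now rewrite (finv_f f fi)).
  apply R; [ | exact H1 | now apply fO].
  split; simpl; [apply cos_gt_0; lra | apply sin_gt_0; lra]. }
specialize (D K); rewrite h0 in D.
assert (w0 : w <> RtoC 0) by (intros E; destruct Q as [Q _]; rewrite E in Q; simpl in Q; lra).
assert (z0 : z <> RtoC 0) by (intros E; apply w0; unfold w; rewrite E; exact f0).
set (X := Cdiv (Cmult z m) w).
assert (X0 : X <> RtoC 0).
{ intros E; apply (Cmult_neq_0 z m z0 m0).
  transitivity (Cmult X w); [unfold X; field; exact w0 | rewrite E; ring]. }
(* [w / m = z / X], so [D] says that [2 |z|^2 Im (1 / X) <= 0]. *)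
assert (EY : Cmult (Cinv m) (Cmult w (Copp Ci)) = Cmult z (Cmult (Copp Ci) (Cinv X))).
{ unfold X; field; auto. }
rewrite EY in D.
assert (N2 : 0 < fst X ^ 2 + snd X ^ 2) by (rewrite <- Cmod2_fst_snd; apply pow_lt, Cmod_gt_0, X0).
assert (Nz : 0 < fst z ^ 2 + snd z ^ 2) by (rewrite <- Cmod2_fst_snd; apply pow_lt, Cmod_gt_0, z0).
destruct X as [x y], z as [p q]; simpl in D, N2, Nz |- *.
set (I := / (x * (x * 1) + y * (y * 1))) in *.
assert (I0 : 0 < I) by (apply Rinv_0_lt_compat; exact N2).
unfold Rdiv in D; fold I in D.
assert (D' : - 2 * ((p * (p * 1) + q * (q * 1)) * I) * y <= 0).
{ eapply Rle_trans; [right | exact D]; ring. }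
assert (0 < (p * (p * 1) + q * (q * 1)) * I) by now apply Rmult_lt_0_compat.
nra.
Qed.

End BiCircular.

(** * Restriction to the two axes *)

Lemma mean_value_R (F F' : R -> R) (x y : R) :
  x < y -> (forall c, x <= c <= y -> is_derive F c (F' c)) ->
  exists c, x < c < y /\ F y - F x = F' c * (y - x).
Proof.
intros Hxy HF; destruct (MVT_cor2 F F' x y Hxy) as (c & E & Hc).
- intros c Hc; now apply is_derive_Reals, HF.
- now exists c.
Qed.

Lemma derivative_ge0_le (F F' : R -> R) (x y : R) :
  x <= y -> (forall c, x <= c <= y -> is_derive F c (F' c)) ->
  (forall c, x < c < y -> 0 <= F' c) -> F x <= F y.
Proof.
intros Hxy HF Hp; destruct (Rle_lt_or_eq_dec _ _ Hxy) as [L | <-]; [ | lra].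
destruct (mean_value_R F F' x y L HF) as (c & Hc & E); specialize (Hp c Hc).
assert (0 <= F' c * (y - x)) by (apply Rmult_le_pos; lra); lra.
Qed.

Lemma derivative_gt0_lt (F F' : R -> R) (x y : R) :
  x < y -> (forall c, x <= c <= y -> is_derive F c (F' c)) ->
  (forall c, x < c < y -> 0 < F' c) -> F x < F y.
Proof.
intros L HF Hp; destruct (mean_value_R F F' x y L HF) as (c & Hc & E); specialize (Hp c Hc).
assert (0 < F' c * (y - x)) by (apply Rmult_lt_0_compat; lra); lra.
Qed.

(** The chord slopes on both sides of the intermediate point are values of [F'] at ordered points,
    and the convexity gap is a nonnegative multiple of their difference. *)
Lemma convex_of_derivative (D : R -> Prop) (F F' : R -> R) :
  (forall x y z, D x -> D y -> x <= z <= y -> D z) ->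
  (forall x, D x -> is_derive F x (F' x)) ->
  (forall x y, D x -> D y -> x <= y -> F' x <= F' y) -> convex_on D F.
Proof.
intros HD HF Hm.
assert (K : forall x y t, D x -> D y -> x < y -> 0 < t < 1 ->
  F (t * x + (1 - t) * y) <= t * F x + (1 - t) * F y).
{ intros x y t Dx Dy Hxy Ht; set (m := t * x + (1 - t) * y).
  assert (M1 : m - x = (1 - t) * (y - x)) by (unfold m; ring).
  assert (M2 : y - m = t * (y - x)) by (unfold m; ring).
  assert (0 < (1 - t) * (y - x)) by (apply Rmult_lt_0_compat; lra).
  assert (0 < t * (y - x)) by (apply Rmult_lt_0_compat; lra).
  destruct (mean_value_R F F' x m) as (c1 & Hc1 & E1); [lra | |].
  { intros c Hc; apply HF, (HD x y); auto; lra. }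
  destruct (mean_value_R F F' m y) as (c2 & Hc2 & E2); [lra | |].
  { intros c Hc; apply HF, (HD x y); auto; lra. }
  assert (L : F' c1 <= F' c2) by (apply Hm; try apply (HD x y); auto; lra).
  rewrite M1 in E1; rewrite M2 in E2.
  assert (E : t * F x + (1 - t) * F y - F m = t * (1 - t) * (y - x) * (F' c2 - F' c1)).
  { replace (F x) with (F m - F' c1 * ((1 - t) * (y - x))) by lra.
    replace (F y) with (F m + F' c2 * (t * (y - x))) by lra; ring. }
  assert (0 <= t * (1 - t) * (y - x) * (F' c2 - F' c1)).
  { repeat apply Rmult_le_pos; lra. }
  lra. }
intros x y t Dx Dy Ht.
destruct (Req_dec t 0) as [-> | T0].
{ right; replace (0 * x + (1 - 0) * y) with y by ring; ring. }
destruct (Req_dec t 1) as [-> | T1].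
{ right; replace (1 * x + (1 - 1) * y) with x by ring; ring. }
destruct (Rtotal_order x y) as [L | [<- | L]].
- apply K; auto; lra.
- right; replace (t * x + (1 - t) * x) with x by ring; ring.
- assert (H := K y x (1 - t) Dy Dx L ltac:(lra)).
  replace (1 - (1 - t)) with t in H by ring.
  rewrite (Rplus_comm (t * x)), (Rplus_comm (t * F x)); exact H.
Qed.

Lemma derivative_gt0_right (F : R -> R) (t d : R) :
  is_derive F t d -> 0 < d -> locally t (fun s => t < s -> F t < F s).
Proof.
intros H d0; apply R_slope_inv in H; destruct H as (psi & Pc & <- & Pe).
generalize (continuous_gt_locally psi t 0 Pc d0); apply filter_imp; intros s Hs Hts.
rewrite (Pe s); assert (0 < psi s * (s - t)) by (apply Rmult_lt_0_compat; [exact Hs | now apply Rlt_0_minus]).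
lra.
Qed.

Lemma Cdiff_C_derive (F : C -> C) (z : C) : (exists m, Cdiff F z m) -> Cdiff F z (C_derive F z).
Proof.
intros [m Hm]; eapply slope_eq; [exact Hm |].
symmetry; apply is_C_derive_unique, Cdiff_is_derive, Hm.
Qed.

Lemma Pdiff_line (F : C -> C) (c a m : C) (x : R) :
  Cdiff F (Cplus c (Cmult a (RtoC x))) m -> Pdiff (fun t => F (Cplus c (Cmult a (RtoC t)))) x (Cmult m a).
Proof.
intros H; apply (Pdiff_comp x F (fun t => Cplus c (Cmult a (RtoC t)))); [exact H |].
eapply slope_eq; [apply Pdiff_plus; [apply Pdiff_const | apply Pdiff_scal, Pdiff_RtoC] | ring].
Qed.

Lemma Pdiff_ray (F : C -> C) (a m : C) (x : R) :
  Cdiff F (Cmult a (RtoC x)) m -> Pdiff (fun t => F (Cmult a (RtoC t))) x (Cmult m a).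
Proof.
intros H; apply (Pdiff_comp x F (fun t => Cmult a (RtoC t))); [exact H |].
eapply slope_eq; [apply Pdiff_scal, Pdiff_RtoC | ring].
Qed.

Lemma Creal_eq (z : C) : Cconj z = z -> z = RtoC (fst z).
Proof.
intros H; apply (f_equal snd) in H; simpl in H.
apply injective_projections; simpl; [reflexivity | lra].
Qed.

Section Ray.
Variables (Om : C -> Prop) (f : C -> C) (l : C).
Hypothesis HB : bi_circularly_symmetric Om.
Hypothesis Hf : conformal f Om.
Hypothesis f0 : f (RtoC 0) = RtoC 0.
Hypothesis fl : Cdiff f (RtoC 0) l.
Hypothesis lreal : Cconj l = l.
Hypothesis lpos : 0 < fst l.

(* The ray is [a x], [0 <= x < 1], along which [f (a x) / a] is real; [b] points
   from it into the open first quadrant.  For [a = 1], [b = i] the sign [eps] is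
   [1], for [a = i], [b = 1] it is [-1]. *)
Variables (a b : C) (eps : R).
Hypothesis a1 : Cmod a = 1.
Hypothesis aa_real : Cconj (Cmult a a) = Cmult a a.
Hypothesis f_sym : forall z, unit_disc z ->
  f (Cmult (Cmult a a) (Cconj z)) = Cmult (Cmult a a) (Cconj (f z)).
Hypothesis eps_sgn : forall X, eps * fst (Cmult X a) = snd (Cmult X b).
Hypothesis enters : forall (H : R -> C) (W la : R), 0 < W -> 0 < la ->
  H 0 = Cmult a (RtoC W) -> Pdiff H 0 (Cmult (RtoC la) b) ->
  locally 0 (fun t => 0 < t -> quadrant (H t)).

Let J (x : R) := 0 <= x < 1.
Let f1 := C_derive f.
(** [P] is z f'/f written so as to be holomorphic at 0 as well. On the ray, [W] is f(a x) / a, [la]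
    is its derivative, [G] is W / x with value Re l at 0, and [p] is x W' / W with value 1 at 0. *)
Let phi := quot f (RtoC 0) l.
Let P z := Cdiv (f1 z) (phi z).
Let W x := fst (Cmult (Cconj a) (f (Cmult a (RtoC x)))).
Let la x := fst (f1 (Cmult a (RtoC x))).
Let G x := fst (phi (Cmult a (RtoC x))).
Let p x := fst (P (Cmult a (RtoC x))).

Let fd : forall z, unit_disc z -> exists m, Cdiff f z m := proj1 Hf.
Let fi : forall z w, unit_disc z -> unit_disc w -> f z = f w -> z = w := proj1 (proj2 (proj2 Hf)).

Lemma J_interval (x y z : R) : J x -> J y -> x <= z <= y -> J z.
Proof. unfold J; lra. Qed.

Lemma ray_disc (x : R) : J x -> unit_disc (Cmult a (RtoC x)).
Proof.
intros [H1 H2]; unfold unit_disc; rewrite Cmod_mult, a1, Cmod_R, Rabs_pos_eq; lra.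
Qed.

Lemma f1_diff (z : C) : unit_disc z -> Cdiff f z (f1 z).
Proof. intros Dz; now apply Cdiff_C_derive, fd. Qed.

Lemma f1_diff2 (z : C) : unit_disc z -> exists m, Cdiff f1 z m.
Proof.
intros Dz; destruct (derivative_diff f z) as (g1 & m & L & Hm).
{ generalize (locally_unit_disc z Dz); apply filter_imp; exact fd. }
exists m; apply slope_ext_loc with (2 := Hm).
generalize (filter_and _ _ L (locally_unit_disc z Dz)); apply filter_imp; intros w [H Dw].
exact (Cdiff_unique _ _ _ _ H (f1_diff w Dw)).
Qed.

Lemma l_neq0 : l <> RtoC 0.
Proof. exact (univalent_derivative_neq0 f fd fi _ _ unit_disc_0 fl). Qed.

Lemma f_phi (z : C) : f z = Cmult z (phi z).
Proof.
unfold phi; destruct (Ceq_dec z (RtoC 0)) as [-> | N]; [rewrite f0; ring |].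
rewrite quot_off, f0 by exact N; field; intros E; apply N; rewrite <- E; ring.
Qed.

Lemma phi_neq0 (z : C) : unit_disc z -> phi z <> RtoC 0.
Proof.
intros Dz E; destruct (Ceq_dec z (RtoC 0)) as [-> | N].
- unfold phi in E; rewrite quot_at in E; exact (l_neq0 E).
- apply N, fi; [exact Dz | apply unit_disc_0 |].
  rewrite f0, f_phi, E; ring.
Qed.

Lemma phi_diff (z : C) : unit_disc z -> exists m, Cdiff phi z m.
Proof. now apply quot_holomorphic; [exact locally_unit_disc | |]. Qed.

Lemma P_diff (z : C) : unit_disc z -> exists m, Cdiff P z m.
Proof.
intros Dz; destruct (f1_diff2 z Dz) as [m Hm], (phi_diff z Dz) as [n Hn].
eexists; apply Cdiff_div; [exact Hm | exact Hn | now apply phi_neq0].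
Qed.

Lemma P_logderivative (z : C) :
  unit_disc z -> z <> RtoC 0 -> P z = Cdiv (Cmult z (f1 z)) (f z).
Proof.
intros Dz N; unfold P; rewrite (f_phi z); field; split; [now apply phi_neq0 | exact N].
Qed.

Lemma aa_unit : Cmult a (Cconj a) = RtoC 1.
Proof. now apply Cmod_1_conj. Qed.

(** The map z -> a^2 conj z is the reflection in the line through 0 and [a]; [f_sym] says that [f]
    commutes with it, so [f] maps the ray into that line. *)
Lemma ray_fixed (x : R) : Cmult (Cmult a a) (Cconj (Cmult a (RtoC x))) = Cmult a (RtoC x).
Proof.
rewrite Cmult_conj.
replace (Cconj (RtoC x)) with (RtoC x) by (apply injective_projections; simpl; ring).
transitivity (Cmult (Cmult a (Cconj a)) (Cmult a (RtoC x))); [ring | rewrite aa_unit; ring].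
Qed.

Lemma ray_W (x : R) : J x -> Cmult (Cconj a) (f (Cmult a (RtoC x))) = RtoC (W x).
Proof.
intros Jx; apply Creal_eq.
rewrite Cmult_conj, Cconj_conj.
rewrite <- (ray_fixed x) at 2; rewrite f_sym by now apply ray_disc.
transitivity (Cmult (Cmult a (Cconj a)) (Cmult a (Cconj (f (Cmult a (RtoC x)))))); [rewrite aa_unit |]; ring.
Qed.

Lemma ray_f (x : R) : J x -> f (Cmult a (RtoC x)) = Cmult a (RtoC (W x)).
Proof.
intros Jx; rewrite <- ray_W by exact Jx; rewrite Cmult_assoc, aa_unit; ring.
Qed.

(** With e = a^2, differentiating f(v) = e conj(f(e conj v)) at a fixed point of the reflection
    gives f' = conj f', since e is real and e^2 = 1. *)
Lemma ray_la (x : R) : J x -> f1 (Cmult a (RtoC x)) = RtoC (la x).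
Proof.
intros Jx; apply Creal_eq.
set (z := Cmult a (RtoC x)); set (e := Cmult a a) in *.
assert (Dz : unit_disc z) by now apply ray_disc.
assert (Ez : Cmult e (Cconj z) = z) by apply ray_fixed.
assert (ee : Cmult e e = RtoC 1).
{ rewrite <- aa_real at 2; unfold e; rewrite Cmult_conj.
  transitivity (Cmult (Cmult a (Cconj a)) (Cmult a (Cconj a))); [ring | rewrite aa_unit; ring]. }
assert (e1 : Cmod e = 1) by (unfold e; rewrite Cmod_mult, a1; ring).
assert (D : Cdiff (fun v => Cmult e (Cconj (f (Cmult e (Cconj v))))) z (Cconj (f1 z))).
{ eapply slope_eq.
  - apply Cdiff_scal, (Cdiff_conj (fun v => f (Cmult e v))).
    apply (Cdiff_comp _ f (Cmult e)); [rewrite Ez; now apply f1_diff | apply Cdiff_scal, Cdiff_id].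
  - rewrite !Cmult_conj, aa_real.
    replace (Cconj (RtoC 1)) with (RtoC 1) by (apply injective_projections; simpl; ring).
    transitivity (Cmult (Cmult e e) (Cconj (f1 z))); [ring | rewrite ee; ring]. }
apply (Cdiff_unique f z); [ | now apply f1_diff].
apply slope_ext_loc with (2 := D).
generalize (locally_unit_disc z Dz); apply filter_imp; intros v Dv.
rewrite f_sym by exact Dv; rewrite Cmult_conj, aa_real, Cconj_conj, Cmult_assoc, ee; ring.
Qed.

Lemma W_derive (x : R) : J x -> is_derive W x (la x).
Proof.
intros Jx.
assert (H : Pdiff (fun t => Cmult (Cconj a) (f (Cmult a (RtoC t)))) x (f1 (Cmult a (RtoC x)))).
{ eapply slope_eq.
  - apply Pdiff_scal, Pdiff_ray, f1_diff, ray_disc, Jx.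
  - transitivity (Cmult (Cmult a (Cconj a)) (f1 (Cmult a (RtoC x)))); [ring | rewrite aa_unit; ring]. }
exact (proj1 (Pdiff_is_derive _ _ _ H)).
Qed.

Lemma ray_0 : Cmult a (RtoC 0) = RtoC 0.
Proof. ring. Qed.

Lemma W_0 : W 0 = 0.
Proof. unfold W; rewrite ray_0, f0; simpl; ring. Qed.

Lemma f1_0 : f1 (RtoC 0) = l.
Proof. apply (Cdiff_unique f (RtoC 0)); [apply f1_diff, unit_disc_0 | exact fl]. Qed.

(** The derivative is real and continuous on the ray, never 0 by univalence, and positive at the
    origin. *)
Lemma la_pos (x : R) : J x -> 0 < la x.
Proof.
assert (N : forall y, J y -> la y <> 0).
{ intros y Jy E; apply (univalent_derivative_neq0 f fd fi _ _ (ray_disc y Jy) (f1_diff _ (ray_disc y Jy))).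
  now rewrite ray_la, E. }
intros Jx; apply Rnot_le_lt; intros Hle.
assert (L0 : 0 < la 0) by (unfold la; rewrite ray_0, f1_0; exact lpos).
assert (x0 : 0 < x).
{ destruct Jx as [[H | <-] _]; [exact H | lra]. }
destruct (IVT_interv (fun y => - la y) 0 x) as (y & Hy & Ey).
- intros y Hy; apply continuity_pt_filterlim, (continuous_opp (V := R_NormedModule)).
  assert (Jy : J y) by (unfold J in *; lra).
  destruct (f1_diff2 _ (ray_disc y Jy)) as [m Hm].
  apply (continuous_C_fst (fun t => f1 (Cmult a (RtoC t)))).
  exact (Pdiff_continuous _ _ _ (Pdiff_ray f1 a m y Hm)).
- exact x0.
- lra.
- specialize (N x Jx); lra.
- apply (N y); [unfold J in *; lra | lra].
Qed.

Lemma W_increasing (x y : R) : J x -> J y -> x < y -> W x < W y.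
Proof.
intros Jx Jy Hxy; apply derivative_gt0_lt with la; [exact Hxy | |]; intros c Hc.
- apply W_derive, (J_interval x y); auto; lra.
- apply la_pos, (J_interval x y); auto; lra.
Qed.

Lemma W_pos (x : R) : 0 < x < 1 -> 0 < W x.
Proof. intros Hx; rewrite <- W_0; apply W_increasing; unfold J; lra. Qed.

Lemma ray_G (x : R) : J x -> phi (Cmult a (RtoC x)) = RtoC (G x) /\ W x = x * G x /\ 0 < G x.
Proof.
intros Jx; unfold G.
destruct (Req_dec x 0) as [-> | N].
- rewrite ray_0, W_0; unfold phi; rewrite quot_at.
  split; [now apply Creal_eq | split; [ring | exact lpos]].
- assert (x0 : 0 < x) by (destruct Jx; lra).
  assert (Nx : RtoC x <> RtoC 0) by (intros E; apply N, RtoC_inj, E).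
  assert (E : phi (Cmult a (RtoC x)) = RtoC (W x / x)).
  { rewrite RtoC_div by exact N; rewrite <- ray_W by exact Jx; rewrite (f_phi (Cmult a (RtoC x))).
    set (ph := phi (Cmult a (RtoC x))).
    transitivity (Cdiv (Cmult (Cmult a (Cconj a)) (Cmult (RtoC x) ph)) (RtoC x));
      [rewrite aa_unit | ]; field; exact Nx. }
  rewrite E; simpl; split; [reflexivity | split; [field; exact N |]].
  apply Rdiv_lt_0_compat; [apply W_pos; unfold J in Jx; lra | exact x0].
Qed.

Lemma ray_p (x : R) : J x -> P (Cmult a (RtoC x)) = RtoC (p x) /\ la x = p x * G x.
Proof.
intros Jx; destruct (ray_G x Jx) as (E & _ & G0).
assert (K : P (Cmult a (RtoC x)) = RtoC (la x / G x)).
{ unfold P; rewrite ray_la, E, RtoC_div by (assumption || lra); reflexivity. }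
unfold p; rewrite K; simpl; split; [reflexivity | field; lra].
Qed.

Let G' x := fst (Cmult (C_derive phi (Cmult a (RtoC x))) a).
Let p' x := fst (Cmult (C_derive P (Cmult a (RtoC x))) a).

Lemma G_derive (x : R) : J x -> is_derive G x (G' x).
Proof.
intros Jx; assert (H := Cdiff_C_derive phi _ (phi_diff _ (ray_disc x Jx))).
exact (proj1 (Pdiff_is_derive _ _ _ (Pdiff_ray phi a _ x H))).
Qed.

Lemma p_derive (x : R) : J x -> is_derive p x (p' x).
Proof.
intros Jx; assert (H := Cdiff_C_derive P _ (P_diff _ (ray_disc x Jx))).
exact (proj1 (Pdiff_is_derive _ _ _ (Pdiff_ray P a _ x H))).
Qed.

(* [Im P] vanishes on the ray and is nonnegative on the [b] side of it. *)
Lemma eps_p'_ge0 (x : R) : 0 < x < 1 -> 0 <= eps * p' x.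
Proof.
intros Hx; assert (Jx : J x) by (unfold J; lra); assert (Dx := ray_disc x Jx).
set (z := Cmult a (RtoC x)) in *.
assert (z0 : Cplus z (Cmult b (RtoC 0)) = z) by ring.
assert (DP := Cdiff_C_derive P _ (P_diff _ Dx)); rewrite <- z0 in DP.
apply Pdiff_line, Pdiff_is_derive in DP; destruct DP as [_ DP]; rewrite z0 in DP.
(* Since b is a turned by a right angle, eps Re(P'(z) a) = Im(P'(z) b), the derivative of Im P
   across the ray. The one-sided test gives upper bounds, hence the passage to - Im P. *)
unfold p'; rewrite eps_sgn; fold z.
assert (DP' := is_derive_opp _ _ _ DP).
apply derivative_le_0_right in DP'; [unfold opp in DP'; simpl in DP' |- *; lra |].
assert (Df := f1_diff z Dx); rewrite <- z0 in Df; apply Pdiff_line in Df.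
rewrite z0 in Df.
assert (E1 : f1 z = RtoC (la x)) by now apply ray_la.
assert (E2 : f z = Cmult a (RtoC (W x))) by now apply ray_f.
rewrite E1 in Df.
(* The image path leaves a W(x) with velocity W'(x) b, hence enters the open quadrant, where
   [quadrant_logderivative] applies. *)
assert (Q := enters (fun t => f (Cplus z (Cmult b (RtoC t)))) (W x) (la x) (W_pos x Hx) (la_pos x Jx)).
simpl in Q; rewrite z0 in Q; specialize (Q E2 Df).
assert (cl : continuous (fun t => Cplus z (Cmult b (RtoC t))) 0).
{ apply continuous_Cplus; [apply continuous_const |].
  apply continuous_Cmult; [apply continuous_const | apply RtoC_cont]. }
assert (LD : locally 0 (fun t => unit_disc (Cplus z (Cmult b (RtoC t))))).
{ apply (continuous_locally _ _ _ cl); rewrite z0; now apply locally_unit_disc. }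
generalize (filter_and _ _ Q LD); apply filter_imp; intros t [Qt Dt] t0; specialize (Qt t0).
assert (N : Cplus z (Cmult b (RtoC t)) <> RtoC 0).
{ intros E; rewrite E, f0 in Qt; destruct Qt as [Qt _]; simpl in Qt; lra. }
rewrite z0; unfold z at 2; rewrite (proj1 (ray_p x Jx)).
rewrite P_logderivative by assumption.
assert (R := quadrant_logderivative Om f l HB Hf f0 fl lreal _ _ Dt (f1_diff _ Dt) Qt).
unfold opp; simpl in R |- *; lra.
Qed.

Lemma eps_p_ge1 (x : R) : J x -> 0 <= eps * (p x - 1).
Proof.
intros Jx.
assert (E0 : p 0 = 1).
{ unfold p, P; rewrite ray_0, f1_0; unfold phi; rewrite quot_at.
  unfold Cdiv; rewrite Cinv_r by exact l_neq0; reflexivity. }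
assert (H : eps * p 0 <= eps * p x).
{ apply (derivative_ge0_le (fun y => eps * p y) (fun y => eps * p' y)); [apply Jx | |]; intros c Hc.
  - apply (is_derive_scal p), p_derive; unfold J in *; lra.
  - apply eps_p'_ge0; unfold J in *; lra. }
rewrite E0 in H; lra.
Qed.

(** Differentiating W = x G and using W' = p G gives x G' = (p - 1) G, whose sign is known from
    [eps_p_ge1]. *)
Lemma eps_G'_ge0 (x : R) : 0 < x < 1 -> 0 <= eps * G' x.
Proof.
intros Hx; assert (Jx : J x) by (unfold J; lra).
destruct (ray_G x Jx) as (_ & _ & G0); destruct (ray_p x Jx) as [_ El].
assert (D1 := W_derive x Jx).
assert (D2 : is_derive W x (1 * G x + x * G' x)).
{ apply is_derive_ext_loc with (fun y => y * G y).
  - assert (L : locally x (fun y => 0 < y < 1)).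
    { apply filter_and; [apply (open_gt 0) | apply (open_lt 1)]; apply Hx. }
    revert L; apply filter_imp; intros y Hy; symmetry; apply ray_G; unfold J; lra.
  - apply (is_derive_mult (K := R_AbsRing) (fun y => y) G); [exact (is_derive_id (K := R_AbsRing) x) | now apply G_derive | apply Rmult_comm]. }
apply is_derive_unique in D1; apply is_derive_unique in D2; rewrite D1 in D2.
assert (E : x * (eps * G' x) = eps * (p x - 1) * G x).
{ rewrite El in D2; replace (x * (eps * G' x)) with (eps * (x * G' x)) by ring.
  replace (x * G' x) with (p x * G x - G x) by lra; ring. }
assert (K := eps_p_ge1 x Jx).
apply Rmult_le_reg_l with x; [apply Hx |]; rewrite Rmult_0_r, E.
apply Rmult_le_pos; lra.
Qed.

(** The product rule for W' = p G. The factors [p] and [G] are positive for either sign of [eps], so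
    both terms carry the sign of [eps]. *)
Lemma eps_la_increasing (x y : R) : J x -> J y -> x <= y -> eps * la x <= eps * la y.
Proof.
intros Jx Jy Hxy.
rewrite (proj2 (ray_p x Jx)), (proj2 (ray_p y Jy)).
apply (derivative_ge0_le (fun c => eps * (p c * G c)) (fun c => eps * (p' c * G c + p c * G' c)));
  [exact Hxy | |]; intros c Hc.
- apply (is_derive_scal (fun c => p c * G c)).
  apply (is_derive_mult (K := R_AbsRing) p G); [apply p_derive | apply G_derive | apply Rmult_comm];
    unfold J in *; lra.
- assert (Jc : J c) by (unfold J in *; lra).
  destruct (ray_G c Jc) as (_ & _ & G0); destruct (ray_p c Jc) as [_ El].
  assert (p0 : 0 < p c).
  { apply Rmult_lt_reg_r with (1 := G0); rewrite <- El, Rmult_0_l; now apply la_pos. }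
  assert (c0 : 0 < c < 1) by (unfold J in *; lra).
  assert (H1 := eps_p'_ge0 c c0); assert (H2 := eps_G'_ge0 c c0).
  replace (eps * (p' c * G c + p c * G' c)) with (eps * p' c * G c + p c * (eps * G' c)) by ring.
  apply Rplus_le_le_0_compat; apply Rmult_le_pos; lra.
Qed.

Lemma eps_W_convex : convex_on J (fun x => eps * W x).
Proof.
apply convex_of_derivative with (fun x => eps * la x).
- exact J_interval.
- intros x Jx; now apply (is_derive_scal W), W_derive.
- exact eps_la_increasing.
Qed.

End Ray.

Theorem theorem4p2 :
  forall (Omega : C -> Prop) (f : C -> C),
    plane_domain Omega ->
    bi_circularly_symmetric Omega ->
    simply_connected Omega ->
    (exists z : C, ~ Omega z) ->
    Omega (RtoC 0) ->
    conformal_mapping f Omega ->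
    f (RtoC 0) = RtoC 0 ->
    (Im (C_derive f (RtoC 0)) = 0 /\ 0 < Re (C_derive f (RtoC 0))) ->
    let J := fun x : R => 0 <= x < 1 in
    let u := fun x : R => f (RtoC x) in
    let v := fun y : R => Copp (Cmult Ci (f (Cmult Ci (RtoC y)))) in
    (real_valued_on J u /\
     strictly_increasing_on J (fun x => Re (u x)) /\
     convex_on J (fun x => Re (u x)) /\
     (forall x, 0 < x < 1 -> 0 < Re (u x))) /\
    (real_valued_on J v /\
     strictly_increasing_on J (fun y => Re (v y)) /\
     concave_on J (fun y => Re (v y)) /\
     (forall y, 0 < y < 1 -> 0 < Re (v y))).
Proof.
intros Omega f _ HB _ _ _ (Hh & HO & Hi & Hs) f0 (lim & lre) J u v.
assert (fd : forall z, unit_disc z -> exists m, Cdiff f z m).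
{ intros z Dz; destruct (Hh z Dz) as [m Hm]; exists m; now apply is_derive_Cdiff. }
assert (Hf : conformal f Omega) by (repeat split; assumption).
set (l := C_derive f (RtoC 0)) in *.
assert (fl : Cdiff f (RtoC 0) l) by apply Cdiff_C_derive, fd, unit_disc_0.
assert (lreal : Cconj l = l).
{ apply injective_projections; simpl; [reflexivity |]; change (- Im l = Im l); rewrite lim; ring. }
assert (u_eq : forall x, Cmult (Cconj (RtoC 1)) (f (Cmult (RtoC 1) (RtoC x))) = u x).
{ intros x; unfold u; replace (Cmult (RtoC 1) (RtoC x)) with (RtoC x) by ring.
  apply injective_projections; simpl; ring. }
assert (v_eq : forall x, Cmult (Cconj Ci) (f (Cmult Ci (RtoC x))) = v x).
{ intros x; unfold v; apply injective_projections; simpl; ring. }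
assert (pos : forall (h : R -> R) t, continuous h t -> 0 < h t -> locally t (fun s => 0 < h s)).
{ intros h t Hc; now apply continuous_gt_locally. }
split.
(* Real axis: a = 1, b = i, eps = 1, and the reflection is conjugation. *)
- assert (S : forall z, unit_disc z -> f (Cmult (Cmult (RtoC 1) (RtoC 1)) (Cconj z)) =
            Cmult (Cmult (RtoC 1) (RtoC 1)) (Cconj (f z))).
  { intros z Dz; replace (Cmult (Cmult (RtoC 1) (RtoC 1)) (Cconj z)) with (Cconj z) by ring.
    rewrite (f_conj Omega f l HB Hf f0 fl lreal z Dz); ring. }
  assert (R1 : Cconj (Cmult (RtoC 1) (RtoC 1)) = Cmult (RtoC 1) (RtoC 1))
    by (apply injective_projections; simpl; ring).
  assert (E : forall (H : R -> C) (W la : R), 0 < W -> 0 < la ->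
     H 0 = Cmult (RtoC 1) (RtoC W) -> Pdiff H 0 (Cmult (RtoC la) Ci) ->
     locally 0 (fun t => 0 < t -> quadrant (H t))).
  { intros H W la W0 la0 H0 HP; assert (Hc := Pdiff_continuous _ _ _ HP).
    apply Pdiff_is_derive in HP; destruct HP as [_ HP].
    assert (L1 : locally 0 (fun t => 0 < fst (H t))).
    { apply (pos (fun t => fst (H t))); [now apply continuous_C_fst | rewrite H0; simpl; lra]. }
    assert (Z : snd (H 0) = 0) by (rewrite H0; simpl; ring).
    assert (L2 := derivative_gt0_right _ _ _ HP ltac:(simpl; lra)).
    generalize (filter_and _ _ L1 L2); apply filter_imp; intros t [A B] t0.
    specialize (B t0); rewrite Z in B; split; assumption. }
  assert (sg : forall X, 1 * fst (Cmult X (RtoC 1)) = snd (Cmult X Ci)) by (intros; simpl; ring).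
  repeat split.
  + intros x Jx; rewrite <- u_eq, (ray_W f (RtoC 1) Cmod_1 S x Jx); reflexivity.
  + intros x y Jx Jy Hxy; rewrite <- !u_eq.
    exact (W_increasing Omega f l Hf fl lre (RtoC 1) Cmod_1 R1 S x y Jx Jy Hxy).
  + assert (K := eps_W_convex Omega f l HB Hf f0 fl lreal lre (RtoC 1) Ci 1 Cmod_1 R1 S sg E).
    intros x y t Jx Jy Ht; specialize (K x y t Jx Jy Ht); rewrite <- !u_eq; unfold Re; lra.
  + intros x Hx; rewrite <- u_eq.
    exact (W_pos Omega f l Hf f0 fl lre (RtoC 1) Cmod_1 R1 S x Hx).
(* Imaginary axis: a = i, b = 1; the reflection z -> - conj z combines oddness with conjugation. *)
- assert (I2 : Cmult Ci Ci = Copp (RtoC 1)) by (apply injective_projections; simpl; ring).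
  assert (S : forall z, unit_disc z -> f (Cmult (Cmult Ci Ci) (Cconj z)) =
            Cmult (Cmult Ci Ci) (Cconj (f z))).
  { intros z Dz; rewrite I2; replace (Cmult (Copp (RtoC 1)) (Cconj z)) with (Copp (Cconj z)) by ring.
    rewrite (f_odd Omega f l HB Hf f0 fl) by now apply unit_disc_conj.
    rewrite (f_conj Omega f l HB Hf f0 fl lreal z Dz); ring. }
  assert (R1 : Cconj (Cmult Ci Ci) = Cmult Ci Ci) by (apply injective_projections; simpl; ring).
  assert (E : forall (H : R -> C) (W la : R), 0 < W -> 0 < la ->
     H 0 = Cmult Ci (RtoC W) -> Pdiff H 0 (Cmult (RtoC la) (RtoC 1)) ->
     locally 0 (fun t => 0 < t -> quadrant (H t))).
  { intros H W la W0 la0 H0 HP; assert (Hc := Pdiff_continuous _ _ _ HP).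
    apply Pdiff_is_derive in HP; destruct HP as [HP _].
    assert (L1 : locally 0 (fun t => 0 < snd (H t))).
    { apply (pos (fun t => snd (H t))); [now apply continuous_C_snd | rewrite H0; simpl; lra]. }
    assert (Z : fst (H 0) = 0) by (rewrite H0; simpl; ring).
    assert (L2 := derivative_gt0_right _ _ _ HP ltac:(simpl; lra)).
    generalize (filter_and _ _ L1 L2); apply filter_imp; intros t [A B] t0.
    specialize (B t0); rewrite Z in B; split; assumption. }
  (* The first quadrant now lies clockwise of the ray, whence eps = -1: convexity of -W is the
     concavity claimed. *)
  assert (sg : forall X, -1 * fst (Cmult X Ci) = snd (Cmult X (RtoC 1))) by (intros; simpl; ring).
  repeat split.
  + intros x Jx; rewrite <- v_eq, (ray_W f Ci Cmod_Ci S x Jx); reflexivity.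
  + intros x y Jx Jy Hxy; rewrite <- !v_eq.
    exact (W_increasing Omega f l Hf fl lre Ci Cmod_Ci R1 S x y Jx Jy Hxy).
  + assert (K := eps_W_convex Omega f l HB Hf f0 fl lreal lre Ci (RtoC 1) (-1) Cmod_Ci R1 S sg E).
    intros x y t Jx Jy Ht; specialize (K x y t Jx Jy Ht); rewrite <- !v_eq; unfold Re; lra.
  + intros x Hx; rewrite <- v_eq.
    exact (W_pos Omega f l Hf f0 fl lre Ci Cmod_Ci R1 S x Hx).
Qed.
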